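(* Let $\alpha:\mathbb{N}\to\mathbb{N}$ satisfy $$\liminf_{n\to\infty}\alpha(n)\ge 4 \qquad\text{and}\qquad \limsup_{n\to\infty}\frac{\alpha(n)}{n}\,\log(n)\,\bigl(\log(\log(n))\bigr)^2<\frac{1}{12\pi^2\mathrm{e}}.$$ Then for all $z\in\mathbb{R}$, $$\lim_{n\to\infty}\mathbb{P}_{n,\alpha}\Bigl(C-m_{n,\alpha}\le z\sqrt{v_{n,\alpha}}\Bigr)=\Phi(z),$$ where $\Phi$ is the distribution function of the standard normal distribution.
   Context: $\mathbb{N}$ denotes the positive integers. For $\alpha:\mathbb{N}\to\mathbb{N}$, $S_{n,\alpha}$ is the set of permutations $\sigma\in S_n$ (the symmetric group on $n$ elements) all of whose cycles have length at most $\alpha(n)$, and $\mathbb{P}_{n,\alpha}$ is the uniform distribution on $S_{n,\alpha}$. For a permutation $\sigma\in S_n$, $c_j(\sigma)$ is the number of cycles of length $j$ in $\sigma$, and $C(\sigma)=\sum_{j=1}^n c_j(\sigma)$ is the total number of cycles (fixed points count as cycles of length 1). For $w$ in a neighbourhood $(1-\delta,1+\delta)$ of $1$ with $0<\delta<1$, $x_{n,\alpha}(w)$ denotes the unique positive solution $x$ of $\sum_{j=1}^{\alpha(n)}x^j=\frac{n}{w}$. It is a smooth function of $w$, and $x_{n,\alpha}'$ denotes its derivative with respect to $w$. Define $$m_{n,\alpha}:=\sum_{j=1}^{\alpha(n)}\frac{x_{n,\alpha}(1)^j}{j},\qquad v_{n,\alpha}:=m_{n,\alpha}+n\,\frac{x_{n,\alpha}'(1)}{x_{n,\alpha}(1)}.$$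 *)

(* Defs.v *)
From HB Require Import structures.
From mathcomp Require Import all_boot all_order all_algebra all_fingroup.
From mathcomp Require Import all_classical all_reals all_analysis.

Set Implicit Arguments.
Unset Strict Implicit.
Unset Printing Implicit Defensive.

Import Order.TTheory GRing.Theory Num.Theory.
Import numFieldNormedType.Exports.

Local Open Scope ring_scope.

(* The cycles of s, fixed points included, are its orbits [porbits s]. *)
Definition cycle_count (n j : nat) (s : 'S_n) : nat :=
  #|[set A in porbits s | #|A| == j]%SET|.

Definition num_cycles (n : nat) (s : 'S_n) : nat :=
  (\sum_(1 <= j < n.+1) cycle_count j s)%N.

Definition bounded_cycle_perms (n a : nat) : {set 'S_n} :=
  [set s : 'S_n | [forall A in porbits s, (#|A| <= a)%N]]%SET.

Definition unif_prob (R : realType) (n a : nat) (E : pred 'S_n) : R :=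
  #|[set s in bounded_cycle_perms n a | E s]%SET|%:R
  / #|bounded_cycle_perms n a|%:R.

Definition is_saddle (R : realType) (n a : nat) (w x : R) : Prop :=
  0 < x /\ \sum_(1 <= j < a.+1) x ^+ j = n%:R / w.

(* The solution exists and is unique when n, a and w are positive; see
   [saddleP] and [saddle_uniq]. Elsewhere the value is irrelevant. *)
Definition saddle (R : realType) (n a : nat) (w : R) : R :=
  xget 0 [set x : R | is_saddle n a w x]%classic.

Definition mean_cycles (R : realType) (n a : nat) : R :=
  \sum_(1 <= j < a.+1) saddle n a 1 ^+ j / j%:R.

Definition var_cycles (R : realType) (n a : nat) : R :=
  let x : R -> R := saddle n a in
  mean_cycles R n a + n%:R * ((x^`()%classic 1 : R) / x 1).

Definition std_normal_cdf (R : realType) (z : R) : R :=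
  fine (normal_prob (0 : R) 1 `]-oo, z]%classic).

Lemma saddle_uniq (R : realType) (n a : nat) (w x y : R) :
  (0 < a)%N -> is_saddle n a w x -> is_saddle n a w y -> x = y.
Proof.
move=> a0; wlog xy : x y / x <= y => [H hx hy|[x0 hx] [y0 hy]].
  by case: (leP x y) => [|/ltW] h; [exact: H|apply/esym/H].
apply/eqP; rewrite eq_le xy leNgt; apply/negP => ltxy.
suff : \sum_(1 <= j < a.+1) x ^+ j < \sum_(1 <= j < a.+1) y ^+ j.
  by rewrite hx hy ltxx.
rewrite !(big_nat_recl _ _ _ a0) ?expr1; apply: ltr_leD => //.
by apply: ler_sum => j _; rewrite lerXn2r // nnegrE ltW.
Qed.

Lemma saddleP (R : realType) (n a : nat) (w : R) :
  (0 < n)%N -> (0 < a)%N -> 0 < w -> is_saddle n a w (saddle n a w).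
Proof.
move=> n0 a0 w0; rewrite /saddle; case: xgetP => // noneP; exfalso.
have nw0 : 0 < n%:R / w :> R by rewrite divr_gt0 ?ltr0n.
pose p : {poly R} := \sum_(1 <= j < a.+1) 'X^j - (n%:R / w)%:P.
have pE x : p.[x] = \sum_(1 <= j < a.+1) x ^+ j - n%:R / w.
  by rewrite !hornerE horner_sum; congr (_ - _);
     apply: eq_bigr => j _; rewrite hornerXn.
have p0 : p.[0] = - (n%:R / w).
  rewrite pE big_nat_cond big1 ?sub0r// => j; rewrite andbT => /andP[j1 _].
  by rewrite expr0n -[j]prednK.
have [|x /andP[x0 _] /rootP px] := @poly_ivt R p 0 (n%:R / w) (ltW nw0).
  rewrite p0 oppr_le0 ltW//= pE (big_nat_recl _ _ _ a0) expr1.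
  rewrite [X in X - _]addrC addrK; apply: sumr_ge0 => j _.
  by rewrite exprn_ge0 // ltW.
apply: (noneP x); split; last by apply/eqP; rewrite -subr_eq0 -pE px.
rewrite lt_neqAle x0 andbT; apply/eqP => x00.
by move: px; rewrite -x00 p0 => /eqP; rewrite oppr_eq0 gt_eqF.
Qed.

(* Main.v *)
Require Import Defs.
From mathcomp Require Import all_boot all_order all_algebra all_fingroup.
From mathcomp Require Import all_classical all_reals all_analysis.
From mathcomp Require Import measurable_realfun ring lra zify.
Set Implicit Arguments.
Unset Strict Implicit.
Unset Printing Implicit Defensive.
Import Order.TTheory GRing.Theory Num.Theory.
Import numFieldNormedType.Exports.
Local Open Scope ring_scope.

(** Let [x] be the saddle point for [w = 1] and [q_j = x ^ j / j]. The generating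
function of permutations with cycle lengths at most [a], with [u] marking
cycles, is [exp (\sum_(j <= a) u * z ^ j / j)]; on the circle [|z| = x] it says
that the cycle counts behave like independent Poisson variables of means [q_j]
conditioned on total size [n]. The choice of [x] makes the expected total size
[\sum_j j * q_j] equal to [n], the expected number of cycles is
[m = \sum_j q_j], and conditioning removes from its variance the part explained
by the total size: with [l2 = \sum_j j ^ 2 * q_j], implicit differentiation of
the saddle equation gives
[v = m - n ^ 2 / l2 = \sum_j q_j * (1 - j * n / l2) ^ 2] ([var_cyclesE]).

An exact formula. Removing the cycle through a given point yields a recursion
for [\sum_s f (number of cycles of s)] ([cycle_totalS]). The Fourier
coefficients of [exp (\sum_j q_j * e ^ (i (c_j + j * kap * t)))] satisfy the same
recursion, because the derivative of a periodic function has integral zero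
([fourier_coeff_rec]); those of negative index vanish and the constant one is
explicit, because they depend on the radius of the circle of integration only
through a power of it ([fourier_coeff_scale]). Hence the two agree
([cycle_total_fourier]), and the characteristic function of the number of cycles,
centred at [m], is a ratio of two integrals ([char_fun_saddle]). All of this is
done with real integrals: instead of [e ^ (i s)] the function [cos (s - b)] is
used with an arbitrary phase [b], which carries the real and the imaginary part.

Asymptotics. Take the angle [th = tau / sqrt v] for the number of cycles and
[psi = t / sqrt l2] for the size. Shifting the size angle by [th * n / l2] turns
the phase of length [j] into [th * (1 - j * n / l2) + j * psi], and the quadratic
form [\sum_j q_j * phase_j ^ 2] becomes [th ^ 2 * v + psi ^ 2 * l2 = tau ^ 2 + t ^ 2]
([sum_phase_sqr]). All phases tend to [0] at fixed [t], so that the integrand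
tends to [e ^ (- (tau ^ 2 + t ^ 2) / 2)] up to the factor [cos b] ([cos_defect_near],
[sin_defect_near]). Here [v] tends to infinity since lengths below [a / 4] already
contribute a power of [n / a] ([count_variance_ge]); this uses [a >= 4].

Domination. If [a * |psi| <= 3], every phase is small enough for
[1 - cos y >= y ^ 2 / 8], and the integrand is below [e ^ (- t ^ 2 / 8)]. Otherwise the
sum [\sum_j x ^ j * cos phase_j] is geometric, and with
[g = a ^ 2 * (x - 1) ^ 2 / x] it is smaller than [n] by the fraction [1 / (2 * (g + 1))] of
[n], up to a bounded multiple of [a]; so the modulus of the integrand is at most
[exp (4 - B / (2 * (g + 1)))] with [B = n / a] ([cos_defect_tail]). Since [a * ln x] is
at most [2 * ln (2 * B)], [g] is at most [8 * ln (2 * B) ^ 2] when [x <= 2]; the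
hypothesis on [alpha], in the form [B >= 243 * ln n * (ln (ln n)) ^ 2], then makes the
exponent at most [- 3 * ln n]. When [x >= 2], [a] is at most [2 * ln n] and [B] is so
large that this holds as well ([tail_exponent_ge]). Finally [n ^ -3] is below
[1 / (1 + t ^ 2)] over the whole period once [n >= 13]. The dominated convergence theorem gives the limit of the integrals
([saddle_integral_cvg]), so the characteristic functions of
[(C - m) / sqrt v] tend to [e ^ (- tau ^ 2 / 2)].

From characteristic functions to distribution functions. Adding an independent
centred Gaussian of variance [s ^ 2] gives a density that is an absolutely
convergent integral of the characteristic function; it converges pointwise, thus
in [L^1] by Scheffe's lemma, and [s] may then tend to [0]
([continuity_theorem_normal]). *)

(** * Decomposing a permutation along the cycle of a point *)

Section CycleDecomposition.
(* The set operations of this section are those on finite sets. *)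
Import mathcomp.boot.fintype mathcomp.boot.finset.
Variable T : finType.
Implicit Types (A B : {set T}) (s c t : {perm T}) (x y : T).

Definition cycles_in A s : nat := #|porbit s @: A|.

Definition short_cycles_in (a : nat) A s : bool :=
  [forall y in A, (#|porbit s y| <= a)%N].

(** Permutations of different supports are compared on a common invariant set. *)
Lemma porbit_agree A s c x : x \in A -> {in A, s =1 c} -> {in A, forall y, c y \in A} ->
  porbit s x = porbit c x.
Proof.
move=> xA sc cA.
have pw i : (s ^+ i)%g x = (c ^+ i)%g x /\ (c ^+ i)%g x \in A.
  elim: i => [|i [IH IA]]; first by rewrite !expg0 !perm1.
  by rewrite !expgSr !permM IH sc //; split => //; exact: cA.
apply/setP => y; apply/porbitP/porbitP => -[i ->]; exists i; first exact: (pw i).1.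
by rewrite (pw i).1.
Qed.

Lemma porbit_perm_on A s x : perm_on A s -> x \in A -> porbit s x \subset A.
Proof.
move=> As xA; apply/subsetP => y /porbitP[i ->].
by elim: i => [|i IH]; rewrite ?expg0 ?perm1 // expgSr permM perm_closed.
Qed.

Lemma porbit_stable s x : s \in ('N(porbit s x | 'P))%g.
Proof.
rewrite !inE /=; apply/subsetP => y; rewrite inE /= apermE.
by move=> /porbitP[i ->]; rewrite -permM -expgSr mem_porbit.
Qed.

Section Product.
Variables (A B : {set T}) (c t : {perm T}).
Hypotheses (Bc : perm_on B c) (Dt : perm_on (A :\: B) t).

Lemma mul_permEl y : y \in B -> (c * t)%g y = c y.
Proof.
move=> yB; rewrite permM (out_perm Dt) // inE perm_closed // yB //.
Qed.

Lemma mul_permEr y : y \in A :\: B -> (c * t)%g y = t y.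
Proof. by rewrite inE => /andP[yB _]; rewrite permM (out_perm Bc). Qed.

Lemma porbit_mull y : y \in B -> porbit (c * t) y = porbit c y.
Proof.
move=> yB; apply: (porbit_agree yB) => z zB; first exact: mul_permEl.
by rewrite perm_closed.
Qed.

Lemma porbit_mulr y : y \in A :\: B -> porbit (c * t) y = porbit t y.
Proof.
move=> yB; apply: (porbit_agree yB) => z zB; first exact: mul_permEr.
by rewrite perm_closed.
Qed.

End Product.

(** A permutation of [A] is the same as the cycle through [x] together with a
permutation of the points of [A] off that cycle. *)
Lemma sum_perm_split (V : nmodType) x A B (F : {perm T} -> V) :
  x \in B -> B \subset A ->
  \sum_(s | perm_on A s && (porbit s x == B)) F s =
  \sum_(c | perm_on B c && (porbit c x == B))
    \sum_(t | perm_on (A :\: B) t) F (c * t)%g.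
Proof.
move=> xB BA; rewrite pair_big /=.
pose h (p : {perm T} * {perm T}) := (p.1 * p.2)%g.
pose h' (s : {perm T}) := (restr_perm B s, restr_perm (A :\: B) s).
have stab s : perm_on A s && (porbit s x == B) ->
  (s \in 'N(B | 'P))%g /\ (s \in 'N(A :\: B | 'P))%g.
  move=> /andP[As /eqP sB].
  have nB : (s \in 'N(B | 'P))%g by rewrite -sB porbit_stable.
  split=> //; rewrite !inE /=; apply/subsetP => y; rewrite !inE /= apermE.
  by rewrite (perm_closed _ As) (astabsP nB).
rewrite (reindex_onto h h') /=; last first.
  move=> s Hs; have [nB nD] := stab s Hs; case/andP: Hs => As _.
  apply/permP => y; rewrite /h /=.
  case: (boolP (y \in B)) => yB.
    by rewrite (mul_permEl (restr_perm_on B s) (restr_perm_on _ s)) // restr_permE.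
  case: (boolP (y \in A)) => yA.
    have yD : y \in A :\: B by rewrite inE yB.
    by rewrite (mul_permEr _ (restr_perm_on B s) yD) restr_permE.
  rewrite permM (out_perm (restr_perm_on B s)) // (out_perm As) //.
  by rewrite (out_perm (restr_perm_on _ s)) // inE (negPf yA) andbF.
apply: eq_bigl => -[c t] /=; apply/andP/idP; rewrite /h /h' /=.
  case=> /andP[_ cx] /eqP[E1 E2].
  have Bc : perm_on B c by rewrite -E1 restr_perm_on.
  have Dt : perm_on (A :\: B) t by rewrite -E2 restr_perm_on.
  by rewrite Bc Dt /= andbT -(porbit_mull Bc Dt xB).
case/andP => /andP[Bc cx] Dt.
have xA : x \in A by apply: (subsetP BA).
have As : perm_on A (c * t)%g.
  apply: perm_onM; first by apply: subset_trans Bc BA.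
  by apply: subset_trans Dt _; apply: subsetDl.
have Hs : perm_on A (c * t)%g && (porbit (c * t) x == B).
  by rewrite As (porbit_mull Bc Dt xB).
have [nB nD] := stab _ Hs; split=> //.
apply/eqP; congr pair; apply/permP => y.
  case: (boolP (y \in B)) => yB.
    by rewrite restr_permE // (mul_permEl Bc Dt).
  by rewrite (out_perm (restr_perm_on _ _)) // (out_perm Bc).
case: (boolP (y \in A :\: B)) => yB.
  by rewrite restr_permE // (mul_permEr _ Bc yB).
by rewrite (out_perm (restr_perm_on _ _)) // (out_perm Dt).
Qed.

Lemma cycles_in_mul x A B c t : x \in B -> B \subset A -> perm_on B c ->
  perm_on (A :\: B) t -> porbit c x = B ->
  cycles_in A (c * t)%g = (cycles_in (A :\: B) t).+1.
Proof.
move=> xB BA Bc Dt cx; rewrite /cycles_in.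
have -> : porbit (c * t) @: A = B |: (porbit t @: (A :\: B)).
  rewrite -{1}(setID A B) (setIidPr BA) imsetU; congr (_ :|: _); last first.
    by apply: eq_in_imset => y yD; rewrite (porbit_mulr Bc Dt).
  apply/setP => C; rewrite inE; apply/imsetP/eqP.
    move=> [y yB ->]; rewrite (porbit_mull Bc Dt) //.
    by rewrite -cx; apply/eqP; rewrite eq_porbit_mem cx.
  by move=> ->; exists x => //; rewrite (porbit_mull Bc Dt).
rewrite cardsU1; case: imsetP => // -[y yD].
have := porbit_id t y; move=> /[swap] <-.
by move: yD; rewrite inE => /andP[/negPf->].
Qed.

Lemma short_cycles_mul a x A B c t : x \in B -> B \subset A -> perm_on B c ->
  perm_on (A :\: B) t -> porbit c x = B ->
  short_cycles_in a A (c * t)%g = (#|B| <= a)%N && short_cycles_in a (A :\: B) t.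
Proof.
move=> xB BA Bc Dt cx; apply/forall_inP/andP.
  move=> H; split.
    by have := H x (subsetP BA _ xB); rewrite (porbit_mull Bc Dt xB) cx.
  apply/forall_inP => y yD; rewrite -(porbit_mulr Bc Dt yD); apply: H.
  by move: yD; rewrite inE => /andP[].
move=> [Ba /forall_inP H] y yA; case: (boolP (y \in B)) => yB.
  rewrite (porbit_mull Bc Dt yB).
  have /eqP-> : porbit c y == B by rewrite -cx eq_porbit_mem cx.
  by [].
have yD : y \in A :\: B by rewrite inE yB.
by rewrite (porbit_mulr Bc Dt yD) H.
Qed.

(** Permutations of an arbitrary subset [A] of a fixed type are used, so that the
points that remain after removing a cycle are again of this kind. *)
Definition cycle_sum (V : nmodType) a A (f : nat -> V) : V :=
  \sum_(s | perm_on A s && short_cycles_in a A s) f (cycles_in A s).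

Definition n_full_cycles x B : nat :=
  #|[pred c : {perm T} | perm_on B c && (porbit c x == B)]|.

(** The cycle of [x] is one cycle more than those of the other points, hence the
successor in [f \o S]. *)
Lemma cycle_sum_rec_sets (V : nmodType) a A x (f : nat -> V) : x \in A ->
  cycle_sum a A f =
  \sum_(B : {set T} | (x \in B) && (B \subset A))
    (if (#|B| <= a)%N then cycle_sum a (A :\: B) (f \o S) else 0) *+ n_full_cycles x B.
Proof.
move=> xA; rewrite /cycle_sum big_mkcondr /=.
rewrite (partition_big (fun s => porbit s x)
  (fun B => (x \in B) && (B \subset A))) /=; last first.
  by move=> s As; rewrite porbit_id porbit_perm_on.
apply: eq_bigr => B /andP[xB BA].
rewrite (sum_perm_split _ xB BA) /n_full_cycles -sumr_const.
apply: eq_bigr => c /andP[Bc /eqP cx].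
case: ifP => Ba; last first.
  by apply: big1 => t Dt; rewrite (short_cycles_mul a xB BA Bc Dt cx) Ba.
rewrite [RHS]big_mkcondr /=; apply: eq_bigr => t Dt.
by rewrite (short_cycles_mul a xB BA Bc Dt cx) Ba (cycles_in_mul xB BA Bc Dt cx).
Qed.

(** Group the sets [B] by the number [j] of their points other than [x]. *)
Lemma sum_subsets_through (V : nmodType) x A (g : nat -> V) : x \in A ->
  \sum_(B : {set T} | (x \in B) && (B \subset A)) g #|B| =
  \sum_(j < #|A|) g j.+1 *+ 'C(#|A|.-1, j).
Proof.
move=> xA.
rewrite (reindex_onto (fun C => x |: C) (fun B => B :\ x)) /=; last first.
  by move=> B /andP[xB _]; rewrite setD1K.
under eq_bigl => C.
  rewrite (_ : _ && _ = (C \subset A :\ x)); first over.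
  rewrite !inE eqxx /= subUset sub1set xA /= subsetD1.
  apply/andP/andP => -[CA].
    move/eqP => E; split => //; rewrite -E !inE eqxx //.
  by move=> xC; split => //; rewrite setU1K.
have -> : #|A| = #|A :\ x|.+1 by rewrite (cardsD1 x A) xA.
rewrite (partition_big (fun C : {set T} => inord #|C| : 'I_(#|A :\ x|.+1)) xpredT) //=.
apply: eq_bigr => j _.
rewrite -cards_draws -sumr_const; apply: eq_big => [C|C].
  rewrite !inE; case: (boolP (C \subset _)) => //= CA.
  rewrite -val_eqE /= inordK //.
  by rewrite ltnS subset_leq_card.
move=> /andP[CA /eqP<-]; rewrite inordK; last by rewrite ltnS subset_leq_card.
rewrite cardsU1; move: CA; rewrite subsetD1 => /andP[_ ->].
by rewrite add1n.
Qed.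

(** Counting the [#|B|!] permutations of [B] by their cycle through [x] determines the
numbers of full cycles inductively, without enumerating cyclic orders. *)
Lemma n_full_cyclesE x B : x \in B -> n_full_cycles x B = (#|B|.-1)`!.
Proof.
have [n] := ubnP #|B|; elim: n B => // n IH B; rewrite ltnS => Bn xB.
have fact_sum C : cycle_sum #|T| C (fun=> 1%N) = (#|C|)`!.
  rewrite /cycle_sum sum1_card -card_perm; apply: eq_card => s.
  rewrite unfold_in /= andb_idr // => _.
  by apply/forall_inP => y _; exact: max_card.
have B0 : (0 < #|B|)%N by apply/card_gt0P; exists x.
have := cycle_sum_rec_sets #|T| (fun=> 1%N) xB.
rewrite fact_sum.
under eq_bigr => C _ do rewrite max_card fact_sum.
have xBB : (x \in B) && (B \subset B) by rewrite xB subxx.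
rewrite (bigD1 B) //= setDv cards0 fact0.
pose g (j : nat) : nat := ((#|B| - j)`! * (j.-1)`!)%N.
have natmul (p q : nat) : (p *+ q)%R = (p * q)%N by rewrite -mulr_natr natn.
(* all terms but [C = B] are known by induction; that one is the unknown *)
have H1 (C : {set T}) : (x \in C) && (C \subset B) && (C != B) ->
  ((#|B :\: C|)`! *+ n_full_cycles x C = g #|C| :> nat)%R.
  case/andP=> /andP[xC CB] CnB; have CpB : C \proper B by rewrite properEneq CnB.
  rewrite IH //; last by apply: leq_trans (proper_card CpB) Bn.
  by rewrite natmul /g cardsD (setIidPr CB).
rewrite (eq_bigr _ H1).
have := @sum_subsets_through nat x B g xB.
rewrite (bigD1 B) //= {1}/g subnn fact0 mul1n.
have -> : (\sum_(j < #|B|) g j.+1 *+ 'C(#|B|.-1, j) = (#|B|)`!)%R.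
  rewrite (eq_bigr (fun=> (#|B|.-1)`!)).
    by rewrite sumr_const card_ord natmul -{3}(prednK B0) factS prednK // mulnC.
  move=> j _; rewrite /g /= natmul.
  rewrite -(@bin_fact #|B|.-1 j); last by rewrite -ltnS prednK.
  have -> : (#|B| - j.+1 = #|B|.-1 - j)%N by rewrite subnS -predn_sub.
  by rewrite mulnC [(_`! * j`!)%N]mulnC.
by move=> <- E; have := addIn E; rewrite natmul mul1n => ->.
Qed.

End CycleDecomposition.

Section CycleSums.
Import mathcomp.boot.fintype mathcomp.boot.finset.

(** There are [C(|A| - 1, j)] sets of size [j.+1] through [x] and [j!] cycles on
each; the product is a falling factorial. The function [w] stands for the fact,
known inductively, that the sums over smaller sets depend only on their sizes. *)
Lemma cycle_sum_rec (V : nmodType) (T : finType) (a : nat) (A : {set T}) (f : nat -> V)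
  (w : nat -> (nat -> V) -> V) :
  (forall B : {set T}, (#|B| < #|A|)%N -> cycle_sum a B (f \o S) = w #|B| (f \o S)) ->
  (0 < #|A|)%N ->
  cycle_sum a A f =
  \sum_(j < #|A|) (if (j < a)%N then w (#|A|.-1 - j)%N (f \o S) else 0)
     *+ (#|A|.-1 ^_ j).
Proof.
move=> Hw /card_gt0P[x xA]; rewrite (cycle_sum_rec_sets a f xA).
pose g j := (if (j <= a)%N then w (#|A| - j)%N (f \o S) else 0) *+ (j.-1)`!.
rewrite (eq_bigr (fun B : {set T} => g #|B|)); last first.
  move=> B /andP[xB BA]; rewrite n_full_cyclesE // /g; case: ifP => // _.
  rewrite Hw ?cardsD ?(setIidPr BA) //.
  rewrite ltn_subrL; apply/andP; split; apply/card_gt0P; by exists x.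
rewrite (sum_subsets_through _ xA); apply: eq_bigr => j _.
rewrite /g /= -mulrnA mulnC bin_ffact; congr (_ *+ _).
have A0 : (0 < #|A|)%N by apply/card_gt0P; exists x.
by rewrite subnS -predn_sub.
Qed.

(** The recursion [cycle_sum_rec] sees [A] only through its size; initial segments
of ['I_n] serve as sets of reference in the induction. *)
Lemma cycle_sum_card (V : nmodType) (T1 T2 : finType) (a : nat)
  (A1 : {set T1}) (A2 : {set T2}) (f : nat -> V) :
  #|A1| = #|A2| -> cycle_sum a A1 f = cycle_sum a A2 f.
Proof.
have [n] := ubnP #|A1|; elim: n T1 T2 A1 A2 f => // n IH T1 T2 A1 A2 f; rewrite ltnS => A1n E.
pose w k (g : nat -> V) := cycle_sum a [set i : 'I_n | (i < k)%N] g.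
have cw k : (k <= n)%N -> #|[set i : 'I_n | (i < k)%N]| = k.
  move=> kn; rewrite cardsE cardE /enum_mem size_filter -enumT /=.
  rewrite -(@count_map _ _ val (fun i => (i < k)%N)) val_enum_ord.
  rewrite -size_filter -{1}(subnKC kn) iotaD filter_cat size_cat.
  rewrite (@eq_in_filter _ _ predT (iota 0 k)) ?filter_predT ?size_iota.
    rewrite (@eq_in_filter _ _ pred0) ?filter_pred0 ?addn0 // => i.
    by rewrite mem_iota add0n => /andP[+ _]; rewrite leqNgt => /negPf.
  by move=> i; rewrite mem_iota.
have [A0|A0] := posnP #|A1|.
  have A20 : #|A2| = 0%N by rewrite -E.
  rewrite (cards0_eq A0) (cards0_eq A20) /cycle_sum.
  have F (T : finType) : \sum_(s : {perm T} | perm_on set0 s && short_cycles_in a set0 s)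
      f (cycles_in set0 s) = f 0%N.
    rewrite (bigD1 (1%g : {perm T})) /=; last first.
      by rewrite perm_on1; apply/forall_inP => y; rewrite inE.
    rewrite big1 ?addr0 /cycles_in ?imset0 ?cards0 // => s /andP[/andP[s0 _]].
    by rewrite (perm_on_id s0) ?cards0 // eqxx.
  by rewrite !F.
rewrite (cycle_sum_rec (w := w)) //; last first.
  move=> B BA; apply: IH; first by apply: leq_trans BA A1n.
  by rewrite cw // ltnW //; apply: leq_trans BA A1n.
rewrite [RHS](cycle_sum_rec (w := w)) ?E //; last by rewrite -E.
move=> B; rewrite -E => BA.
have cn : (#|B| < n)%N by apply: leq_trans BA A1n.
by apply: IH => //; rewrite cw // ltnW.
Qed.

End CycleSums.

Local Open Scope classical_set_scope.
Local Open Scope ring_scope.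

(** * Permutations with bounded cycle lengths *)

Lemma num_cyclesE n (s : 'S_n) : num_cycles s = cycles_in [set: 'I_n]%SET s.
Proof.
rewrite /num_cycles /cycle_count /cycles_in.
have -> : (porbit s @: [set: 'I_n] = porbits s)%SET.
  by apply/finset.setP => A; apply/imsetP/imsetP => -[i _ ->]; exists i.
transitivity (\sum_(A in porbits s) 1)%N; last by rewrite sum1_card.
rewrite [RHS](partition_big (fun A : {set 'I_n} => inord #|A| : 'I_n.+1) predT) //=.
rewrite big_add1 big_mkord big_ord_recl /= [X in _ = (X + _)%N]big1 ?add0n => [|A].
  apply: eq_bigr => i _; rewrite -sum1_card; apply: eq_bigl => A.
  rewrite !inE -val_eqE /= inordK //.
  by rewrite ltnS; apply: leq_trans (max_card _) _; rewrite card_ord.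
move=> /andP[/imsetP[i _ ->]] /eqP/(congr1 val) /=; rewrite inordK.
  by move/eqP; rewrite (negPf (card_porbit_neq0 _ _)).
by rewrite ltnS; apply: leq_trans (max_card _) _; rewrite card_ord.
Qed.

(** The recursion [cycle_totalS] passes between symmetric groups of different sizes,
so the sum is taken as a function of [n] rather than of a set. *)
Definition cycle_total (V : nmodType) (a n : nat) (f : nat -> V) : V :=
  cycle_sum a [set: 'I_n]%SET f.

Lemma cycle_totalE (V : nmodType) (a n : nat) (f : nat -> V) :
  \sum_(s in bounded_cycle_perms n a) f (num_cycles s) = cycle_total a n f.
Proof.
rewrite /cycle_total /cycle_sum; apply: eq_big => [s|s _]; last by rewrite num_cyclesE.
rewrite inE; have -> : perm_on [set: 'I_n]%SET s by apply/fintype.subsetP => i; rewrite inE.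
apply/forall_inP/forall_inP => H A.
  by move=> _; apply: H; apply/imsetP; exists A.
by move=> /imsetP[i _ ->]; apply: H; rewrite inE.
Qed.

Lemma cycle_total0 (V : nmodType) (a : nat) (f : nat -> V) : cycle_total a 0 f = f 0%N.
Proof.
rewrite /cycle_total /cycle_sum (bigD1 (1%g : 'S_0)) /=; last first.
  apply/andP; split; first exact: perm_on1.
  by apply/forall_inP => -[].
rewrite big1 => [|s /andP[_]].
  rewrite addr0 /cycles_in (_ : [set: 'I_0]%SET = finset.set0) ?imset0 ?cards0 //.
  by apply/finset.setP => -[].
by rewrite (_ : s = 1%g) ?eqxx //; apply/permP => -[].
Qed.

Lemma cycle_totalS (V : nmodType) (a n : nat) (f : nat -> V) :
  cycle_total a n.+1 f =
  \sum_(j < n.+1) (if (j < a)%N then cycle_total a (n - j) (f \o S) else 0) *+ (n ^_ j).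
Proof.
have cT : #|[set: 'I_n.+1]%SET| = n.+1 by rewrite cardsT card_ord.
rewrite {1}/cycle_total
  (@cycle_sum_rec _ _ a _ f (fun k g => cycle_total a k g)) ?cT //.
by move=> B _; apply: cycle_sum_card; rewrite cardsT card_ord.
Qed.

(** * Derivatives and integrals on a segment *)

Section Calculus.
Context {R : realType}.
Notation mu := (@lebesgue_measure R).
Implicit Types (f g : R -> R) (x y : R).

(** This and the following lemmas state the rules of differentiation on explicit
expressions in the variable rather than on pointwise operations on functions. *)
Lemma is_derive_ext f g x df dg :
  is_derive x 1 f df -> f =1 g -> df = dg -> is_derive x 1 g dg.
Proof. by move=> H /funext <- <-. Qed.

Lemma is_derive_sumE n (h : 'I_n -> R -> R) x (dh : 'I_n -> R) :
  (forall i, is_derive x 1 (h i) (dh i)) ->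
  is_derive x 1 (fun t => \sum_(i < n) h i t) (\sum_(i < n) dh i).
Proof.
move=> H; apply: (is_derive_ext (is_derive_sum H)) => // t.
by rewrite fct_sumE.
Qed.

Lemma is_derive_mulE f g x df dg :
  is_derive x 1 f df -> is_derive x 1 g dg ->
  is_derive x 1 (fun t => f t * g t) (df * g x + f x * dg).
Proof.
move=> Hf Hg; apply: (is_derive_ext (is_deriveM Hf Hg)) => //.
by rewrite /GRing.scale /= addrC; congr (_ + _); rewrite mulrC.
Qed.

Lemma is_derive_scaleE f x df k :
  is_derive x 1 f df -> is_derive x 1 (fun t => k * f t) (k * df).
Proof. by move=> H; apply: (is_derive_ext (is_deriveZ k H)). Qed.

Lemma is_derive_compE f g x df dg :
  is_derive (g x) 1 f df -> is_derive x 1 g dg ->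
  is_derive x 1 (fun t => f (g t)) (dg * df).
Proof. by move=> Hf Hg; apply: (is_derive_ext (is_derive1_comp Hf Hg)) => //; rewrite mulrC. Qed.

Lemma is_derive_expE g x dg :
  is_derive x 1 g dg -> is_derive x 1 (fun t => expR (g t)) (dg * expR (g x)).
Proof. by move=> H; apply: is_derive_compE. Qed.

Lemma is_derive_sinE g x dg :
  is_derive x 1 g dg -> is_derive x 1 (fun t => sin (g t)) (dg * cos (g x)).
Proof. by move=> H; apply: is_derive_compE. Qed.

Lemma is_derive_cosE g x dg :
  is_derive x 1 g dg -> is_derive x 1 (fun t => cos (g t)) (dg * - sin (g x)).
Proof. by move=> H; apply: is_derive_compE. Qed.

Lemma is_derive_affine k b x : is_derive x 1 (fun t : R => b + k * t) k.
Proof.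
by apply: (is_derive_ext (is_deriveD (is_derive_cst b x 1) (is_derive_scaleE k (is_derive_id x 1)))) => //;
  rewrite add0r mulr1.
Qed.

Lemma is_derive_continuous f x df : is_derive x 1 f df -> {for x, continuous f}.
Proof. by move=> H; apply: differentiable_continuous; apply/derivable1_diffP; case: H. Qed.

Lemma integrable_itv_continuous f a b : continuous f ->
  mu.-integrable `[a, b] (EFin \o f).
Proof.
move=> cf; apply: continuous_compact_integrable; first exact: segment_compact.
exact: continuous_subspaceT.
Qed.

Lemma is_derive_under_integral (D : set R) (f df : R -> R -> R) (G : R -> R) (u v a : R) :
  measurable D -> u < a < v ->
  (forall x, u < x < v -> mu.-integrable D (EFin \o f x)) ->
  (forall x y, u < x < v -> D y -> is_derive x 1 (f ^~ y) (df x y)) ->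
  (forall y, 0 <= G y) -> mu.-integrable D (EFin \o G) ->
  (forall x y, u < x < v -> D y -> `|df x y| <= G y) ->
  is_derive a 1 (fun x => \int[mu]_(y in D) f x y) (\int[mu]_(y in D) df a y).
Proof.
move=> mD uav intf dfE G0 intG Gb.
have d1 x y : `]u, v[%classic x -> D y -> partial1of2 f x y = df x y.
  rewrite /= in_itv /= => xuv Dy; rewrite partial1of2E.
  by have [_] := dfE _ _ xuv Dy.
have Ia : `]u, v[%classic a by rewrite /= in_itv.
have I x : `]u, v[%classic x -> mu.-integrable D (EFin \o f x).
  by rewrite /= in_itv /=; apply: intf.
have II x y : `]u, v[%classic x -> D y -> derivable (f ^~ y) x 1.
  by rewrite /= in_itv /= => xuv Dy; have [] := dfE _ _ xuv Dy.
have III x y : `]u, v[%classic x -> D y -> `|partial1of2 f x y| <= G y.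
  by move=> xuv Dy; rewrite d1 //; apply: Gb => //; move: xuv; rewrite /= in_itv.
apply: DeriveDef; first refine (@derivable_under_integral R _ _ mu f D mD a u v Ia I II G G0 intG III).
rewrite -derive1E (@differentiation_under_integral R _ _ mu f D mD a u v Ia I II G G0 intG III).
by apply: eq_Rintegral => y /set_mem Dy; exact: d1.
Qed.

Lemma Rintegral_derive (F f : R -> R) (a b : R) : a < b -> continuous f ->
  (forall t : R, is_derive t 1 F (f t)) -> \int[mu]_(t in `[a, b]) f t = F b - F a.
Proof.
move=> ab cf dF; rewrite /Rintegral (@continuous_FTC2 _ f F) //.
- exact: continuous_subspaceT.
- split.
  + by move=> t _; case: (dF t).
  + by apply: cvg_at_right_filter; apply: is_derive_continuous (dF a).
  + by apply: cvg_at_left_filter; apply: is_derive_continuous (dF b).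
- by move=> t _; rewrite derive1E; case: (dF t).
Qed.

Lemma integrable_sumR (D : set R) (I : Type) (s : seq I) (P : pred I) (f : I -> R -> R) :
  measurable D -> (forall i, P i -> mu.-integrable D (EFin \o f i)) ->
  mu.-integrable D (EFin \o (fun t => \sum_(i <- s | P i) f i t)).
Proof.
move=> mD intf; have := @integrable_sum _ _ _ mu D mD _ s P _ intf.
by congr (_.-integrable _ _); apply/funext => t /=; rewrite sumEFin.
Qed.

Lemma Rintegral_sum (D : set R) (I : Type) (s : seq I) (P : pred I) (f : I -> R -> R) :
  measurable D -> (forall i, P i -> mu.-integrable D (EFin \o f i)) ->
  \int[mu]_(t in D) (\sum_(i <- s | P i) f i t) = \sum_(i <- s | P i) \int[mu]_(t in D) f i t.
Proof.
move=> mD intf; elim: s => [|i s IH].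
  rewrite big_nil; under eq_Rintegral do rewrite big_nil.
  by rewrite Rintegral_cst // mul0r.
rewrite big_cons; case: ifP => Pi.
  rewrite -IH -RintegralD //; last exact: integrable_sumR.
    by apply: eq_Rintegral => t _; rewrite big_cons Pi.
  exact: intf.
by rewrite -IH; apply: eq_Rintegral => t _; rewrite big_cons Pi.
Qed.

Lemma is_derive0_eq (f : R -> R) (a b : R) : a <= b ->
  (forall x : R, a < x < b -> is_derive x 1 f 0) ->
  (forall x : R, a <= x <= b -> {for x, continuous f}) -> f b = f a.
Proof.
move=> ab df cf; apply/eqP; rewrite -subr_eq0; apply/eqP.
have dI : forall x, x \in `]a, b[ -> is_derive x 1 f ((fun=> 0) x).
  by move=> x; rewrite in_itv /= => xab; exact: df.
have [|c _ ->] := @MVT_segment R f (fun=> 0) a b ab dI; last by rewrite mul0r.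
apply: continuous_in_subspaceT => x /set_mem /=; rewrite in_itv /=; exact: cf.
Qed.

End Calculus.

(** * Fourier coefficients of the exponential of a trigonometric sum *)
Lemma sinD2piz (R : realType) (k : int) (x : R) : sin (x + k%:~R * (pi *+ 2)) = sin x.
Proof.
have sinD2pin (n : nat) y : sin (y + n%:R * (pi *+ 2)) = sin y :> R.
  by rewrite mulr_natl (periodicn (@sinD2pi R)).
case: k => k; first by rewrite -pmulrn sinD2pin.
rewrite NegzE mulrNz mulNr -pmulrn.
by rewrite -[in RHS](subrK (k.+1%:R * (pi *+ 2)) x) sinD2pin.
Qed.

Section FourierCoefficients.
Context {R : realType}.
Notation mu := (@lebesgue_measure R).
Variables (a : nat) (q c : 'I_a -> R) (kap : R).
Hypothesis kap_gt0 : 0 < kap.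

(** [angle], [re_sum] and [im_sum] are the argument of the [i]-th term and the real
and imaginary parts of [\sum_i q_i * r ^ i.+1 * e ^ (i angle_i)], so that
[fourier_integrand] is the real part of the exponential of this sum times
[e ^ (- i (k * kap * t + b))]. The factor [kap] rescales the variable: the
period is [2 * pi / kap]. *)
Definition angle (i : 'I_a) (t : R) : R := c i + i.+1%:R * kap * t.

Definition re_sum (r t : R) : R :=
  \sum_(i < a) q i * r ^+ i.+1 * cos (angle i t).

Definition im_sum (r t : R) : R :=
  \sum_(i < a) q i * r ^+ i.+1 * sin (angle i t).

Definition fourier_integrand (r : R) (k : int) (b t : R) : R :=
  expR (re_sum r t) * cos (im_sum r t - k%:~R * kap * t - b).

Definition fourier_coeff (r : R) (k : int) (b : R) : R :=
  \int[mu]_(t in `[(- (pi / kap)), pi / kap]) fourier_integrand r k b t.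

Let is_derive_angle i (t : R) : is_derive t 1 (angle i) (i.+1%:R * kap).
Proof. exact: is_derive_affine. Qed.

Lemma is_derive_re_sum (r t : R) : is_derive t 1 (re_sum r)
  (\sum_(i < a) q i * r ^+ i.+1 * (i.+1%:R * kap * - sin (angle i t))).
Proof.
by apply: is_derive_sumE => i; apply: is_derive_scaleE; apply: is_derive_cosE.
Qed.

Lemma is_derive_im_sum (r t : R) : is_derive t 1 (im_sum r)
  (\sum_(i < a) q i * r ^+ i.+1 * (i.+1%:R * kap * cos (angle i t))).
Proof.
by apply: is_derive_sumE => i; apply: is_derive_scaleE; apply: is_derive_sinE.
Qed.

Lemma is_derive_re_sum_radius (r t : R) : is_derive r 1 (re_sum ^~ t)
  (\sum_(i < a) i.+1%:R * q i * r ^+ i * cos (angle i t)).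
Proof.
apply: is_derive_sumE => i.
apply: (is_derive_ext (is_derive_scaleE (q i * cos (angle i t)) (is_deriveX i.+1 (is_derive_id r 1)))).
  by move=> x; rewrite fctE mulrAC.
by rewrite /GRing.scale /= mulr1; ring.
Qed.

Lemma is_derive_im_sum_radius (r t : R) : is_derive r 1 (im_sum ^~ t)
  (\sum_(i < a) i.+1%:R * q i * r ^+ i * sin (angle i t)).
Proof.
apply: is_derive_sumE => i.
apply: (is_derive_ext (is_derive_scaleE (q i * sin (angle i t)) (is_deriveX i.+1 (is_derive_id r 1)))).
  by move=> x; rewrite fctE mulrAC.
by rewrite /GRing.scale /= mulr1; ring.
Qed.

Let is_derive_arg r k b (t : R) : is_derive t 1 (fun t => im_sum r t - k%:~R * kap * t - b)
  (\sum_(i < a) q i * r ^+ i.+1 * (i.+1%:R * kap * cos (angle i t)) - k%:~R * kap).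
Proof.
apply: (is_derive_ext (is_deriveD (is_derive_im_sum r t) (is_derive_affine (- (k%:~R * kap)) (- b) t))) => // x.
by rewrite fctE; lra.
Qed.

(** Multiplying by [e ^ (i angle_i)] lowers the index by [i.+1] and moves the phase:
this is what makes both derivatives below combinations of integrands. *)
Lemma fourier_integrand_shift r (k : int) b t (i : 'I_a) :
  fourier_integrand r (k - i.+1%:Z) (b - c i) t =
  expR (re_sum r t) * cos (im_sum r t - k%:~R * kap * t - b + angle i t).
Proof.
rewrite /fourier_integrand; congr (_ * cos _).
by rewrite intrB -pmulrn /angle; ring.
Qed.

(** The function differentiated is the imaginary part of the one whose real part is
[fourier_integrand]. *)
Lemma is_derive_fourier_primitive r (k : int) b (t : R) :
  is_derive t 1 (fun t => expR (re_sum r t) * sin (im_sum r t - k%:~R * kap * t - b))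
   (kap * (\sum_(i < a) i.+1%:R * q i * r ^+ i.+1 * fourier_integrand r (k - i.+1%:Z) (b - c i) t
     - k%:~R * fourier_integrand r k b t)).
Proof.
apply: (is_derive_ext (is_derive_mulE (is_derive_expE (is_derive_re_sum r t))
   (is_derive_sinE (is_derive_arg r k b t)))) => //.
under [in RHS]eq_bigr => i _ do rewrite fourier_integrand_shift cosD.
rewrite /fourier_integrand; set E := expR _; set C := cos _; set S := sin _.
rewrite mulrBr mulr_sumr mulrBl mulrBr addrA !mulr_suml mulr_sumr -big_split /=.
congr (_ - _); last by ring.
by apply: eq_bigr => i _; ring.
Qed.

Lemma is_derive_fourier_integrand_radius (r : R) (k : int) b t :
  is_derive r 1 (fun r => fourier_integrand r k b t)
   (\sum_(i < a) i.+1%:R * q i * r ^+ i * fourier_integrand r (k - i.+1%:Z) (b - c i) t).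
Proof.
have H : is_derive r 1 (fun r => im_sum r t - k%:~R * kap * t - b)
   (\sum_(i < a) i.+1%:R * q i * r ^+ i * sin (angle i t)).
  apply: (is_derive_ext (is_deriveD (is_derive_im_sum_radius r t) (is_derive_cst (- (k%:~R * kap * t) - b) r 1))).
    by move=> x; rewrite fctE addrA.
  by rewrite addr0.
apply: (is_derive_ext (is_derive_mulE (is_derive_expE (is_derive_re_sum_radius r t))
   (is_derive_cosE H))) => //.
under [in RHS]eq_bigr => i _ do rewrite fourier_integrand_shift cosD.
set E := expR _; set C := cos _; set S := sin _.
rewrite !mulr_suml mulr_sumr -big_split /=.
by apply: eq_bigr => i _; ring.
Qed.

Lemma continuous_fourier_integrand r k b : continuous (fourier_integrand r k b).
Proof.
move=> t; apply: is_derive_continuous.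
exact: (is_derive_mulE (is_derive_expE (is_derive_re_sum r t)) (is_derive_cosE (is_derive_arg r k b t))).
Qed.

Let integrable_fourier r k b (l u : R) :
  mu.-integrable `[l, u] (EFin \o fourier_integrand r k b).
Proof. exact/integrable_itv_continuous/continuous_fourier_integrand. Qed.

(** Integrating the derivative of a periodic function over one period. *)
Lemma fourier_coeff_rec r (k : int) b :
  \sum_(i < a) i.+1%:R * q i * r ^+ i.+1 * fourier_coeff r (k - i.+1%:Z) (b - c i) =
  k%:~R * fourier_coeff r k b.
Proof.
set l := pi / kap.
have l0 : - l < l by rewrite gtrN // divr_gt0 // pi_gt0.
pose F t := expR (re_sum r t) * sin (im_sum r t - k%:~R * kap * t - b).
have angle_per i : angle i l = angle i (- l) + pi *+ 2 *+ i.+1.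
  rewrite /angle /l -[_ *+ i.+1]mulr_natr.
  by field; rewrite gt_eqF.
have Fper : F l = F (- l).
  rewrite /F; have -> : re_sum r l = re_sum r (- l).
    by apply: eq_bigr => i _; rewrite angle_per (periodicn (@cosD2pi R)).
  have -> : im_sum r l = im_sum r (- l).
    by apply: eq_bigr => i _; rewrite angle_per (periodicn (@sinD2pi R)).
  congr (_ * _); set s := im_sum _ _.
  have -> : s - k%:~R * kap * - l - b = s - k%:~R * kap * l - b + k%:~R * (pi *+ 2).
    by rewrite /l; field; rewrite gt_eqF.
  by rewrite sinD2piz.
have cZ (w : R) k' b' : continuous (fun t => w * fourier_integrand r k' b' t).
  by move=> t; apply: cvgM; [exact: cvg_cst|exact: continuous_fourier_integrand].
have cS : continuous (fun t => \sum_(i < a) i.+1%:R * q i * r ^+ i.+1 *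
    fourier_integrand r (k - i.+1%:Z) (b - c i) t).
  by move=> t; apply: cvg_big => [|i _]; [exact: add_continuous|exact: cZ].
have cSB : continuous (fun t => \sum_(i < a) i.+1%:R * q i * r ^+ i.+1 *
    fourier_integrand r (k - i.+1%:Z) (b - c i) t - k%:~R * fourier_integrand r k b t).
  by move=> t; apply: cvgB; [exact: cS|exact: cZ].
have cdF : continuous (fun t => kap * (\sum_(i < a) i.+1%:R * q i * r ^+ i.+1 *
    fourier_integrand r (k - i.+1%:Z) (b - c i) t - k%:~R * fourier_integrand r k b t)).
  by move=> t; apply: cvgM; [exact: cvg_cst|exact: cSB].
have := @Rintegral_derive R F _ _ _ l0 cdF (fun t => is_derive_fourier_primitive r k b t).
rewrite Fper subrr RintegralZl //; last exact: integrable_itv_continuous.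
move=> /eqP; rewrite mulf_eq0 gt_eqF //= => /eqP.
rewrite RintegralB //; [|exact: integrable_itv_continuous..].
rewrite RintegralZl // Rintegral_sum //; last by move=> i _; exact: integrable_itv_continuous.
move/eqP; rewrite subr_eq0 => /eqP <-; apply: eq_bigr => i _.
by rewrite RintegralZl.
Qed.

(** An open range of radii around the segment [0 <= r <= 1] gives continuity at both
ends of it and a uniform bound on the derivative. *)
Lemma is_derive_fourier_coeff (r : R) (k : int) b : -1 < r < 2 ->
  is_derive r 1 (fun r => fourier_coeff r k b)
    (\sum_(i < a) i.+1%:R * q i * r ^+ i * fourier_coeff r (k - i.+1%:Z) (b - c i)).
Proof.
move=> r12.
pose M := (\sum_(i < a) i.+1%:R * `|q i| * 2 ^+ i) *
  expR (\sum_(i < a) `|q i| * 2 ^+ i.+1).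
have M0 : 0 <= M.
  apply: mulr_ge0; last exact: expR_ge0.
  by apply: sumr_ge0 => i _; rewrite !mulr_ge0 ?exprn_ge0.
have rpow (x : R) i : -1 < x < 2 -> `|x ^+ i| <= 2 ^+ i.
  move=> /andP[x1 x2]; rewrite normrX lerXn2r ?nnegrE // ler_norml.
  by apply/andP; split; lra.
have fb (x t : R) k' b' : -1 < x < 2 ->
    `|fourier_integrand x k' b' t| <= expR (\sum_(i < a) `|q i| * 2 ^+ i.+1).
  move=> x12; rewrite normrM ger0_norm ?expR_ge0 // -[leRHS]mulr1.
  rewrite ler_pM ?expR_ge0 // ?cos_max // ler_expR; apply: ler_sum => i _.
  apply: (le_trans (ler_norm _)); rewrite !normrM -[leRHS]mulr1 ler_pM ?cos_max ?mulr_ge0 //.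
  by rewrite ler_wpM2l // rpow.
have -> : \sum_(i < a) i.+1%:R * q i * r ^+ i * fourier_coeff r (k - i.+1%:Z) (b - c i) =
  \int[mu]_(t in `[(- (pi / kap)), pi / kap])
     \sum_(i < a) i.+1%:R * q i * r ^+ i * fourier_integrand r (k - i.+1%:Z) (b - c i) t.
  rewrite Rintegral_sum //.
    by apply: eq_bigr => i _; rewrite RintegralZl.
  move=> i _; apply: integrable_itv_continuous => t.
  by apply: cvgM; [exact: cvg_cst|exact: continuous_fourier_integrand].
apply: (@is_derive_under_integral R _ (fun r t => fourier_integrand r k b t)
  (fun r t => \sum_(i < a) i.+1%:R * q i * r ^+ i * fourier_integrand r (k - i.+1%:Z) (b - c i) t)
  (fun=> M) (-1) 2) => //.
- by move=> x y _ _; exact: is_derive_fourier_integrand_radius.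
- by apply: integrable_itv_continuous => t; exact: cvg_cst.
- move=> x t x12 _; apply: (le_trans (ler_norm_sum _ _ _)); rewrite /M mulr_suml.
  apply: ler_sum => i _; rewrite normrM ler_pM ?fb //.
  by rewrite !normrM normr_nat ler_wpM2l ?mulr_ge0 // rpow.
Qed.

(** For [k = - m], [r ^+ m * fourier_coeff r k b] does not depend on [r], because
[r d/dr] and [d/dt] act on the integrand in the same way: this is the
independence of the radius in Cauchy's formula, from [r = 1] down to [r = 0]. *)
Lemma fourier_coeff_scale (m : nat) b :
  fourier_coeff 1 (- m%:Z) b = 0 ^+ m * fourier_coeff 0 (- m%:Z) b.
Proof.
pose f (r : R) := r ^+ m * fourier_coeff r (- m%:Z) b.
suff : f 1 = f 0 by rewrite /f expr1n mul1r.
pose df (r : R) := m%:R * r ^+ m.-1 * fourier_coeff r (- m%:Z) b + r ^+ m *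
   (\sum_(i < a) i.+1%:R * q i * r ^+ i * fourier_coeff r (- m%:Z - i.+1%:Z) (b - c i)).
have dfE (r : R) : -1 < r < 2 -> is_derive r 1 f (df r).
  move=> r12; apply: (is_derive_ext (is_derive_mulE (is_deriveX m (is_derive_id r 1))
    (is_derive_fourier_coeff (- m%:Z) b r12))).
    by move=> x; rewrite fctE.
  by rewrite /df fctE /GRing.scale /= mulr1.
apply: is_derive0_eq => // r /andP[r0 r1].
  have r12 : -1 < r < 2 by apply/andP; split; lra.
  apply: (is_derive_ext (dfE r r12)) => //.
  have rn0 : r != 0 by rewrite gt_eqF.
  apply: (mulfI rn0); rewrite mulr0 /df.
  have := fourier_coeff_rec r (- m%:Z) b; rewrite mulrNz mulNr -pmulrn => E.
  rewrite mulrDr mulrCA [r * (r ^+ m * _)]mulrCA mulr_sumr.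
  have -> : \sum_(i < a) r * (i.+1%:R * q i * r ^+ i * fourier_coeff r (- m%:Z - i.+1%:Z) (b - c i))
    = - (m%:R * fourier_coeff r (- m%:Z) b).
    by rewrite -E; apply: eq_bigr => i _; rewrite exprS; ring.
  by case: (m) => [|m'] /=; rewrite ?exprS; ring.
by apply: is_derive_continuous (dfE r _); apply/andP; split; lra.
Qed.

Lemma fourier_coeff_neg (m : nat) b : (0 < m)%N -> fourier_coeff 1 (- m%:Z) b = 0.
Proof. by move=> m0; rewrite fourier_coeff_scale expr0n -[m == 0%N]negbK -lt0n m0 mul0r. Qed.

Lemma fourier_coeff_0 b : fourier_coeff 1 0 b = 2 * pi / kap * cos b.
Proof.
have := fourier_coeff_scale 0 b; rewrite oppr0 expr0 mul1r => ->.
rewrite /fourier_coeff /fourier_integrand.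
have re0 t : re_sum 0 t = 0 by rewrite /re_sum big1 // => i _; rewrite expr0n mulr0 mul0r.
have im0 t : im_sum 0 t = 0 by rewrite /im_sum big1 // => i _; rewrite expr0n mulr0 mul0r.
under eq_Rintegral do rewrite re0 im0 expR0 mul1r !mul0r subrr sub0r cosN.
rewrite Rintegral_cst //= lebesgue_measure_itv /= lte_fin ifT; last first.
  by rewrite gtrN // divr_gt0 // pi_gt0.
by rewrite /= mulrC; congr (_ * _); lra.
Qed.

End FourierCoefficients.

(** * Cycle sums as Fourier coefficients *)

Lemma sum_ord_ltnC (V : nmodType) (m n : nat) (F : nat -> V) :
  \sum_(i < m) (if (i < n)%N then F i else 0) = \sum_(i < n) (if (i < m)%N then F i else 0).
Proof.
rewrite -!big_mkcond /= (@big_ord_widen_cond _ _ _ m (m + n) (fun i => (i < n)%N) F) ?leq_addr //.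
rewrite (@big_ord_widen_cond _ _ _ n (m + n) (fun i => (i < m)%N) F) ?leq_addl //.
by apply: eq_bigl => i; rewrite andbC.
Qed.

Definition length_weight (R : realType) (a : nat) (x : R) (i : 'I_a) : R :=
  x ^+ i.+1 / i.+1%:R.

(** Both sides obey the same recursion: [fourier_coeff_rec] on the left, where the
terms of negative index vanish, and [cycle_totalS] on the right. The parameter
[d] is a translation of the integration variable: [c_j = th - j * d] and the shift
[n * d] of the phase compensate each other. A suitable [d]
makes the quadratic form of the phases diagonal ([sum_phase_sqr]). *)
Lemma cycle_total_fourier (R : realType) (a n : nat) (x th d b kap : R) : 0 < kap ->
  fourier_coeff (@length_weight R a x) (fun i : 'I_a => th - i.+1%:R * d) kap 1 n (b - n%:R * d) =
  2 * pi / kap * (x ^+ n / n`!%:R * cycle_total a n (fun k => cos (k%:R * th - b))).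
Proof.
move=> kap0; have [N] := ubnP n; elim: N n b => // N IH [|n] b; rewrite ltnS => nN.
  by rewrite cycle_total0 !mul0r subr0 sub0r cosN fourier_coeff_0 // fact0 expr0 divr1 mul1r.
have n1 : n.+1%:R != 0 :> R by rewrite pnatr_eq0.
apply: (mulfI n1).
have := fourier_coeff_rec (@length_weight R a x) (fun i : 'I_a => th - i.+1%:R * d) kap0 1
  n.+1 (b - n.+1%:R * d).
rewrite -[n.+1%:~R]/(n.+1%:R) => <-.
pose H (i : nat) := 2 * pi / kap * (x ^+ n.+1 / (n - i)`!%:R *
   cycle_total a (n - i) (fun k => cos (k%:R * th - (b - th)))).
rewrite (eq_bigr (fun i : 'I_a => if (i < n.+1)%N then H i else 0)); last first.
  move=> i _; rewrite expr1n mulr1 /length_weight mulrCA divff ?pnatr_eq0 // mulr1.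
  case: ltnP => [ltin|lenI].
    have -> : n.+1%:Z - i.+1%:Z = (n - i)%N%:Z by rewrite subzSS subzn.
    have -> : b - n.+1%:R * d - (th - i.+1%:R * d) = (b - th) - (n - i)%:R * d.
      by rewrite natrB // -!natr1; ring.
    rewrite IH; last by apply: leq_ltn_trans nN; rewrite leq_subr.
    rewrite /H mulrCA; congr (_ * _); rewrite !mulrA -exprD; congr (_ ^+ _ / _ * _).
    by rewrite addSn subnKC.
  have -> : n.+1%:Z - i.+1%:Z = - (i - n)%N%:Z by rewrite subzSS -subzn ?opprB // ltnW.
  by rewrite fourier_coeff_neg ?mulr0 // subn_gt0.
rewrite sum_ord_ltnC cycle_totalS mulrCA; rewrite !mulr_sumr.
apply: eq_bigr => j _; case: ifP => _; last by rewrite mul0rn !mulr0.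
rewrite /H; congr (_ * _).
have -> : ((fun k : nat => cos (k%:R * th - b)) \o S) = (fun k => cos (k%:R * th - (b - th))).
  by apply/funext => k /=; congr cos; rewrite -natr1; ring.
have jn : (j <= n)%N by rewrite -ltnS.
rewrite -mulr_natr factS -(ffact_fact jn) !natrM.
have f0 : (n - j)`!%:R != 0 :> R by rewrite pnatr_eq0 -lt0n fact_gt0.
have g0 : (n ^_ j)%:R != 0 :> R by rewrite pnatr_eq0 -lt0n ffact_gt0.
by field; rewrite g0 f0 addrC natr1.
Qed.

(** * Dominated convergence for real-valued integrals *)

(** A domination that holds only for large [n] suffices: shift the sequence. *)
Lemma dominated_cvg_Rintegral d (T : measurableType d) (R : realType)
    (mu : {measure set T -> \bar R}) (D : set T) (f_ : nat -> T -> R) (f g : T -> R) :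
  measurable D -> (forall n, measurable_fun D (f_ n)) ->
  (forall x, D x -> f_ n x @[n --> \oo] --> f x) ->
  mu.-integrable D (EFin \o g) ->
  (\forall n \near \oo, forall x, D x -> `|f_ n x| <= g x) ->
  \int[mu]_(x in D) f_ n x @[n --> \oo] --> \int[mu]_(x in D) f x.
Proof.
move=> mD mf_ f_f ig [N _ f_g].
rewrite -(cvg_shiftn N); apply: fine_cvg.
pose h n x := (f_ (n + N)%N x)%:E.
have f_f' x : D x -> h ^~ x @ \oo --> (f x)%:E.
  move=> Dx; apply: cvg_EFin; first exact: nearW.
  by rewrite (cvg_shiftn N (fun n => f_ n x)); exact: f_f.
have mh n : measurable_fun D (h n) by exact/measurable_EFinP.
have h_g n x : D x -> (`|h n x| <= (EFin \o g) x)%E.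
  by move=> Dx; rewrite /h /= lee_fin f_g //= leq_addl.
have mf : measurable_fun D (fun x => (f x)%:E) by exact: (emeasurable_fun_cvg h).
have [iff _ /=] := @dominated_convergence _ _ _ mu D mD h _ (EFin \o g) mh mf
  (aeW _ f_f') ig (aeW _ (fun x n Dx => h_g n x Dx)).
by rewrite /Rintegral fineK //; exact: integrable_fin_num.
Qed.

Lemma integrable_dominated d (T : measurableType d) (R : realType)
    (mu : {measure set T -> \bar R}) (D : set T) (f g : T -> R) : measurable D ->
  measurable_fun D f -> mu.-integrable D (EFin \o g) ->
  (forall x, D x -> `|f x| <= g x) -> mu.-integrable D (EFin \o f).
Proof.
move=> mD mf ig fg.
have mf' : measurable_fun D (EFin \o f) by exact/measurable_EFinP.
apply: (le_integrable mD mf' _ ig) => x Dx; rewrite /= lee_fin; apply: (le_trans (fg x Dx)); exact: ler_norm.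
Qed.

Section Integration.
Context {R : realType}.
Notation mu := (@lebesgue_measure R).

Lemma dominated_cvg_lebesgue (D : set R) (f_ : nat -> R -> R) (f g : R -> R) :
  measurable D -> (forall n, measurable_fun D (f_ n)) ->
  (forall x, D x -> f_ n x @[n --> \oo] --> f x) ->
  mu.-integrable D (EFin \o g) ->
  (\forall n \near \oo, forall x, D x -> `|f_ n x| <= g x) ->
  \int[mu]_(x in D) f_ n x @[n --> \oo] --> \int[mu]_(x in D) f x.
Proof. exact: (@dominated_cvg_Rintegral _ _ R mu D f_ f g). Qed.

Lemma integrable_dominated_lebesgue (D : set R) (f g : R -> R) : measurable D ->
  measurable_fun D f -> mu.-integrable D (EFin \o g) ->
  (forall x, D x -> `|f x| <= g x) -> mu.-integrable D (EFin \o f).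
Proof. exact: (@integrable_dominated _ _ R mu D f g). Qed.

Lemma integrableDR (D : set R) (f g : R -> R) : measurable D ->
  mu.-integrable D (EFin \o f) -> mu.-integrable D (EFin \o g) ->
  mu.-integrable D (EFin \o (fun t => f t + g t)).
Proof.
move=> mD fi gi; have := @integrableD _ _ R mu D mD _ _ fi gi.
by congr (_.-integrable _ _); apply/funext => t /=; rewrite EFinD.
Qed.

Lemma integrableZR (D : set R) (k : R) (f : R -> R) : measurable D ->
  mu.-integrable D (EFin \o f) -> mu.-integrable D (EFin \o (fun t => k * f t)).
Proof.
move=> mD fi; have := @integrableZl _ _ R mu D mD k _ fi.
by congr (_.-integrable _ _); apply/funext => t /=; rewrite EFinM.
Qed.

Lemma cvg_Rintegral_itv (f : R -> R) : measurable_fun [set: R] f ->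
  mu.-integrable [set: R] (EFin \o f) ->
  \int[mu]_(x in `[(- n%:R), n%:R]) f x @[n --> \oo] --> \int[mu]_x f x.
Proof.
move=> mf iff; under eq_cvg do rewrite Rintegral_mkcond.
apply: (@dominated_cvg_lebesgue _ _ _ (fun x => `|f x|)) => //.
- move=> n; have mI : measurable (`[(- n%:R), n%:R]%classic : set R) by exact: measurable_itv.
  exact: ((measurable_restrictT f mI).1 (measurable_funTS mf)).
- move=> x _; apply: cvg_near_cst; near=> n.
  rewrite patchE mem_set //= in_itv /= -ler_norml.
  near: n; exact: nbhs_infty_ger.
- exact: integrable_abse iff.
- by apply: nearW => n x _; rewrite patchE; case: ifP => //; rewrite normr0.
Unshelve. all: by end_near. Qed.

(** Integration by parts on the whole line, in the form needed for the differential
equation of the Gaussian Fourier transform. *)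
Lemma Rintegral_derive_line (F f : R -> R) : continuous f ->
  (forall t : R, is_derive t 1 F (f t)) -> mu.-integrable [set: R] (EFin \o f) ->
  F n%:R @[n --> \oo] --> 0 -> F (- n%:R) @[n --> \oo] --> 0 ->
  \int[mu]_x f x = 0.
Proof.
move=> cf dF iff Fy FNy.
have H1 := cvg_Rintegral_itv (continuous_measurable_fun cf) iff.
suff H2 : \int[mu]_(x in `[(- n%:R), n%:R]) f x @[n --> \oo] --> 0.
  by rewrite -(cvg_lim _ H1) // (cvg_lim _ H2).
rewrite -(subrr 0); apply: (cvg_trans _ (cvgB Fy FNy)); apply: near_eq_cvg; near=> n.
rewrite /= (@Rintegral_derive _ F) //.
rewrite gtrN // ltr0n; near: n; exact: nbhs_infty_gt.
Unshelve. all: by end_near. Qed.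

End Integration.

(** * The Fourier transform of a Gaussian *)
Section Gaussian.
Context {R : realType}.
Notation mu := (@lebesgue_measure R).

Definition gauss (c t : R) : R := expR (- (c * t ^+ 2)).

Lemma is_derive_gauss (c t : R) : is_derive t 1 (gauss c) (- (2 * c * t) * gauss c t).
Proof.
apply: is_derive_expE.
apply: (is_derive_ext (is_derive_scaleE (- c) (is_deriveX 2 (is_derive_id t 1)))).
  by move=> x; rewrite fctE mulNr.
by rewrite /GRing.scale /= expr1 mulr1; ring.
Qed.

Lemma continuous_gauss c : continuous (gauss c).
Proof. by move=> t; exact: is_derive_continuous (is_derive_gauss c t). Qed.

Lemma normal_peakE (s : R) : 0 < s -> normal_peak s = (s * Num.sqrt (pi *+ 2))^-1.
Proof.
move=> s0; rewrite /normal_peak -mulrnAr sqrtrM ?sqr_ge0 //.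
by rewrite sqrtr_sqr ger0_norm // ltW.
Qed.

Lemma normal_pdf_gauss (m s t : R) : 0 < s ->
  normal_pdf m s t = (s * Num.sqrt (pi *+ 2))^-1 * gauss ((2 * s ^+ 2)^-1) (t - m).
Proof.
move=> s0; rewrite normal_pdfE ?gt_eqF // normal_peakE //; congr (_ * _).
rewrite /normal_fun /gauss; congr expR.
by rewrite -[s ^+ 2 *+ 2]mulr_natl mulNr mulrC.
Qed.

Lemma gauss_normal_pdf (c t : R) : 0 < c ->
  gauss c t = Num.sqrt (pi / c) * normal_pdf 0 (Num.sqrt (2 * c))^-1 t.
Proof.
move=> c0; have c20 : 0 < 2 * c by rewrite mulr_gt0.
rewrite normal_pdf_gauss ?invr_gt0 ?sqrtr_gt0 // subr0.
have -> : (2 * (Num.sqrt (2 * c))^-1 ^+ 2)^-1 = c.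
  by rewrite exprVn sqr_sqrtr ?ltW //; field; rewrite gt_eqF.
rewrite mulrA invfM invrK.
have -> : Num.sqrt (pi / c) * (Num.sqrt (2 * c) / Num.sqrt (pi *+ 2)) = 1.
  rewrite mulrA -sqrtrM ?divr_ge0 ?pi_ge0 ?ltW //.
  have -> : pi / c * (2 * c) = pi *+ 2 by field; rewrite gt_eqF.
  by rewrite divff // gt_eqF // sqrtr_gt0 mulrn_wgt0 // pi_gt0.
by rewrite mul1r.
Qed.

Lemma integrable_gauss (c : R) : 0 < c -> mu.-integrable [set: R] (EFin \o gauss c).
Proof.
move=> c0; have := integrable_normal_pdf 0 (Num.sqrt (2 * c))^-1.
move=> /(@integrableZl _ _ _ mu setT measurableT (Num.sqrt (pi / c))).
by congr (_.-integrable _ _); apply/funext => t /=; rewrite gauss_normal_pdf // EFinM.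
Qed.

Lemma Rintegral_gauss (c : R) : 0 < c -> \int[mu]_t gauss c t = Num.sqrt (pi / c).
Proof.
move=> c0; under eq_Rintegral do rewrite gauss_normal_pdf //.
rewrite RintegralZl //; last exact: integrable_normal_pdf.
by rewrite /Rintegral integral_normal_pdf mulr1.
Qed.

Lemma gauss_cvg0 (c : R) : 0 < c -> gauss c n%:R @[n --> \oo] --> 0.
Proof.
move=> c0.
apply: (@squeeze_cvgr _ _ _ _ (fun=> 0) (fun n : nat => c^-1 * n%:R^-1)).
- near=> n; rewrite expR_ge0 /= /gauss expRN -invfM lef_pV2 ?posrE ?expR_gt0 //.
    apply: le_trans (expR_ge1Dx _); apply: (@le_trans _ _ (c * n%:R ^+ 2)).
      rewrite ler_pM2l // expr2 ler_peMl // ler1n; near: n; exact: nbhs_infty_gt.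
    by rewrite lerDr.
  by rewrite mulr_gt0 // ltr0n; near: n; exact: nbhs_infty_gt.
- exact: cvg_cst.
- rewrite -(mulr0 c^-1); apply: cvgM; first exact: cvg_cst.
  apply/gtr0_cvgV0; last exact: cvgr_idn.
  by near=> n; rewrite ltr0n; near: n; exact: nbhs_infty_gt.
Unshelve. all: by end_near. Qed.

(** The linear factor is absorbed by half of the exponent. *)
Lemma gauss_moment_bound (c t : R) : 0 < c ->
  `|t| * gauss c t <= (1 + c^-1 *+ 2) * gauss (c / 2) t.
Proof.
move=> c0; have -> : gauss c t = gauss (c / 2) t * gauss (c / 2) t.
  by rewrite /gauss -expRD; congr expR; field.
rewrite mulrA ler_wpM2r ?expR_ge0 // /gauss expRN ler_pdivrMr ?expR_gt0 //.
have H : 1 + c / 2 * t ^+ 2 <= expR (c / 2 * t ^+ 2) := expR_ge1Dx _.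
apply: (@le_trans _ _ ((1 + c^-1 *+ 2) * (1 + c / 2 * t ^+ 2))); last first.
  by rewrite ler_wpM2l // addr_ge0 // mulrn_wge0 // invr_ge0 ltW.
have -> : (1 + c^-1 *+ 2) * (1 + c / 2 * t ^+ 2) =
  1 + c^-1 *+ 2 + c / 2 * t ^+ 2 + t ^+ 2 by field; rewrite gt_eqF.
have ci : 0 < c^-1 by rewrite invr_gt0.
have : 0 <= c / 2 * t ^+ 2 by rewrite mulr_ge0 ?sqr_ge0 ?divr_ge0 ?ltW.
rewrite -(real_normK (num_real t)); have := normr_ge0 t.
set y := `|t|; nra.
Qed.

Lemma integrable_gauss_mul (c : R) (f : R -> R) : 0 < c -> measurable_fun [set: R] f ->
  (forall t, `|f t| <= 1) -> mu.-integrable [set: R] (EFin \o (fun t => gauss c t * f t)).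
Proof.
move=> c0 mf f1; apply: (@integrable_dominated_lebesgue _ _ _ (gauss c)) => //.
- apply: measurable_funM => //; apply: continuous_measurable_fun; exact: continuous_gauss.
- exact: integrable_gauss.
- by move=> t _; rewrite normrM ger0_norm ?expR_ge0 // ler_piMr // expR_ge0.
Qed.

(** The Fourier transform of a Gaussian: both sides solve
[h' = - u / (2 c) * h] with the same value at [0]. *)
Lemma gauss_fourier (c u : R) : 0 < c ->
  \int[mu]_t (gauss c t * cos (t * u)) = Num.sqrt (pi / c) * gauss ((4 * c)^-1) u.
Proof.
move=> c0; pose h u := \int[mu]_t (gauss c t * cos (t * u)).
pose k u := \int[mu]_t (gauss c t * (t * - sin (t * u))).
have did v (t : R) : is_derive t 1 (fun t => t * v) v.
  by apply: (is_derive_ext (is_derive_scaleE v (is_derive_id t 1))) => [x|]; rewrite ?mulr1 // mulrC.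
have dcos v (t : R) := is_derive_cosE (did v t).
have dsin v (t : R) := is_derive_sinE (did v t).
have mc v : measurable_fun [set: R] (fun t => cos (t * v)).
  by apply: continuous_measurable_fun => t; exact: is_derive_continuous (dcos v t).
have dgs v (t : R) : is_derive t 1 (fun t => gauss c t * sin (t * v))
    (- (2 * c * t) * gauss c t * sin (t * v) + gauss c t * (v * cos (t * v))).
  exact: (is_derive_mulE (is_derive_gauss c t) (dsin v t)).
pose G t := (1 + c^-1 *+ 2) * gauss (c / 2) t.
have iG : mu.-integrable [set: R] (EFin \o G).
  exact: integrableZR (integrable_gauss (divr_gt0 c0 (ltr0Sn _ 1))).
have ksb v t : `|gauss c t * (t * - sin (t * v))| <= G t.
  rewrite !normrM normrN ger0_norm ?expR_ge0 // mulrCA mulrA.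
  apply: le_trans (gauss_moment_bound t c0).
  by rewrite ler_piMr ?sin_max // mulr_ge0 ?expR_ge0.
have cks v : continuous (fun t => gauss c t * (t * - sin (t * v))).
  move=> t; apply: cvgM; first exact: continuous_gauss.
  apply: cvgM; first exact: cvg_id.
  by apply: cvgN; exact: is_derive_continuous (dsin v t).
have iks v : mu.-integrable [set: R] (EFin \o (fun t => gauss c t * (t * - sin (t * v)))).
  by apply: (integrable_dominated_lebesgue _ _ iG) => //; exact: continuous_measurable_fun.
have ic v : mu.-integrable [set: R] (EFin \o (fun t => gauss c t * cos (t * v))).
  by apply: integrable_gauss_mul => // t; exact: cos_max.
have ccs v : continuous (fun t => gauss c t * cos (t * v)).
  move=> t; apply: cvgM; first exact: continuous_gauss.
  exact: is_derive_continuous (dcos v t).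
have kE v : k v = - (v / (2 * c)) * h v.
  have dgs' (t : R) : is_derive t 1 (fun t => gauss c t * sin (t * v))
      (2 * c * (gauss c t * (t * - sin (t * v))) + v * (gauss c t * cos (t * v))).
    by apply: (is_derive_ext (dgs v t)) => //; ring.
  have cnt : continuous (fun t => 2 * c * (gauss c t * (t * - sin (t * v))) + v * (gauss c t * cos (t * v))).
    by move=> t; apply: cvgD; apply: cvgM; [exact: cvg_cst|exact: cks|exact: cvg_cst|exact: ccs].
  have ik2 : mu.-integrable [set: R] (EFin \o (fun t => 2 * c * (gauss c t * (t * - sin (t * v))))).
    exact: integrableZR.
  have ic2 : mu.-integrable [set: R] (EFin \o (fun t => v * (gauss c t * cos (t * v)))).
    exact: integrableZR.
  have ikc := integrableDR measurableT ik2 ic2.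
  have vanish (s : R) : (s == 1) || (s == -1) -> gauss c (s * n%:R) * sin (s * n%:R * v) @[n --> \oo] --> 0.
    move=> s1; apply: norm_cvg0.
    apply: (@squeeze_cvgr _ _ _ _ (fun=> 0) (fun n : nat => gauss c n%:R)).
    - apply: nearW => n; rewrite normr_ge0 /= normrM ger0_norm ?expR_ge0 //.
      have -> : gauss c (s * n%:R) = gauss c n%:R.
        by rewrite /gauss exprMn; case/orP: s1 => /eqP ->; rewrite ?sqrrN expr1n mul1r.
      by rewrite ler_piMr ?expR_ge0 // sin_max.
    - exact: cvg_cst.
    - exact: gauss_cvg0.
  have e1 : gauss c n%:R * sin (n%:R * v) @[n --> \oo] --> 0.
    have := vanish 1; rewrite eqxx => /(_ isT).
    by under eq_cvg do rewrite mul1r.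
  have e2 : gauss c (- n%:R) * sin (- n%:R * v) @[n --> \oo] --> 0.
    have := vanish (-1); rewrite eqxx orbT => /(_ isT).
    by under eq_cvg do rewrite mulN1r.
  have := Rintegral_derive_line cnt dgs' ikc e1 e2.
  rewrite RintegralD // !RintegralZl // -/(k v) -/(h v) => E.
  apply: (@mulfI _ (2 * c)); first by rewrite gt_eqF // mulr_gt0.
  transitivity (- (v * h v)); first by apply/eqP; rewrite -addr_eq0 E.
  by field; rewrite gt_eqF.
have dh (v : R) : is_derive v 1 h (- (v / (2 * c)) * h v).
  rewrite -kE.
  apply: (@is_derive_under_integral R setT (fun x t => gauss c t * cos (t * x))
    (fun x t => gauss c t * (t * - sin (t * x))) G (v - 1) (v + 1)) => //.
  - by apply/andP; split; lra.
  - move=> x t _ _; apply: is_derive_scaleE.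
    apply: is_derive_cosE; apply: (is_derive_ext (is_derive_scaleE t (is_derive_id x 1))) => //.
    by rewrite mulr1.
  - by move=> t; apply: le_trans (ksb 0 t).
have dH (v : R) : is_derive v 1 (fun v => h v * expR ((4 * c)^-1 * v ^+ 2)) 0.
  have dq : is_derive v 1 (fun v : R => (4 * c)^-1 * v ^+ 2) (v / (2 * c)).
    apply: (is_derive_ext (is_derive_scaleE _ (is_deriveX 2 (is_derive_id v 1)))) => //.
    by rewrite /GRing.scale /= expr1 mulr1; field; rewrite gt_eqF.
  by apply: (is_derive_ext (is_derive_mulE (dh v) (is_derive_expE dq))) => //; ring.
have h0 : h 0 = Num.sqrt (pi / c).
  rewrite -Rintegral_gauss //; apply: eq_Rintegral => t _.
  by rewrite mulr0 cos0 mulr1.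
have := is_derive_0_is_cst u 0 dH; rewrite expr0n mulr0 expR0 mulr1 h0 => <-.
by rewrite /gauss expRN mulfK // gt_eqF // expR_gt0.
Qed.

End Gaussian.

(** * The normal distribution function and Scheffe's lemma *)

Section NormalCdf.
Context {R : realType}.
Notation mu := (@lebesgue_measure R).
Notation Phi := (@std_normal_cdf R).

Lemma integrable_normal_pdfS (m s : R) (D : set R) : measurable D ->
  mu.-integrable D (EFin \o normal_pdf m s).
Proof.
by move=> mD; apply: (@integrableS _ _ R mu setT D) => //; exact: integrable_normal_pdf.
Qed.

Lemma Rintegral_normal_pdf (m s : R) : \int[mu]_t normal_pdf m s t = 1.
Proof. by rewrite /Rintegral integral_normal_pdf. Qed.

Lemma std_normal_cdfE z : Phi z = \int[mu]_(t in `]-oo, z]) normal_pdf 0 1 t.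
Proof. by []. Qed.

Lemma le_Rintegral_normal (m s : R) (A B : set R) : measurable A -> measurable B ->
  A `<=` B -> \int[mu]_(t in A) normal_pdf m s t <= \int[mu]_(t in B) normal_pdf m s t.
Proof.
move=> mA mB AB; rewrite /Rintegral; apply: fine_le.
- exact: integrable_fin_num (integrable_normal_pdfS _ _ mA).
- exact: integrable_fin_num (integrable_normal_pdfS _ _ mB).
- apply: (@ge0_subset_integral _ _ R mu A B mA mB) => //.
    exact: (measurable_int mu (integrable_normal_pdfS m s mB)).
  by move=> t _; rewrite lee_fin normal_pdf_ge0.
Qed.

Lemma std_normal_cdf_ge0 z : 0 <= Phi z.
Proof. by apply: Rintegral_ge0 => t _; exact: normal_pdf_ge0. Qed.

Lemma std_normal_cdf_le1 z : Phi z <= 1.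
Proof.
rewrite std_normal_cdfE -[leRHS](Rintegral_normal_pdf 0 1).
by apply: le_Rintegral_normal => //; exact: measurable_itv.
Qed.

Lemma std_normal_cdf_le y z : y <= z -> Phi y <= Phi z.
Proof.
move=> yz; apply: le_Rintegral_normal; try exact: measurable_itv.
by apply: subset_itvl; rewrite bnd_simp.
Qed.

(** The density is bounded by its peak, so the distribution function is Lipschitz. *)
Lemma continuous_std_normal_cdf : continuous Phi.
Proof.
have lip y z : y <= z -> Phi z - Phi y <= normal_peak 1 * (z - y).
  move=> yz; rewrite !std_normal_cdfE Rintegral_itvB //; last first.
    by apply: integrable_normal_pdfS; exact: measurable_itv.
  apply: (@le_trans _ _ (\int[mu]_(t in `]y, z]) normal_peak 1)).
    have mI : measurable (`]y, z]%classic : set R) by exact: measurable_itv.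
    have iC : mu.-integrable `[y, z] (EFin \o (fun=> normal_peak 1 : R)).
      by apply: integrable_itv_continuous => t; exact: cvg_cst.
    have iC' : mu.-integrable `]y, z] (EFin \o (fun=> normal_peak 1 : R)).
      exact: (@integrableS _ _ R mu _ _ _ (measurable_itv _) mI (@subset_itv_oc_cc _ _ _ _) iC).
    apply: (@le_Rintegral _ _ R mu _ _ _ mI (integrable_normal_pdfS _ _ mI) iC') => t _.
    by apply: normal_pdf_ub.
  rewrite Rintegral_cst; last exact: measurable_itv.
  rewrite /= lebesgue_measure_itv /= lte_fin; case: (ltP y z) => //= zy.
  by rewrite mulr0 mulr_ge0 ?normal_peak_ge0 // subr_ge0.
move=> z; apply/cvgrPdist_le => e e0.
have P0 : 0 < normal_peak 1 :> R by rewrite normal_peak_gt0.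
near=> y.
have yz : `|z - y| <= e / normal_peak 1.
  by near: y; apply: cvgr_dist_le; [exact: cvg_id|rewrite divr_gt0].
apply: (@le_trans _ _ (normal_peak 1 * `|z - y|)); last first.
  by rewrite mulrC -ler_pdivlMr.
have [zy|yz'] := leP z y.
  have -> : `|Phi z - Phi y| = Phi y - Phi z by rewrite ler0_norm ?subr_le0 ?std_normal_cdf_le // opprB.
  have -> : `|z - y| = y - z by rewrite ler0_norm ?subr_le0 // opprB.
  exact: lip.
have -> : `|Phi z - Phi y| = Phi z - Phi y by rewrite ger0_norm ?subr_ge0 ?std_normal_cdf_le // ltW.
have -> : `|z - y| = z - y by rewrite ger0_norm ?subr_ge0 // ltW.
by apply: lip; exact: ltW.
Unshelve. all: by end_near. Qed.

Lemma std_normal_cdf_subst (m s z : R) : 0 < s ->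
  \int[mu]_(t in `]-oo, z]) normal_pdf m s t = Phi ((z - m) / s).
Proof.
move=> s0; rewrite std_normal_cdfE /Rintegral.
pose F (t : R) := (t - m) / s.
have dF (t : R) : is_derive t 1 F s^-1.
  apply: (is_derive_ext (is_derive_affine s^-1 (- m / s) t)) => // x.
  by rewrite /F; ring.
have F'E : F^`()%classic = cst s^-1.
  by apply/funext => t; rewrite derive1E; case: (dF t).
rewrite -/(F z) (increasing_ge0_integration_by_substitutionNy (F := F) (G := normal_pdf 0 1)).
- congr fine; apply: eq_integral => t _; congr EFin.
  rewrite F'E fctE /= !normal_pdf_gauss //.
  have -> : gauss ((2 * 1 ^+ 2)^-1) (F t - 0) = gauss ((2 * s ^+ 2)^-1) (t - m).
    by rewrite /gauss /F; congr expR; field; rewrite gt_eqF.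
  by rewrite mul1r invfM; ring.
- by move=> x y _ _ xy; rewrite /F ltr_pM2r ?invr_gt0 // ltrD2r.
- by move=> t _; rewrite F'E; exact: cvg_cst.
- by rewrite F'E; exact: is_cvg_cst.
- by rewrite F'E; exact: cvg_cst.
- split; first by move=> t _; case: (dF t).
  by apply: cvg_at_left_filter; exact: is_derive_continuous (dF z).
- apply/gt0_cvgMlNy; first by rewrite invr_gt0.
  exact: cvg_addrr_Ny.
- by apply: continuous_subspaceT; apply: continuous_normal_pdf; rewrite oner_eq0.
- by move=> t _; exact: normal_pdf_ge0.
Qed.

Lemma std_normal_cdf_cvg1 : Phi n%:R @[n --> \oo] --> (1 : R).
Proof.
rewrite -[X in _ --> X](Rintegral_normal_pdf 0 1).
under eq_cvg do rewrite std_normal_cdfE Rintegral_mkcond.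
apply: (@dominated_cvg_lebesgue _ _ _ _ (normal_pdf 0 1)) => //.
- move=> n; have mI : measurable (`]-oo, n%:R]%classic : set R) by exact: measurable_itv.
  exact: ((measurable_restrictT _ mI).1 (measurable_funTS (measurable_normal_pdf 0 1))).
- move=> x _; apply: cvg_near_cst; near=> n.
  rewrite patchE mem_set //= in_itv /=.
  by apply: le_trans (ler_norm _) _; near: n; exact: nbhs_infty_ger.
- exact: integrable_normal_pdf.
- apply: nearW => n x _; rewrite patchE; case: ifP => _.
    by rewrite ger0_norm // normal_pdf_ge0.
  by rewrite normr0 normal_pdf_ge0.
Unshelve. all: by end_near. Qed.

Lemma std_normal_cdf_cvg0 : Phi (- n%:R) @[n --> \oo] --> (0 : R).
Proof.
rewrite -[X in _ --> X](Rintegral_set0 mu (normal_pdf 0 1)) Rintegral_mkcond.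
under eq_cvg do rewrite std_normal_cdfE Rintegral_mkcond.
apply: (@dominated_cvg_lebesgue _ _ _ _ (normal_pdf 0 1)) => //.
- move=> n; have mI : measurable (`]-oo, - n%:R]%classic : set R) by exact: measurable_itv.
  exact: ((measurable_restrictT _ mI).1 (measurable_funTS (measurable_normal_pdf 0 1))).
- move=> x _; rewrite patch_set0; apply: cvg_near_cst; near=> n.
  rewrite patchE memNset //= in_itv /=; apply/negP; rewrite -ltNge ltrNl.
  by apply: le_lt_trans (ler_norm _) _; rewrite normrN; near: n; exact: nbhs_infty_gtr.
- exact: integrable_normal_pdf.
- apply: nearW => n x _; rewrite patchE; case: ifP => _.
    by rewrite ger0_norm // normal_pdf_ge0.
  by rewrite normr0 normal_pdf_ge0.
Unshelve. all: by end_near. Qed.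

(** With equal total masses, [|f_n - f|] has the same integral as twice the positive
part of [f - f_n], which is dominated by [f]. *)
Lemma scheffe (f_ : nat -> R -> R) (f : R -> R) :
  (forall n, mu.-integrable [set: R] (EFin \o f_ n)) -> mu.-integrable [set: R] (EFin \o f) ->
  (forall n t, 0 <= f_ n t) -> (forall t, 0 <= f t) ->
  (forall n, \int[mu]_t f_ n t = \int[mu]_t f t) ->
  (forall t, f_ n t @[n --> \oo] --> f t) ->
  forall D : set R, measurable D ->
  \int[mu]_(t in D) f_ n t @[n --> \oo] --> \int[mu]_(t in D) f t.
Proof.
move=> if_ iff f_0 f0 eqI cvf D mD.
have mR (g : R -> R) : mu.-integrable [set: R] (EFin \o g) -> measurable_fun [set: R] g.
  by move=> /measurable_int /measurable_EFinP.
pose g n t := Num.max (f t - f_ n t) 0.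
have mg n : measurable_fun [set: R] (g n).
  by apply: measurable_maxr => //; apply: measurable_funB; exact: mR.
have gf n t : `|g n t| <= f t.
  rewrite /g ger0_norm ?le_max ?lexx ?orbT // ge_max f0 andbT.
  by rewrite lerBlDr lerDl.
have ig n : mu.-integrable [set: R] (EFin \o g n).
  by apply: (integrable_dominated_lebesgue _ (mg n) iff) => // t _; exact: gf.
have Ig : \int[mu]_t g n t @[n --> \oo] --> 0.
  have <- : \int[mu]_t (fun=> 0 : R) t = 0 by rewrite Rintegral_cst // mul0r.
  apply: (@dominated_cvg_lebesgue _ _ _ _ f) => //; last first.
    by apply: nearW => n t _; exact: gf.
  move=> t _; apply: (@squeeze_cvgr _ _ _ _ (fun=> 0) (fun n => `|f t - f_ n t|)).
  - by apply: nearW => n; rewrite /g le_max lexx orbT ge_max ler_norm normr_ge0.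
  - exact: cvg_cst.
  - by apply/norm_cvg0P; rewrite -(subrr (f t)); apply: cvgB; [exact: cvg_cst|exact: cvf].
(* |f_n - f| = 2 g_n + (f_n - f), and the last term has integral 0 *)
apply/subr_cvg0; apply: norm_cvg0.
apply: (@squeeze_cvgr _ _ _ _ (fun=> 0) (fun n => 2 * \int[mu]_t g n t)).
- apply: nearW => n; rewrite normr_ge0 /=.
  have sE (g1 : R -> R) : mu.-integrable [set: R] (EFin \o g1) -> mu.-integrable D (EFin \o g1).
    by move=> ?; apply: (@integrableS _ _ R mu setT D).
  have iB : mu.-integrable [set: R] (EFin \o (fun t => f_ n t - f t)).
    have := integrableDR measurableT (if_ n) (integrableZR (-1) measurableT iff).
    by congr (_.-integrable _ _); apply/funext => t /=; rewrite mulN1r.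
  have iA : mu.-integrable [set: R] (EFin \o (fun t => `|f_ n t - f t|)).
    exact: integrable_abse iB.
  rewrite -RintegralB; [|by []|exact: sE|exact: sE].
  apply: (le_trans (@le_normr_Rintegral _ _ R mu D _ mD (sE _ iB))).
  apply: (@le_trans _ _ (\int[mu]_t `|f_ n t - f t|)).
    rewrite /Rintegral; apply: fine_le.
    - exact: integrable_fin_num (sE _ iA).
    - exact: integrable_fin_num iA.
    - apply: (@ge0_subset_integral _ _ R mu D setT mD measurableT) => //.
      exact: (measurable_int mu iA).
  have -> : 2 * \int[mu]_t g n t = \int[mu]_t (2 * g n t + (f_ n t - f t)).
    rewrite RintegralD //; last exact: integrableZR.
    by rewrite RintegralZl // RintegralB // eqI subrr addr0.
  rewrite le_eqVlt; apply/orP; left; apply/eqP; apply: eq_Rintegral => t _.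
  rewrite /g; case: (leP (f_ n t) (f t)) => h.
    rewrite distrC ger0_norm ?subr_ge0 // max_l ?subr_ge0 //; lra.
  by rewrite gtr0_norm ?subr_gt0 // max_r ?subr_le0 ?ltW // mulr0 add0r.
- exact: cvg_cst.
- by rewrite -(mulr0 2); apply: cvgM; [exact: cvg_cst|exact: Ig].
Qed.

End NormalCdf.

(** * The continuity theorem for a normal limit *)

Section ContinuityTheorem.
Context {R : realType}.
Notation mu := (@lebesgue_measure R).
Notation Phi := (@std_normal_cdf R).
Variables (I : nat -> finType) (p X : forall n, I n -> R).
Arguments p : clear implicits.
Arguments X : clear implicits.
Hypotheses (p_ge0 : forall n i, 0 <= p n i) (p_sum1 : forall n, \sum_i p n i = 1).
Hypothesis cvg_char : forall t b : R,
  \sum_i p n i * cos (t * X n i - b) @[n --> \oo] --> gauss 2^-1 t * cos b.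

(** By [gauss_fourier], the density of [X + s * N] with [N] standard normal is the
integral of the characteristic function of [X] against a Gaussian in [t]; that
Gaussian dominates. *)
Lemma smoothed_density_cvg (s y : R) : 0 < s ->
  \sum_i p n i * normal_pdf (X n i) s y @[n --> \oo] -->
    normal_pdf 0 (Num.sqrt (1 + s ^+ 2)) y.
Proof.
move=> s0; pose c := s ^+ 2 / 2.
have c0 : 0 < c by rewrite divr_gt0 // exprn_gt0.
have s20 : 0 < 1 + s ^+ 2 by rewrite addr_gt0 // exprn_gt0.
pose K := (s * Num.sqrt (pi *+ 2))^-1 / Num.sqrt (pi / c).
have pc0 (d : R) : 0 < d -> Num.sqrt (pi / d) != 0.
  by move=> d0; rewrite gt_eqF // sqrtr_gt0 divr_gt0 // pi_gt0.
have pdfE (m : R) : normal_pdf m s y = K * \int[mu]_t (gauss c t * cos (t * (y - m))).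
  rewrite normal_pdf_gauss // gauss_fourier // /K.
  have -> : (4 * c)^-1 = (2 * s ^+ 2)^-1 by rewrite /c; congr (_^-1); field.
  by field; rewrite pc0 // (gt_eqF s0) gt_eqF // sqrtr_gt0 mulrn_wgt0 // pi_gt0.
have mg (f : R -> R) : continuous f -> measurable_fun [set: R] (fun t => gauss c t * f t).
  move=> cf; apply: continuous_measurable_fun => t.
  by apply: cvgM; [exact: continuous_gauss|exact: cf].
have ccos (u b : R) : continuous (fun t : R => cos (t * u - b)).
  move=> t; apply: (is_derive_continuous (df := u * - sin (t * u - b))).
  apply: is_derive_cosE; apply: (is_derive_ext (is_derive_affine u (- b) t)) => // x.
  by rewrite addrC mulrC.
have ccos0 (u : R) : continuous (fun t : R => cos (t * u)).
  rewrite (_ : (fun t => _) = (fun t : R => cos (t * u - 0))); first exact: ccos.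
  by apply/funext => t; rewrite subr0.
have ig (f : R -> R) : continuous f -> (forall t, `|f t| <= 1) ->
    mu.-integrable [set: R] (EFin \o (fun t => gauss c t * f t)).
  by move=> cf f1; apply: integrable_gauss_mul => //; exact: continuous_measurable_fun.
pose h n t := \sum_i p n i * cos (t * X n i - t * y).
have hE n : \sum_i p n i * normal_pdf (X n i) s y = K * \int[mu]_t (gauss c t * h n t).
  under eq_bigr => i _ do rewrite pdfE mulrCA.
  rewrite -mulr_sumr; congr (_ * _).
  have -> : \int[mu]_t (gauss c t * h n t) =
      \int[mu]_t (\sum_i p n i * (gauss c t * cos (t * (y - X n i)))).
    apply: eq_Rintegral => t _; rewrite /h mulr_sumr; apply: eq_bigr => i _.
    by rewrite mulrCA -[in LHS]cosN; congr (_ * (_ * cos _)); ring.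
  have igc i : mu.-integrable [set: R] (EFin \o (fun t => gauss c t * cos (t * (y - X n i)))).
    apply: ig => [|t]; last exact: cos_max.
    exact: ccos0.
  rewrite Rintegral_sum //; last by move=> i _; exact: integrableZR.
  by apply: eq_bigr => i _; rewrite RintegralZl.
under eq_cvg do rewrite hE.
have -> : normal_pdf 0 (Num.sqrt (1 + s ^+ 2)) y =
    K * \int[mu]_t (gauss c t * (gauss 2^-1 t * cos (t * y))).
  have -> : \int[mu]_t (gauss c t * (gauss 2^-1 t * cos (t * y))) =
      \int[mu]_t (gauss (c + 2^-1) t * cos (t * y)).
    apply: eq_Rintegral => t _; rewrite mulrA /gauss -expRD; congr (expR _ * _).
    by ring.
  have c20 : 0 < c + 2^-1 by rewrite addr_gt0.
  rewrite gauss_fourier // normal_pdf_gauss ?sqrtr_gt0 // subr0 sqr_sqrtr ?ltW //.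
  have -> : (4 * (c + 2^-1))^-1 = (2 * (1 + s ^+ 2))^-1 by rewrite /c; congr (_^-1); field.
  rewrite mulrA; congr (_ * _); rewrite /K.
  rewrite (_ : c + 2^-1 = (1 + s ^+ 2) / 2); last by rewrite /c; ring.
  have E (d : R) : 0 < d -> Num.sqrt (pi / (d / 2)) = Num.sqrt (pi *+ 2) / Num.sqrt d.
    move=> d0; have -> : pi / (d / 2) = (pi *+ 2) / d by field; rewrite gt_eqF.
    have p2 : 0 <= pi *+ 2 :> R by apply: mulrn_wge0; exact: pi_ge0.
    by rewrite (sqrtrM _ p2) sqrtrV // ltW.
  have p2 : Num.sqrt (pi *+ 2) != 0 :> R by rewrite gt_eqF // sqrtr_gt0 mulrn_wgt0 // pi_gt0.
  have q2 : Num.sqrt (1 + s ^+ 2) != 0 by rewrite gt_eqF // sqrtr_gt0.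
  rewrite /c !E ?exprn_gt0 // sqrtr_sqr ger0_norm ?(ltW s0) //.
  by field; rewrite p2 q2 gt_eqF.
apply: cvgM; first exact: cvg_cst.
apply: (@dominated_cvg_lebesgue _ _ _ _ (gauss c)) => //.
- move=> n; apply: mg => t; apply: cvg_big => [|i _]; first exact: add_continuous.
  apply: cvgM; first exact: cvg_cst.
  have := ccos0 (X n i - y) t; rewrite (_ : (fun t => cos (t * (X n i - y))) =
    (fun t => cos (t * X n i - t * y))) //.
  by apply/funext => x; rewrite mulrBr.
- move=> t _; apply: cvgM; first exact: cvg_cst.
  exact: cvg_char.
- exact: integrable_gauss.
- apply: nearW => n t _; rewrite normrM ger0_norm ?expR_ge0 // ler_piMr ?expR_ge0 //.
  apply: (le_trans (ler_norm_sum _ _ _)); rewrite -(p_sum1 n); apply: ler_sum => i _.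
  by rewrite normrM ger0_norm // ler_piMr // cos_max.
Qed.

Lemma smoothed_cdf_cvg (s z : R) : 0 < s ->
  \sum_i p n i * Phi ((z - X n i) / s) @[n --> \oo] --> Phi (z / Num.sqrt (1 + s ^+ 2)).
Proof.
move=> s0; have s20 : 0 < 1 + s ^+ 2 by rewrite addr_gt0 // exprn_gt0.
have mz : measurable (`]-oo, z]%classic : set R) by exact: measurable_itv.
have ip n (D : set R) i : measurable D ->
  mu.-integrable D (EFin \o (fun t => p n i * normal_pdf (X n i) s t)).
  by move=> mD; apply: integrableZR => //; exact: integrable_normal_pdfS.
have -> : Phi (z / Num.sqrt (1 + s ^+ 2)) =
    \int[mu]_(t in `]-oo, z]) normal_pdf 0 (Num.sqrt (1 + s ^+ 2)) t.
  by rewrite std_normal_cdf_subst ?sqrtr_gt0 // subr0.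
have E n : \sum_i p n i * Phi ((z - X n i) / s) =
    \int[mu]_(t in `]-oo, z]) (\sum_i p n i * normal_pdf (X n i) s t).
  rewrite Rintegral_sum //; last by move=> i _; exact: ip.
  apply: eq_bigr => i _; rewrite RintegralZl ?std_normal_cdf_subst //.
  exact: integrable_normal_pdfS.
under eq_cvg do rewrite E.
apply: scheffe => //.
- by move=> n; apply: integrable_sumR => // i _; exact: ip.
- exact: integrable_normal_pdf.
- by move=> n t; apply: sumr_ge0 => i _; rewrite mulr_ge0 ?normal_pdf_ge0.
- by move=> t; exact: normal_pdf_ge0.
- move=> n; rewrite Rintegral_normal_pdf Rintegral_sum //; last by move=> i _; exact: ip.
  rewrite -(p_sum1 n); apply: eq_bigr => i _.
  by rewrite RintegralZl ?Rintegral_normal_pdf ?mulr1 //; exact: integrable_normal_pdf.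
- by move=> t; exact: smoothed_density_cvg.
Qed.

(** Smoothing [X] at scale [s] and moving the threshold by [d] costs at most
[1 - Phi (d / s)] on each side. With [d = 1 / k] and [s = d ^ 2] the quotient
[d / s = k] tends to infinity while [d] and [s] tend to [0]. *)
Lemma continuity_theorem_normal (z : R) :
  \sum_(i | X n i <= z) p n i @[n --> \oo] --> Phi z.
Proof.
pose d (k : nat) : R := k.+1%:R^-1.
have d0 k : 0 < d k by rewrite invr_gt0 ltr0n.
have kd k : k.+1%:R * d k = 1 by rewrite /d mulfV // pnatr_eq0.
have P_le1 n : \sum_(i | X n i <= z) p n i <= 1.
  rewrite -(p_sum1 n) [leRHS](bigID (fun i => X n i <= z)) /= lerDl.
  by apply: sumr_ge0.
have upper k n : \sum_(i | X n i <= z) p n i <=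
    \sum_i p n i * Phi ((z + d k - X n i) / d k ^+ 2) + (1 - Phi k.+1%:R).
  apply: (@le_trans _ _ (\sum_(i | X n i <= z) p n i * Phi k.+1%:R + (1 - Phi k.+1%:R))).
    rewrite -mulr_suml.
    have := P_le1 n; have := std_normal_cdf_le1 (k.+1%:R : R).
    set a := \sum_(i | _) _; set b := Phi _ => b1 a1.
    have : 0 <= (1 - a) * (1 - b) by rewrite mulr_ge0 // subr_ge0.
    nra.
  rewrite lerD2r [leRHS](bigID (fun i => X n i <= z)) /= -[leLHS]addr0.
  apply: lerD; last by apply: sumr_ge0 => i _; rewrite mulr_ge0 ?std_normal_cdf_ge0.
  apply: ler_sum => i Xz; rewrite ler_wpM2l // std_normal_cdf_le //.
  rewrite ler_pdivlMr ?exprn_gt0 // expr2 mulrA kd mul1r.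
  by rewrite addrAC lerDr subr_ge0.
have lower k n : \sum_i p n i * Phi ((z - d k - X n i) / d k ^+ 2) - Phi (- k.+1%:R) <=
    \sum_(i | X n i <= z) p n i.
  rewrite lerBlDr (bigID (fun i => X n i <= z)) /=; apply: lerD.
    by apply: ler_sum => i _; rewrite ler_piMr // std_normal_cdf_le1.
  rewrite -[leRHS]mul1r -[X in _ <= X * _](p_sum1 n) mulr_suml [leRHS](bigID (fun i => X n i <= z)) /=.
  rewrite -[leLHS]add0r; apply: lerD.
    by apply: sumr_ge0 => i _; rewrite mulr_ge0 ?std_normal_cdf_ge0.
  apply: ler_sum => i Xz; rewrite ler_wpM2l // std_normal_cdf_le //.
  rewrite ler_pdivrMr ?exprn_gt0 // expr2 mulrA mulNr kd mulN1r.
  rewrite addrAC gerDr subr_le0 ltW // ltNge //.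
have cd : d k @[k --> \oo] --> 0 by exact: cvg_harmonic.
have cPhi (e : R) : e ^+ 2 = 1 ->
    Phi ((z + e * d k) / Num.sqrt (1 + (d k ^+ 2) ^+ 2)) @[k --> \oo] --> Phi z.
  move=> e1; apply: continuous_cvg; first exact: continuous_std_normal_cdf.
  have zE : (z + e * 0) / Num.sqrt (1 + (0 ^+ 2) ^+ 2) = z.
    by rewrite !expr2 !mulr0 !addr0 sqrtr1 divr1.
  rewrite -[X in _ --> X]zE.
  apply: cvgM.
    by apply: cvgD; [exact: cvg_cst|apply: cvgM; [exact: cvg_cst|exact: cd]].
  apply: cvgV; first by rewrite !expr2 !mulr0 addr0 sqrtr1 oner_neq0.
  apply: continuous_cvg; first exact: sqrt_continuous.
  apply: cvgD; first exact: cvg_cst.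
  by under eq_cvg do rewrite !expr2; rewrite !expr2; apply: cvgM; apply: cvgM.
have cP1 : Phi k.+1%:R @[k --> \oo] --> (1 : R).
  by rewrite (cvg_shiftS (fun k => Phi k%:R)); exact: std_normal_cdf_cvg1.
have cP0 : Phi (- k.+1%:R) @[k --> \oo] --> (0 : R).
  by rewrite (cvg_shiftS (fun k => Phi (- k%:R))); exact: std_normal_cdf_cvg0.
apply/cvgrPdist_le => e e0.
have e3 : 0 < e / 3 by rewrite divr_gt0.
have [k [ku kl k1 k0]] : exists k, [/\
    Phi ((z + d k) / Num.sqrt (1 + (d k ^+ 2) ^+ 2)) <= Phi z + e / 3,
    Phi z - e / 3 <= Phi ((z - d k) / Num.sqrt (1 + (d k ^+ 2) ^+ 2)),
    1 - Phi k.+1%:R <= e / 3 & Phi (- k.+1%:R) <= e / 3].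
  have /cvgrPdist_le/(_ _ e3) H1 := cPhi 1 (expr1n _ _).
  have /cvgrPdist_le/(_ _ e3) H2 := cPhi (-1) (etrans (sqrrN 1) (expr1n _ _)).
  have /cvgrPdist_le/(_ _ e3) H3 := cP1.
  have /cvgrPdist_le/(_ _ e3) H4 := cP0.
  near \oo => k; exists k; split.
  - have : `|Phi z - Phi ((z + 1 * d k) / Num.sqrt (1 + (d k ^+ 2) ^+ 2))| <= e / 3 by near: k.
    by rewrite mul1r ler_distlC => /andP[].
  - have : `|Phi z - Phi ((z + -1 * d k) / Num.sqrt (1 + (d k ^+ 2) ^+ 2))| <= e / 3 by near: k.
    by rewrite mulN1r ler_distlC => /andP[].
  - by apply: (le_trans (ler_norm _)); near: k.
  - apply: (le_trans (ler_norm _)); rewrite -normrN -sub0r; by near: k.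
have s0 : 0 < d k ^+ 2 by rewrite exprn_gt0.
have /cvgrPdist_le/(_ _ e3) Hu := smoothed_cdf_cvg (z := z + d k) s0.
have /cvgrPdist_le/(_ _ e3) Hl := smoothed_cdf_cvg (z := z - d k) s0.
near=> n.
have hu : `|Phi ((z + d k) / Num.sqrt (1 + (d k ^+ 2) ^+ 2)) -
  \sum_i p n i * Phi ((z + d k - X n i) / d k ^+ 2)| <= e / 3 by near: n.
have hl : `|Phi ((z - d k) / Num.sqrt (1 + (d k ^+ 2) ^+ 2)) -
  \sum_i p n i * Phi ((z - d k - X n i) / d k ^+ 2)| <= e / 3 by near: n.
have := upper k n; have := lower k n.
move: hu hl; rewrite !ler_distlC => /andP[_ hu] /andP[hl _] lo up.
by apply/andP; split; lra.
Unshelve. all: by end_near. Qed.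
End ContinuityTheorem.

(** * Elementary inequalities *)

Section Elementary.
Context {R : realType}.
Implicit Types x y t : R.

(** Alternate integration of [cos <= 1] from [0] gives the Taylor bounds below. *)
Lemma ge0_of_derive (f df : R -> R) y : 0 <= y -> f 0 = 0 ->
  (forall t : R, is_derive t 1 f (df t)) -> (forall t, 0 <= t -> 0 <= df t) -> 0 <= f y.
Proof.
move=> y0 f0 dfE df0.
have dI : forall x, x \in `]0, y[ -> is_derive x 1 f (df x) by move=> x _; exact: dfE.
have cf : {within `[0, y], continuous f}.
  by apply: continuous_subspaceT => t; exact: is_derive_continuous (dfE t).
have [t t0y E] := MVT_segment y0 dI cf.
move: E; rewrite f0 !subr0 => ->; rewrite mulr_ge0 // df0 //.
by move: t0y; rewrite in_itv /= => /andP[].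
Qed.

Lemma sin_le_id y : 0 <= y -> sin y <= y.
Proof.
move=> y0; rewrite -subr_ge0.
apply: (@ge0_of_derive (fun t => t - sin t) (fun t => 1 - cos t)) => //.
- by rewrite sin0 subr0.
Qed.

Lemma cos_ge_quad y : 0 <= y -> 1 - y ^+ 2 / 2 <= cos y.
Proof.
move=> y0; rewrite -subr_ge0.
apply: (@ge0_of_derive (fun t => cos t - (1 - t ^+ 2 / 2)) (fun t => t - sin t)) => //.
- by rewrite cos0 expr2 !mul0r subr0 subrr.
- move=> t; apply: (@is_derive_ext R _ _ _ _ _ (is_deriveB (is_derive_cos t)
    (is_deriveB (is_derive_cst (1 : R) t 1) (is_derive_scaleE 2^-1 (is_deriveX 2 (is_derive_id t 1)))))).
    by move=> u; rewrite /= !fctE; ring.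
  by rewrite /GRing.scale /=; field.
- by move=> t t0; rewrite subr_ge0 sin_le_id.
Qed.

Lemma sin_ge_cubic y : 0 <= y -> y - y ^+ 3 / 6 <= sin y.
Proof.
move=> y0; rewrite -subr_ge0.
apply: (@ge0_of_derive (fun t => sin t - (t - t ^+ 3 / 6)) (fun t => cos t - (1 - t ^+ 2 / 2))) => //.
- by rewrite sin0 expr0n /= mul0r !subr0.
- move=> t; apply: (@is_derive_ext R _ _ _ _ _ (is_deriveB (is_derive_sin t)
    (is_deriveB (is_derive_id t 1) (is_derive_scaleE 6^-1 (is_deriveX 3 (is_derive_id t 1)))))).
    by move=> u; rewrite /= !fctE; ring.
  by rewrite /GRing.scale /=; field.
- by move=> t t0; rewrite subr_ge0 cos_ge_quad.
Qed.

Lemma cos_le_quartic y : 0 <= y -> cos y <= 1 - y ^+ 2 / 2 + y ^+ 4 / 24.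
Proof.
move=> y0; rewrite -subr_ge0.
apply: (@ge0_of_derive (fun t => 1 - t ^+ 2 / 2 + t ^+ 4 / 24 - cos t)
  (fun t => sin t - (t - t ^+ 3 / 6))) => //.
- by rewrite cos0 !expr0n /= !mul0r; ring.
- move=> t; apply: (@is_derive_ext R _ _ _ _ _ (is_deriveB
    (is_deriveD (is_deriveB (is_derive_cst (1 : R) t 1) (is_derive_scaleE 2^-1 (is_deriveX 2 (is_derive_id t 1))))
      (is_derive_scaleE 24^-1 (is_deriveX 4 (is_derive_id t 1)))) (is_derive_cos t))).
    by move=> u; rewrite /= !fctE; ring.
  by rewrite /GRing.scale /=; field.
- by move=> t t0; rewrite subr_ge0 sin_ge_cubic.
Qed.

Lemma sin_id_dist y : `|sin y - y| <= `|y| ^+ 3.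
Proof.
wlog y0 : y / 0 <= y => [H|].
  have [/H//|/ltW y0] := leP 0 y.
  by have := H (- y); rewrite sinN oppr_ge0 -opprD !normrN; apply.
rewrite ler0_norm ?subr_le0 ?sin_le_id // opprB ger0_norm //.
have := sin_ge_cubic y0; have : 0 <= y ^+ 3 by rewrite exprn_ge0.
lra.
Qed.

Lemma cos_quad_dist y : `|1 - cos y - y ^+ 2 / 2| <= y ^+ 4.
Proof.
wlog y0 : y / 0 <= y => [H|].
  have [/H//|/ltW y0] := leP 0 y.
  by have := H (- y); rewrite cosN oppr_ge0 sqrrN exprNn (_ : (-1) ^+ 4 = 1) ?mul1r //; [apply|ring].
rewrite ler_norml; have := cos_ge_quad y0; have := cos_le_quartic y0.
have : 0 <= y ^+ 4 by rewrite exprn_ge0.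
by move=> ? ? ?; apply/andP; split; lra.
Qed.

(** [1 - cos y = 2 * sin (y / 2) ^ 2], and [sin (y / 2) >= y / 4] as long as
[(y / 2) ^ 2 <= 3]. The range [y ^ 2 <= 12] contains a neighbourhood of [[-pi, pi]],
which leaves room for the shift of the phases. *)
Lemma one_minus_cos_ge y : y ^+ 2 <= 12 -> y ^+ 2 / 8 <= 1 - cos y.
Proof.
wlog y0 : y / 0 <= y => [H|y12].
  have [/H//|/ltW y0] := leP 0 y.
  by have := H (- y); rewrite cosN oppr_ge0 sqrrN; apply.
have -> : 1 - cos y = 2 * sin (y / 2) ^+ 2.
  rewrite -[in cos y](_ : (y / 2) *+ 2 = y); last by rewrite -mulr_natr; field.
  by rewrite cos_mulr2n sin2cos2; ring.
have h0 : 0 <= y / 2 by rewrite divr_ge0.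
have := sin_ge_cubic h0.
have : y / 4 <= y / 2 - (y / 2) ^+ 3 / 6.
  rewrite -subr_ge0 (_ : _ - _ = y / 4 * (1 - y ^+ 2 / 12)); last by field.
  by rewrite mulr_ge0 ?divr_ge0 // subr_ge0 ler_pdivrMr // mul1r.
move=> h1 h2; have h3 : y / 4 <= sin (y / 2) by apply: le_trans h2.
have h4 : (y / 4) ^+ 2 <= sin (y / 2) ^+ 2.
  by rewrite lerXn2r // nnegrE ?divr_ge0 // (le_trans _ h3) // divr_ge0.
by apply: le_trans (ler_wpM2l _ h4) => //; rewrite le_eqVlt; apply/orP; left; apply/eqP; field.
Qed.

(** [cos (17 / 10)] is negative by its Taylor bound of order 4. *)
Lemma pi_le_17_5 : pi <= 17 / 5 :> R.
Proof.
suff : pi / 2 <= 17 / 10 :> R by lra.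
rewrite leNgt; apply/negP => h.
have c0 : 0 < cos (17 / 10 : R) by apply: cos_gt0_pihalf; rewrite h andbT; have := @pi_ge0 R; lra.
have y0 : 0 <= 17 / 10 :> R by [].
have := cos_le_quartic y0.
rewrite (_ : (17 / 10) ^+ 2 = 289 / 100 :> R); last by field.
have : (17 / 10) ^+ 4 <= 9 :> R.
  rewrite (_ : (17 / 10) ^+ 4 = ((17 / 10) ^+ 2) ^+ 2 :> R); last by rewrite -exprM.
  have -> : 9 = 3 ^+ 2 :> R by ring.
  by rewrite lerXn2r ?nnegrE ?exprn_ge0 //; lra.
lra.
Qed.

(** [s = sin (pi / 6)] solves [3 s - 4 s ^ 3 = 1], whose only positive root is [1 / 2],
and [sin y <= y]. *)
Lemma pi_ge3 : 3 <= pi :> R.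
Proof.
pose s : R := sin (pi / 6); pose c : R := cos (pi / 6).
have p0 : 0 < pi :> R := pi_gt0 R.
have s0 : 0 < s by apply: sin_gt0_pi; lra.
have cs : c ^+ 2 + s ^+ 2 = 1 := cos2Dsin2 _.
have : sin (pi / 6 + (pi / 6) *+ 2) = 1 :> R.
  by rewrite -[RHS]sin_pihalf; congr sin; rewrite -mulr_natr; field.
rewrite sinD sin_mulr2n cos_mulr2n -/s -/c => E.
have : s = 1 / 2.
  have c2 : c ^+ 2 = 1 - s ^+ 2 by rewrite -cs; ring.
  have : (s + 1) * (2 * s - 1) ^+ 2 = 0.
    have E2 : s * ((1 - s ^+ 2) *+ 2 - 1) + (1 - s ^+ 2) * s *+ 2 = 1.
      by rewrite -c2 -[RHS]E; ring.
    rewrite (_ : _ * _ = 1 - (s * ((1 - s ^+ 2) *+ 2 - 1) + (1 - s ^+ 2) * s *+ 2)); last by ring.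
    by rewrite E2 subrr.
  move=> /eqP; rewrite mulf_eq0 sqrf_eq0 => /orP[]/eqP; lra.
have := @sin_le_id (pi / 6); rewrite -/s => /(_ _)/[swap] -> /(_ _).
have : 0 <= pi / 6 :> R by lra.
by move=> h /(_ h); lra.
Qed.

Lemma expR1_ge : 9 / 4 <= expR 1 :> R.
Proof.
have h : 3 / 2 <= expR (1 / 2) :> R by have := expR_ge1Dx (1 / 2 : R); lra.
have -> : expR 1 = expR (1 / 2) * expR (1 / 2) :> R by rewrite -expRD; congr expR; field.
apply: (@le_trans _ _ (3 / 2 * (3 / 2))); first lra.
by rewrite ler_pM.
Qed.

(** [e ^ u = (e ^ (u / (k + 1))) ^ (k + 1) >= (u / (k + 1)) ^ (k + 1)]. *)
Lemma expR_dominates (k : nat) (C : R) : \forall u \near +oo, C * u ^+ k <= expR u.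
Proof.
have kn : 0 < k.+1%:R :> R by rewrite ltr0n.
near=> u.
have u0 : 0 < u by near: u; apply: nbhs_pinfty_gt; exact: num_real.
have uC : C * k.+1%:R ^+ k.+1 <= u by near: u; apply: nbhs_pinfty_ge; exact: num_real.
have -> : expR u = expR (u / k.+1%:R) ^+ k.+1.
  by rewrite -expRM_natl; congr expR; field; rewrite gt_eqF.
apply: (@le_trans _ _ ((u / k.+1%:R) ^+ k.+1)).
  rewrite expr_div_n ler_pdivlMr ?exprn_gt0 // mulrAC [leRHS]exprS.
  by rewrite ler_wpM2r // exprn_ge0 // ltW.
have y0 : 0 <= u / k.+1%:R by rewrite divr_ge0 // ltW.
have := expR_ge1Dx (u / k.+1%:R); move: y0; set y := u / _ => y0 hy.
by rewrite lerXn2r ?nnegrE ?expR_ge0 //; lra.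
Unshelve. all: by end_near. Qed.

End Elementary.

(** * Saddle point estimates *)

(** Inside the norm stands the real part of [e ^ (i A) * (x - e ^ (i phi))]; the radicand
is [|x - e ^ (i phi)| ^ 2]. *)
Lemma cos_shift_bound (R : realType) (x A phi : R) :
  `|x * cos A - cos (A + phi)| <= Num.sqrt ((x - 1) ^+ 2 + 2 * x * (1 - cos phi)).
Proof.
rewrite -sqrtr_sqr ler_wsqrtr // cosD.
have := cos2Dsin2 A; have := cos2Dsin2 phi.
set p := cos phi; set r := sin phi; set c := cos A; set s := sin A => E1 E2.
have -> : (x - 1) ^+ 2 + 2 * x * (1 - p) = ((x - p) ^+ 2 + r ^+ 2) * (c ^+ 2 + s ^+ 2).
  by rewrite E2 mulr1 (_ : r ^+ 2 = 1 - p ^+ 2); [ring|rewrite -E1; ring].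
rewrite -subr_ge0.
rewrite (_ : _ - _ = ((x - p) * s - r * c) ^+ 2); first exact: sqr_ge0.
by ring.
Qed.

(** The real part of the sum of a geometric series of ratio [x * e ^ (i phi)]. *)
Lemma geometric_cos_sum (R : realType) (x th phi : R) (a : nat) :
  ((x - 1) ^+ 2 + 2 * x * (1 - cos phi)) * (\sum_(i < a) x ^+ i.+1 * cos (th + i.+1%:R * phi)) =
  x ^+ a.+1 * (x * cos (th + a%:R * phi) - cos (th + a%:R * phi + phi)) -
  x * (x * cos th - cos (th + phi)).
Proof.
elim: a => [|a IH]; first by rewrite big_ord0 mulr0 mul0r addr0 expr1 subrr.
rewrite big_ord_recr /= mulrDr IH.
have -> : th + a.+1%:R * phi = th + a%:R * phi + phi by rewrite -natr1; ring.
set u := th + a%:R * phi.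
have -> : cos u = cos (u + phi) * cos phi + sin (u + phi) * sin phi.
  by rewrite -[in LHS](addrK phi u) cosB.
rewrite [cos (u + phi + phi)]cosD.
by rewrite !exprS; ring.
Qed.

Lemma geometric_cos_bound (R : realType) (x th phi D : R) (a : nat) : 0 < x -> 0 < D ->
  D ^+ 2 = (x - 1) ^+ 2 + 2 * x * (1 - cos phi) ->
  \sum_(i < a) x ^+ i.+1 * cos (th + i.+1%:R * phi) <= x * (x ^+ a + 1) / D.
Proof.
move=> x0 D0 DE; rewrite ler_pdivlMr // -(ler_pM2r D0) -mulrA -expr2 mulrC DE.
rewrite geometric_cos_sum.
have sD : Num.sqrt ((x - 1) ^+ 2 + 2 * x * (1 - cos phi)) = D.
  by rewrite -DE sqrtr_sqr gtr0_norm.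
have := cos_shift_bound x (th + a%:R * phi) phi; rewrite sD ler_norml => /andP[_ h1].
have := cos_shift_bound x th phi; rewrite sD ler_norml => /andP[h2 _].
have xa : 0 < x ^+ a.+1 by rewrite exprn_gt0.
have := ler_wpM2l (ltW xa) h1; have := ler_wpM2l (ltW x0) h2.
set u := x ^+ a.+1 * (_ - _); set w := x * (_ - _) => hw hu.
have -> : x * (x ^+ a + 1) * D = x ^+ a.+1 * D + x * D by rewrite exprS; ring.
by move: hw; rewrite mulrN; lra.
Qed.

Section Saddle.
Context {R : realType}.
Variables (a n : nat) (x : R).
Hypotheses (a_gt0 : (0 < a)%N) (a_lt_n : (a < n)%N) (x_gt0 : 0 < x).
Hypothesis saddle_eq : \sum_(i < a) x ^+ i.+1 = n%:R.

Notation q i := (length_weight x i).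

(** The length [i.+1] has weight [q i], so the terms [i.+1 * x ^ i.+1] are
[i.+1 ^ 2 * q i]. *)
Definition second_moment : R := \sum_(i < a) i.+1%:R * x ^+ i.+1.
Definition mean_count : R := \sum_(i < a) q i.
Definition count_variance : R := \sum_(i < a) q i * (1 - i.+1%:R * (n%:R / second_moment)) ^+ 2.
Notation l2 := second_moment.

Let n_gt0 : 0 < n%:R :> R. Proof. by rewrite ltr0n; apply: leq_ltn_trans a_lt_n. Qed.
Let a_gt0R : 0 < a%:R :> R. Proof. by rewrite ltr0n. Qed.

Lemma length_weight_gt0 (i : 'I_a) : 0 < q i.
Proof. by rewrite divr_gt0 ?exprn_gt0 ?ltr0n. Qed.

Lemma length_weight_mul (i : 'I_a) : q i * i.+1%:R = x ^+ i.+1.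
Proof. by rewrite divfK // pnatr_eq0. Qed.

Lemma saddle_gt1 : 1 < x.
Proof.
rewrite ltNge; apply/negP => x1.
have : \sum_(i < a) x ^+ i.+1 <= a%:R.
  rewrite -[a in a%:R]card_ord -sumr_const; apply: ler_sum => i _.
  by rewrite exprn_ile1 // ltW.
by rewrite saddle_eq ler_nat leqNgt a_lt_n.
Qed.
Let x_ge1 : 1 <= x := ltW saddle_gt1.

Lemma saddle_pow_le i j : (i <= j)%N -> x ^+ i <= x ^+ j.
Proof. by move=> ij; rewrite ler_weXn2l. Qed.

(** The saddle equation with its geometric sum evaluated. *)
Lemma saddle_geometric : n%:R * (x - 1) = x * (x ^+ a - 1).
Proof.
rewrite -saddle_eq subrX1 mulrCA mulrC; congr (_ * _).
by rewrite mulr_sumr; apply: eq_bigr => i _; rewrite exprS.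
Qed.

Lemma top_power_ge : n%:R / a%:R <= x ^+ a.
Proof.
rewrite ler_pdivrMr // -saddle_eq mulr_natr -[a in _ *+ a]card_ord -sumr_const.
by apply: ler_sum => i _; exact: saddle_pow_le.
Qed.

Lemma power_le_n j : (0 < j <= a)%N -> x ^+ j <= n%:R.
Proof.
case: j => // j /andP[_ ja]; rewrite -saddle_eq (bigD1 (Ordinal ja)) //= lerDl.
by apply: sumr_ge0 => i _; rewrite exprn_ge0 // ltW.
Qed.

Lemma second_moment_le : l2 <= a%:R * n%:R.
Proof.
rewrite -saddle_eq mulr_sumr; apply: ler_sum => i _.
by rewrite ler_pM2r ?exprn_gt0 // ler_nat.
Qed.

Lemma second_moment_gt0 : 0 < l2.
Proof.
rewrite /second_moment (bigD1 (Ordinal a_gt0)) //= ltr_pwDl ?mulr_gt0 ?exprn_gt0 //.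
by apply: sumr_ge0 => i _; rewrite mulr_ge0 ?exprn_ge0 // ltW.
Qed.

(** Larger lengths carry larger weights, so the size-biased mean length is at
least the midpoint. *)
Lemma second_moment_ge : (a.+1)%:R / 2 * n%:R <= l2.
Proof.
pose c := (a./2).+1.
have key : 0 <= \sum_(i < a) (2 * i.+1%:R - a.+1%:R) * x ^+ i.+1.
  have E0 : \sum_(i < a) (2 * i.+1%:R - a.+1%:R) = 0 :> R.
    elim: (a) => [|b IH]; first by rewrite big_ord0.
    rewrite big_ord_recr /= (eq_bigr (fun i : 'I_b => (2 * i.+1%:R - b.+1%:R) - 1 : R)).
      by rewrite sumrB IH sumr_const card_ord -!natr1; ring.
    by move=> i _; rewrite -(@natr1 _ b.+1); ring.
  rewrite -[leLHS](mul0r (x ^+ c)) -[in leLHS]E0 mulr_suml; apply: ler_sum => i _.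
  have [ic|ci] := leqP i.+1 c; last first.
    rewrite ler_wpM2l ?saddle_pow_le ?(ltnW ci) // subr_ge0 -natrM ler_nat.
    by move: ci; rewrite /c; lia.
  have [e|ne] := eqVneq i.+1 c; first by rewrite e.
  rewrite -subr_ge0 -mulrBr mulr_le0 //; last by rewrite subr_le0 saddle_pow_le.
  rewrite subr_le0 -natrM ler_nat.
  by move: ic ne; rewrite /c; lia.
have E : \sum_(i < a) (2 * i.+1%:R - a.+1%:R) * x ^+ i.+1 = 2 * l2 - a.+1%:R * n%:R.
  rewrite -saddle_eq /second_moment !mulr_sumr -sumrB; apply: eq_bigr => i _.
  by rewrite mulrBl mulrA.
by move: key; rewrite E => key; lra.
Qed.

Lemma top_ratio_le : a%:R * (n%:R / l2) <= 2.
Proof.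
have l20 := second_moment_gt0.
rewrite mulrA ler_pdivrMr //; have := second_moment_ge; rewrite -natr1.
by have := n_gt0; nra.
Qed.

Lemma size_ratio_le (i : 'I_a) : i.+1%:R * (n%:R / l2) <= 2.
Proof.
apply: le_trans top_ratio_le; rewrite ler_wpM2r ?ler_nat //.
by rewrite divr_ge0 // ltW // second_moment_gt0.
Qed.

Lemma size_dev_le1 (i : 'I_a) : `|1 - i.+1%:R * (n%:R / l2)| <= 1.
Proof.
have := size_ratio_le i.
have : 0 <= i.+1%:R * (n%:R / l2).
  by rewrite mulr_ge0 // divr_ge0 // ltW // second_moment_gt0.
by move=> ? ?; rewrite ler_norml; apply/andP; split; lra.
Qed.

Lemma sum_weight_size : \sum_(i < a) q i * i.+1%:R = n%:R.
Proof. by rewrite -saddle_eq; apply: eq_bigr => i _; rewrite length_weight_mul. Qed.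

Lemma sum_weight_size2 : \sum_(i < a) q i * i.+1%:R ^+ 2 = l2.
Proof. by apply: eq_bigr => i _; rewrite expr2 mulrA length_weight_mul mulrC. Qed.

Lemma count_varianceE : count_variance = mean_count - n%:R ^+ 2 / l2.
Proof.
have l20 := second_moment_gt0.
rewrite /count_variance (eq_bigr (fun i : 'I_a => q i - 2 * (n%:R / l2) * (q i * i.+1%:R) +
  (n%:R / l2) ^+ 2 * (q i * i.+1%:R ^+ 2))); last by move=> i _; ring.
rewrite big_split /= sumrB -!mulr_sumr sum_weight_size sum_weight_size2 -/mean_count.
by field; rewrite gt_eqF.
Qed.

(** A length [j <= k = a / 4] has [j * n / l2 <= 1 / 2], so its factor
[(1 - j * n / l2) ^ 2] is at least [1 / 4]; the upper half of these lengths, at least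
[k / 2] many, has weights at least [x ^ h / k]. *)
Lemma count_variance_ge_pow : (4 <= a)%N -> x ^+ uphalf (a %/ 4) <= 8 * count_variance.
Proof.
move=> a4; set k := (a %/ 4)%N; set h := uphalf k.
have k1 : (0 < k)%N by rewrite divn_gt0.
have ka : (4 * k <= a)%N by rewrite mulnC leq_trunc_div.
have h1 : (0 < h)%N by rewrite /h; lia.
have kR : 0 < k%:R :> R by rewrite ltr0n.
have r0 : 0 <= n%:R / l2 by rewrite divr_ge0 // ltW // second_moment_gt0.
pose c := x ^+ h / k%:R / 4.
have c0 : 0 <= c by rewrite !divr_ge0 // exprn_ge0 // ltW.
apply: (@le_trans _ _ (8 * \sum_(i < a | (h.-1 <= i < k)%N) c)).
  have -> : \sum_(i < a | (h.-1 <= i < k)%N) c = \sum_(h.-1 <= i < k) c.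
    rewrite (@big_nat_widenl _ _ _ h.-1 0) // (@big_nat_widen _ _ _ 0 k a) //; last by lia.
    by rewrite big_mkord; apply: eq_bigl => i; rewrite andbC.
  rewrite sumr_const_nat -[X in _ <= _ * X]mulr_natr /c.
  have hk : k%:R <= 2 * (k - h.-1)%:R :> R by rewrite -natrM ler_nat /h; lia.
  rewrite (_ : 8 * _ = x ^+ h * (2 * (k - h.-1)%:R / k%:R)); last by field; rewrite gt_eqF.
  by rewrite ler_peMr ?exprn_ge0 ?(ltW x_gt0) // ler_pdivlMr // mul1r.
rewrite ler_pM2l // /count_variance [leRHS](bigID (fun i : 'I_a => (h.-1 <= i < k)%N)) /=.
rewrite -[leLHS]addr0; apply: lerD; last first.
  by apply: sumr_ge0 => i _; rewrite mulr_ge0 ?sqr_ge0 // ltW // length_weight_gt0.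
apply: ler_sum => i /andP[hi ik]; rewrite /c ler_pM ?divr_ge0 ?exprn_ge0 ?(ltW x_gt0) //.
  rewrite ler_pM ?invr_ge0 ?exprn_ge0 ?(ltW x_gt0) //.
    by rewrite saddle_pow_le //; lia.
  by rewrite lef_pV2 ?posrE ?ltr0n // ler_nat.
have : i.+1%:R * (n%:R / l2) <= 1 / 2.
  apply: (@le_trans _ _ (k%:R * (n%:R / l2))); first by rewrite ler_wpM2r // ler_nat.
  have : 4 * k%:R <= a%:R :> R by rewrite -natrM ler_nat.
  by have := top_ratio_le; move: (n%:R / l2) r0 => r r0; nra.
have : 0 <= i.+1%:R * (n%:R / l2) by rewrite mulr_ge0.
by move: (_ * _) => y; nra.
Qed.

(** [x ^ a >= n / a], and [a] is at most 11 times the exponent in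
[count_variance_ge_pow]; the worst case is [a = 11]. *)
Lemma count_variance_ge : (4 <= a)%N -> n%:R / a%:R <= (8 * count_variance) ^+ 11.
Proof.
move=> a4; apply: (le_trans top_power_ge).
have h1 : (a <= uphalf (a %/ 4) * 11)%N by lia.
apply: (le_trans (saddle_pow_le h1)); rewrite exprM.
have := count_variance_ge_pow a4; have : 0 <= x ^+ uphalf (a %/ 4) by rewrite exprn_ge0 // ltW.
by move=> h0 hv; rewrite lerXn2r // nnegrE // (le_trans h0).
Qed.

Section Phases.
Variables (th psi : R).
Definition phase (i : 'I_a) : R := th * (1 - i.+1%:R * (n%:R / l2)) + i.+1%:R * psi.

(** The shift by [n / l2] makes the quadratic form in [(th, psi)] diagonal. *)
Lemma sum_phase_sqr : \sum_(i < a) q i * phase i ^+ 2 = th ^+ 2 * count_variance + psi ^+ 2 * l2.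
Proof.
have l20 := second_moment_gt0.
rewrite count_varianceE /phase (eq_bigr (fun i : 'I_a => th ^+ 2 * q i
  + (2 * th * (psi - th * (n%:R / l2))) * (q i * i.+1%:R)
  + (psi - th * (n%:R / l2)) ^+ 2 * (q i * i.+1%:R ^+ 2))); last by move=> i _; ring.
rewrite !big_split /= -!mulr_sumr sum_weight_size sum_weight_size2 -/mean_count.
by field; rewrite gt_eqF.
Qed.

Lemma sum_phase : \sum_(i < a) q i * phase i =
  th * mean_count - th * (n%:R / l2) * n%:R + n%:R * psi.
Proof.
rewrite /phase (eq_bigr (fun i : 'I_a => th * q i
  + (psi - th * (n%:R / l2)) * (q i * i.+1%:R))); last by move=> i _; ring.
by rewrite big_split /= -!mulr_sumr sum_weight_size -/mean_count; ring.
Qed.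

Lemma phase_le (i : 'I_a) : `|phase i| <= `|th| + a%:R * `|psi|.
Proof.
apply: (le_trans (ler_normD _ _)); rewrite !normrM.
rewrite lerD //; first by rewrite ler_piMr // size_dev_le1.
by rewrite normr_nat ler_wpM2r // ler_nat.
Qed.

(** The real part (up to sign) and the imaginary part of
[\sum_i q_i * (e ^ (i phase_i) - 1 - i phase_i)]. *)
Definition cos_defect : R := \sum_(i < a) q i * (1 - cos (phase i)).
Definition sin_defect : R := \sum_(i < a) q i * (sin (phase i) - phase i).

Lemma cos_defect_near :
  `|cos_defect - (th ^+ 2 * count_variance + psi ^+ 2 * l2) / 2| <=
  (`|th| + a%:R * `|psi|) ^+ 2 * (th ^+ 2 * count_variance + psi ^+ 2 * l2).
Proof.
rewrite -sum_phase_sqr mulr_suml -sumrB mulr_sumr.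
apply: (le_trans (ler_norm_sum _ _ _)); apply: ler_sum => i _.
rewrite -mulrA -mulrBr normrM gtr0_norm ?length_weight_gt0 // mulrCA ler_pM2l ?length_weight_gt0 //.
apply: (le_trans (cos_quad_dist _)).
rewrite (_ : phase i ^+ 4 = phase i ^+ 2 * phase i ^+ 2); last by ring.
rewrite ler_wpM2r ?sqr_ge0 // -[phase i ^+ 2]real_normK ?num_real //.
by rewrite lerXn2r ?nnegrE ?addr_ge0 ?mulr_ge0 // phase_le.
Qed.

Lemma sin_defect_near :
  `|sin_defect| <= (`|th| + a%:R * `|psi|) * (th ^+ 2 * count_variance + psi ^+ 2 * l2).
Proof.
rewrite -sum_phase_sqr mulr_sumr.
apply: (le_trans (ler_norm_sum _ _ _)); apply: ler_sum => i _.
rewrite normrM gtr0_norm ?length_weight_gt0 // mulrCA ler_pM2l ?length_weight_gt0 //.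
apply: (le_trans (sin_id_dist _)).
by rewrite exprS real_normK ?num_real // ler_wpM2r ?sqr_ge0 // phase_le.
Qed.

Lemma cos_defect_central : `|th| <= 1 / 64 -> a%:R * `|psi| <= 3 ->
  psi ^+ 2 * l2 / 8 <= cos_defect.
Proof.
move=> th1 psi1; apply: (@le_trans _ _ ((th ^+ 2 * count_variance + psi ^+ 2 * l2) / 8)).
  rewrite ler_pM2r // lerDr mulr_ge0 ?sqr_ge0 //; apply: sumr_ge0 => i _.
  by rewrite mulr_ge0 ?sqr_ge0 // ltW // length_weight_gt0.
rewrite -sum_phase_sqr mulr_suml; apply: ler_sum => i _.
rewrite -mulrA ler_pM2l ?length_weight_gt0 // one_minus_cos_ge //.
rewrite -(real_normK (num_real _)); have := phase_le i.
have := normr_ge0 (phase i); move: (`|phase i|) => y y0 hy.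
(* 49 / 16 = 3 + 4 / 64, and its square is below 12 *)
by have : y <= 49 / 16; [lra|nra].
Qed.

(** Replacing [1 / j] by [1 / a] in the weights leaves
[(n - \sum_j x ^ j * cos (th + j * phi)) / a], and the geometric sum is about
[n * (x - 1) / D] with [D = |x * e ^ (i phi) - 1|]. As [a * |phi| >= 2], the ratio
[(x - 1) / D] stays below [1] by [1 / (2 * (g + 1))], [g = a ^ 2 * (x - 1) ^ 2 / x]; the
correction [4] comes from the term [1] in [x ^ a + 1]. The range of [psi] is the half
period [pi <= 17 / 5]. *)
Lemma cos_defect_tail : `|th| <= 1 / 64 -> 3 < a%:R * `|psi| -> `|psi| <= 17 / 5 ->
  2 <= n%:R / a%:R :> R ->
  (n%:R / a%:R) / (2 * (a%:R ^+ 2 * (x - 1) ^+ 2 / x + 1)) - 4 <= cos_defect.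
Proof.
move=> th1 psi3 psi4 B2.
have l20 := second_moment_gt0.
have w0 : 0 < x - 1 by rewrite subr_gt0 saddle_gt1.
pose phi := psi - th * (n%:R / l2).
have phaseE i : phase i = th + i.+1%:R * phi by rewrite /phase /phi; ring.
(* the shift is smaller than 1 / a and than 1 / 32 *)
have shift : a%:R * `|psi - phi| <= 1 / 32.
  rewrite /phi opprB addrC subrK normrM mulrCA.
  have r0 : 0 <= n%:R / l2 by rewrite divr_ge0 // ltW.
  rewrite (ger0_norm r0).
  have h := top_ratio_le.
  by have := normr_ge0 th; move: th1 h; move: (`|th|) (a%:R * _) => t s; nra.
have a1 : 1 <= a%:R :> R by rewrite ler1n.
have d8 : `|psi - phi| <= 1 / 32.
  by apply: le_trans shift; rewrite ler_peMl.
have phi_lo : 2 <= a%:R * `|phi|.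
  have := ler_normD (psi - phi) phi; rewrite subrK.
  by move=> /(ler_wpM2l (ltW a_gt0R)); rewrite mulrDr; lra.
have phi_hi : phi ^+ 2 <= 12.
  rewrite -(real_normK (num_real _)).
  have := ler_normD (phi - psi) psi; rewrite subrK (distrC phi psi).
  have := normr_ge0 phi; move: (`|phi|) => y y0 hy.
  (* 17 / 5 + 1 / 32 is below 86 / 25, whose square is below 12 *)
  by have : y <= 86 / 25; [lra|nra].
pose D2 := (x - 1) ^+ 2 + 2 * x * (1 - cos phi).
have D2_lo : (x - 1) ^+ 2 + x / a%:R ^+ 2 <= D2.
  rewrite lerD2l; have := one_minus_cos_ge phi_hi => h.
  apply: (@le_trans _ _ (2 * x * (phi ^+ 2 / 8))); last by rewrite ler_pM2l // mulr_gt0.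
  have : 4 <= a%:R ^+ 2 * phi ^+ 2.
    rewrite -(real_normK (num_real phi)) -exprMn (_ : 4 = 2 ^+ 2); last by ring.
    by rewrite lerXn2r ?nnegrE // mulr_ge0.
  rewrite ler_pdivrMr ?exprn_gt0 //.
  by move: (a%:R ^+ 2) (phi ^+ 2) => u w h4; have := x_gt0; nra.
have D2_gt0 : 0 < D2.
  by apply: lt_le_trans D2_lo; rewrite ltr_pwDl ?exprn_gt0 // divr_ge0 ?exprn_ge0 // ltW.
pose D := Num.sqrt D2; have D0 : 0 < D by rewrite sqrtr_gt0.
have DE : D ^+ 2 = D2 by rewrite sqr_sqrtr // ltW.
pose g := a%:R ^+ 2 * (x - 1) ^+ 2 / x.
have g0 : 0 <= g by rewrite divr_ge0 ?mulr_ge0 ?sqr_ge0 // ltW.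
have ratio : (x - 1) / D <= 1 - (2 * (g + 1))^-1.
  have g1 : 0 < g + 1 by rewrite ltr_wpDl.
  have r0 : 0 <= 1 - (2 * (g + 1))^-1.
    rewrite subr_ge0 invf_le1 ?mulr_gt0 //; lra.
  rewrite ler_pdivrMr // -(@ler_pXn2r _ 2) ?nnegrE ?mulr_ge0 ?(ltW w0) ?(ltW D0) //.
  rewrite [leRHS]exprMn DE.
  apply: (@le_trans _ _ ((1 - (g + 1)^-1) * D2)); last first.
    rewrite ler_pM2r // (_ : (1 - (2 * (g + 1))^-1) ^+ 2 = 1 - (g + 1)^-1 + ((2 * (g + 1))^-1) ^+ 2).
      by rewrite lerDl sqr_ge0.
    by field; rewrite gt_eqF.
  apply: (@le_trans _ _ ((1 - (g + 1)^-1) * ((x - 1) ^+ 2 + x / a%:R ^+ 2))); last first.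
    have h1 : (g + 1)^-1 <= 1 by rewrite invf_le1 //; lra.
    by rewrite ler_wpM2l // subr_ge0.
  have gE : a%:R ^+ 2 * (x - 1) ^+ 2 = g * x by rewrite /g divfK // gt_eqF.
  have -> : (x - 1) ^+ 2 + x / a%:R ^+ 2 = (g + 1) * (x / a%:R ^+ 2).
    apply: (@mulfI _ (a%:R ^+ 2)); first by rewrite expf_neq0 // gt_eqF.
    by rewrite mulrDr gE; field; rewrite gt_eqF.
  have -> : (x - 1) ^+ 2 = g * (x / a%:R ^+ 2).
    apply: (@mulfI _ (a%:R ^+ 2)); first by rewrite expf_neq0 // gt_eqF.
    by rewrite gE; field; rewrite gt_eqF.
  by rewrite [leRHS]mulrA mulrBl mul1r mulVf ?gt_eqF // addrK.
have x_a : n%:R / a%:R <= x ^+ a := top_power_ge.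
have xa1 : 0 < x ^+ a - 1 by move: x_a B2; lra.
have G := geometric_cos_bound th a x_gt0 D0 DE.
(* replace each weight x ^ j / j by x ^ j / a *)
have step1 : (n%:R - x * (x ^+ a + 1) / D) / a%:R <= cos_defect.
  apply: (@le_trans _ _ ((n%:R - \sum_(i < a) x ^+ i.+1 * cos (th + i.+1%:R * phi)) / a%:R)).
    by rewrite ler_pM2r ?invr_gt0 // lerD2l lerN2.
  rewrite -saddle_eq -sumrB mulr_suml; apply: ler_sum => i _.
  rewrite phaseE -{1}[x ^+ i.+1]mulr1 -mulrBr mulrAC ler_wpM2r ?subr_ge0 ?cos_le1 //.
  by rewrite ler_pM2l ?exprn_gt0 // lef_pV2 ?posrE ?ltr0n // ler_nat.
apply: le_trans step1; rewrite mulrBl.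
have -> : x * (x ^+ a + 1) / D = n%:R * ((x - 1) / D) * (1 + 2 / (x ^+ a - 1)).
  rewrite [n%:R * (_ / _)]mulrA saddle_geometric; field.
  by rewrite !gt_eqF.
have B0 : 0 < n%:R / a%:R :> R by rewrite divr_gt0.
have -> : n%:R * ((x - 1) / D) * (1 + 2 / (x ^+ a - 1)) / a%:R =
  n%:R / a%:R * (((x - 1) / D) * (1 + 2 / (x ^+ a - 1))).
  by field; rewrite !gt_eqF.
move: B0 x_a B2 xa1; move: (n%:R / a%:R) => B B0 x_a B2 xa1.
have r0 : 0 <= (x - 1) / D by rewrite divr_ge0 // ltW.
have g1 : 0 < g + 1 by rewrite ltr_wpDl.
have loss : B * (2 / (x ^+ a - 1)) <= 4.
  by rewrite mulrA ler_pdivrMr //; lra.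
have loss0 : 0 <= B * (2 / (x ^+ a - 1)) by rewrite mulr_ge0 ?divr_ge0 // ltW.
have h0 : 0 <= (2 * (g + 1))^-1 by rewrite invr_ge0 mulr_ge0 // ltW.
rewrite -[a%:R ^+ 2 * (x - 1) ^+ 2 / x]/g.
move: ratio r0 h0 loss loss0; move: (_^-1) ((x - 1) / D) (2 / _) => h r e ratio r0 h0 loss loss0.
have : B * (r * (1 + e)) <= B * (1 - h) + B * e.
  have : r <= 1 by lra.
  by nra.
by lra.
Qed.
End Phases.
End Saddle.

(** * Mean and variance at the saddle point *)

Section SaddleFunction.
Context {R : realType}.
Variables (a n : nat).
Hypotheses (a_gt0 : (0 < a)%N) (a_lt_n : (a < n)%N).
Let n0 : (0 < n)%N. Proof. exact: leq_ltn_trans a_lt_n. Qed.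
Notation x := (saddle n a (1 : R)).

Lemma saddle1_gt0 : 0 < x.
Proof. by have [] := saddleP n0 a_gt0 (@ltr01 R). Qed.

Lemma saddle1_eq : \sum_(i < a) x ^+ i.+1 = n%:R.
Proof.
have [_] := saddleP n0 a_gt0 (@ltr01 R).
by rewrite divr1 big_add1 big_mkord.
Qed.

Lemma mean_cyclesE : mean_cycles R n a = mean_count a x.
Proof. by rewrite /mean_cycles big_add1 big_mkord. Qed.

(** [saddle] inverts [y |-> n / (\sum_j y ^ j)], so its derivative is the
inverse of the derivative of this function. *)
Lemma var_cyclesE : var_cycles R n a = count_variance a n x.
Proof.
have x0 := saddle1_gt0; have sE := saddle1_eq.
have nR : n%:R != 0 :> R by rewrite pnatr_eq0 -lt0n.
have l20 := second_moment_gt0 a_gt0 x0.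
rewrite (count_varianceE a_gt0 x0 sE) /var_cycles mean_cyclesE; congr (_ + _).
pose S (y : R) := \sum_(i < a) y ^+ i.+1.
pose f (y : R) := n%:R / S y.
have S0 (y : R) : 0 < y -> 0 < S y.
  move=> y0; rewrite /S (bigD1 (Ordinal a_gt0)) //= ltr_pwDl ?exprn_gt0 //.
  by apply: sumr_ge0 => i _; rewrite exprn_ge0 // ltW.
have fK (y : R) : 0 < y -> saddle n a (f y) = y.
  move=> y0; have fy0 : 0 < f y by rewrite divr_gt0 ?S0 // ltr0n.
  apply: (saddle_uniq a_gt0 (saddleP n0 a_gt0 fy0)); split => //.
  by rewrite big_add1 big_mkord -/(S y) /f invfM invrK mulrA mulfV // mul1r.
have dS (y : R) : is_derive y 1 S (\sum_(i < a) i.+1%:R * y ^+ i).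
  apply: is_derive_sumE => i.
  apply: (is_derive_ext (is_deriveX i.+1 (is_derive_id y 1))) => [t|]; first by rewrite fctE.
  by rewrite /GRing.scale /= mulr1.
have df (y : R) : 0 < y -> is_derive y 1 f (n%:R * (- (\sum_(i < a) i.+1%:R * y ^+ i) / S y ^+ 2)).
  move=> y0; apply: is_derive_scaleE.
  have Sy : S y != 0 by rewrite gt_eqF // S0.
  apply: (is_derive_ext (is_deriveV Sy (dS y))) => //.
  by rewrite /GRing.scale /= mulNr mulNr mulrC.
have Sx : S x = n%:R := sE.
have f1 : f x = 1 by rewrite /f Sx mulfV.
have l2E : x * (\sum_(i < a) i.+1%:R * x ^+ i) = second_moment a x.
  by rewrite mulr_sumr; apply: eq_bigr => i _; rewrite mulrCA -exprS.
have dn0 : \sum_(i < a) i.+1%:R * x ^+ i != 0.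
  by apply: contraTneq l20 => e; rewrite -l2E e mulr0 ltxx.
have near0 : \forall y \near x, 0 < y by apply: lt_nbhsr.
have := @is_derive_inverse R f (saddle n a) _ x _ _ (df x x0) _.
rewrite f1 Sx => H.
have [||| _ d1] := H.
- by near=> y; apply: fK; near: y.
- near=> y; apply: (is_derive_continuous (df y _)); near: y; exact: near0.
- by rewrite mulf_neq0 // mulf_neq0 ?oppr_eq0 // invr_eq0 expf_neq0.
rewrite derive1E d1 -l2E; field.
by rewrite nR dn0 gt_eqF.
Unshelve. all: by end_near. Qed.

End SaddleFunction.

(** * Size of the exponent away from the saddle point *)

Section TailExponent.
Context {R : realType}.

Lemma sub1_le_mul_ln (x : R) : 0 < x -> x - 1 <= x * ln x.
Proof.
move=> x0; have := expR_ge1Dx (- ln x); rewrite expRN lnK ?posrE // => h.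
have := ler_wpM2l (ltW x0) h; rewrite mulrDr mulr1 mulfV ?gt_eqF // mulrN; lra.
Qed.

Variables (a n : nat) (x : R).
Hypotheses (a_ge2 : (2 <= a)%N) (a_lt_n : (a < n)%N) (x_gt0 : 0 < x).
Hypothesis saddle_eq : \sum_(i < a) x ^+ i.+1 = n%:R.

Let a_gt0 : (0 < a)%N. Proof. exact: ltnW. Qed.
Let x_gt1 : 1 < x. Proof. exact: saddle_gt1 a_lt_n x_gt0 saddle_eq. Qed.
Let aR : 0 < a%:R :> R. Proof. by rewrite ltr0n. Qed.
Let nR : 0 < n%:R :> R. Proof. by rewrite ltr0n; apply: leq_ltn_trans a_lt_n. Qed.

Notation B := (n%:R / a%:R : R).
Notation D2 := (a%:R ^+ 2 * (x - 1) ^+ 2 / x).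

Let B_ge1 : 1 <= B. Proof. by rewrite ler_pdivlMr // mul1r ler_nat ltnW. Qed.

(** Put [L = a * ln x]. By [saddle_geometric] and [x - 1 <= x * ln x],
[e ^ L <= 1 + B * L]; but [L > 2 * ln (2 * B)] would give
[e ^ L = e ^ (L / 2) * e ^ (L / 2) >= 2 * B * (1 + L / 2)], which is larger. *)
Lemma log_top_power_le : a%:R * ln x <= 2 * ln (2 * B).
Proof.
set L := a%:R * ln x; rewrite leNgt; apply/negP => hL.
have xa : x ^+ a = expR L by rewrite /L expRM_natl lnK.
have L0 : 0 <= L by rewrite mulr_ge0 ?ln_ge0 // ltW.
have up : expR L <= 1 + B * L.
  have e1 : x * (expR L - 1) = n%:R * (x - 1) by rewrite -xa (saddle_geometric saddle_eq).
  have e2 := ler_wpM2l (ltW nR) (sub1_le_mul_ln x_gt0).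
  have -> : B * L = n%:R * ln x by rewrite /L; field; rewrite gt_eqF.
  rewrite -(ler_pM2l x_gt0); move: e2; rewrite -e1.
  by move: (expR L) => E; nra.
have low : 2 * B * (1 + L / 2) <= expR L.
  have -> : expR L = expR (L / 2) * expR (L / 2) by rewrite -expRD; congr expR; field.
  apply: ler_pM.
  - by rewrite mulr_ge0 // (le_trans _ B_ge1).
  - by rewrite addr_ge0 // divr_ge0.
  - have B2 : 0 < 2 * B by rewrite mulr_gt0 // divr_gt0.
    rewrite -[leLHS]lnK ?posrE // ler_expR; lra.
  - exact: expR_ge1Dx.
by have := B_ge1; move: up low; move: (expR L) B => E b; nra.
Qed.

(** [(x - 1) ^ 2 / x <= x * ln x ^ 2 <= 2 * ln x ^ 2]. *)
Lemma gap_small_saddle : x <= 2 -> D2 <= 8 * ln (2 * B) ^+ 2.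
Proof.
move=> x2.
have h := log_top_power_le.
have l0 : 0 <= ln x by rewrite ln_ge0 // ltW.
apply: (@le_trans _ _ (2 * (a%:R * ln x) ^+ 2)); last first.
  have L0 : 0 <= a%:R * ln x by rewrite mulr_ge0.
  by move: L0 h; move: (a%:R * ln x) (ln _) => L M; nra.
rewrite (_ : 2 * (a%:R * ln x) ^+ 2 = a%:R ^+ 2 * (2 * ln x ^+ 2)); last by ring.
rewrite -mulrA ler_pM2l ?exprn_gt0 // ler_pdivrMr //.
have := sub1_le_mul_ln x_gt0 => h1.
apply: (@le_trans _ _ ((x * ln x) ^+ 2)).
  by rewrite lerXn2r ?nnegrE ?subr_ge0 ?mulr_ge0 // ltW.
rewrite (_ : (x * ln x) ^+ 2 = (x * x) * ln x ^+ 2); last by ring.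
rewrite (_ : 2 * ln x ^+ 2 * x = (2 * x) * ln x ^+ 2); last by ring.
by rewrite ler_wpM2r ?sqr_ge0 // ler_wpM2r // ltW.
Qed.

(** [2 ^ a <= x ^ a <= n] and [ln 2 >= 1 / 2]. *)
Lemma size_large_saddle : 2 <= x -> a%:R <= 2 * ln (n%:R : R).
Proof.
move=> x2.
have xa : ln (x ^+ a) <= ln (n%:R : R).
  rewrite ler_ln ?posrE ?exprn_gt0 //.
  by apply: (power_le_n x_gt0 saddle_eq); rewrite a_gt0 leqnn.
have l2 : 1 <= 2 * ln (2 : R).
  by have := @sub1_le_mul_ln 2 (ltr0Sn _ 1); lra.
have lx : ln (2 : R) <= ln x by rewrite ler_ln ?posrE.
move: xa; rewrite lnXn // -mulr_natl => xa.
by have := aR; nra.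
Qed.

Let D2_ge0 : 0 <= D2.
Proof.
apply: divr_ge0; last exact: ltW.
by apply: mulr_ge0; exact: sqr_ge0.
Qed.

(** For [x >= 2] the maximal length is at most [2 * l] with [l = ln n], and [x] is at
most [sqrt n] since [x ^ 2 <= n]; so the claim, of the form
[constant * l ^ 4 * x <= n], holds with much room. *)
Lemma tail_exponent_large_saddle (l : R) : l = ln n%:R -> 1 <= l ->
  (140 * l ^+ 4) ^+ 2 <= n%:R -> 2 <= x -> (3 * l + 4) * (2 * (D2 + 1)) <= B.
Proof.
move=> lE l1 hn x2.
have l0 : 0 <= l by apply: le_trans l1.
have x0 := ltW x_gt0.
have gap : D2 + 1 <= 5 * l ^+ 2 * x.
  have a2l := size_large_saddle x2; rewrite -lE in a2l.
  have : D2 <= (2 * l) ^+ 2 * x.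
    apply: (@le_trans _ _ (a%:R ^+ 2 * x)).
      rewrite -mulrA ler_wpM2l ?sqr_ge0 // ler_pdivrMr // -expr2.
      by rewrite lerXn2r ?nnegrE ?subr_ge0 ?(ltW x_gt1) // gerDl.
    by rewrite ler_wpM2r // lerXn2r ?nnegrE ?ler0n ?mulr_ge0.
  have : 1 <= l ^+ 2 * x.
    by rewrite -[leLHS]mulr1 ler_pM ?expr_ge1 // ltW.
  rewrite (_ : (2 * l) ^+ 2 * x = 4 * (l ^+ 2 * x)); last by ring.
  rewrite -[5 * _ * x]mulrA; clear hn; move: (l ^+ 2 * x) D2 => y g; lra.
have xn : x ^+ 2 <= n%:R by apply: (power_le_n x_gt0 saddle_eq); rewrite a_ge2.
(* both factors of the product are at most the square root of n *)
have nl : 140 * l ^+ 4 * x <= n%:R.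
  rewrite -(@ler_pXn2r _ 2) ?nnegrE ?mulr_ge0 ?exprn_ge0 //.
  by rewrite [leRHS]expr2 exprMn ler_pM ?sqr_ge0.
apply: (@le_trans _ _ (7 * l * (2 * (5 * l ^+ 2 * x)))).
  apply: ler_pM.
  - by rewrite addr_ge0 ?mulr_ge0.
  - by rewrite mulr_ge0 // addr_ge0.
  - by clear hn gap nl; lra.
  - by rewrite ler_pM2l.
rewrite ler_pdivlMr //; apply: le_trans nl.
have -> : 140 * l ^+ 4 * x = 7 * l * (2 * (5 * l ^+ 2 * x)) * (2 * l) by ring.
rewrite ler_wpM2l ?mulr_ge0 ?exprn_ge0 //.
by rewrite lE; exact: size_large_saddle.
Qed.

(** By [gap_small_saddle] it suffices that [B >= (3 * l + 4) * 17 * ln (2 * B) ^ 2]. When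
[2 * B <= l ^ 2], [ln (2 * B) <= 2 * ln l] and the right-hand side is
[(204 * l + 272) * (ln l) ^ 2], for which the constant 243 suffices; for larger
[B] the logarithm is negligible. *)
Lemma tail_exponent_small_saddle (l : R) : 8 <= l -> 2 <= ln l ->
  243 * l * ln l ^+ 2 <= B -> (forall u, ln l <= u -> 952 * u ^+ 2 <= expR u) ->
  x <= 2 -> (3 * l + 4) * (2 * (D2 + 1)) <= B.
Proof.
move=> l8 ll2 hB hu x2.
have l0 : 0 < l by apply: lt_le_trans l8.
have B20 : 0 < 2 * B by rewrite mulr_gt0 // divr_gt0.
have ll1 : 1 <= ln l ^+ 2 by rewrite expr_ge1 //; clear hB; lra.
have lB : l <= 2 * B.
  apply: (@le_trans _ _ B); last first.
    by rewrite ler_peMl ?ler1n // (le_trans _ B_ge1).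
  apply: le_trans hB; apply: (@le_trans _ _ (243 * l)).
    by rewrite ler_peMl ?ler1n // ltW.
  by rewrite ler_peMr ?mulr_ge0 ?ler0n ?(ltW l0).
have llB : ln l <= ln (2 * B) by rewrite ler_ln ?posrE.
apply: (@le_trans _ _ ((3 * l + 4) * (17 * ln (2 * B) ^+ 2))).
  rewrite ler_wpM2l ?addr_ge0 ?mulr_ge0 ?(ltW l0) //.
  have := gap_small_saddle x2; move: llB ll2; clear hB.
  by move: D2 (ln (2 * B)) (ln l) => g y z; nra.
have [sm|lg] := leP (2 * B) (l ^+ 2).
  have lB2 : ln (2 * B) <= 2 * ln l.
    rewrite (_ : 2 * ln l = ln (l ^+ 2)); last by rewrite lnXn // mulr_natl.
    by rewrite ler_ln ?posrE ?exprn_gt0.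
  apply: le_trans hB.
  apply: (@le_trans _ _ ((3 * l + 4) * (17 * (2 * ln l) ^+ 2))).
    rewrite ler_wpM2l ?addr_ge0 ?mulr_ge0 ?(ltW l0) // ler_wpM2l // lerXn2r ?nnegrE //.
      by apply: le_trans llB; apply: le_trans ll2.
    by rewrite mulr_ge0 // (le_trans _ ll2).
  rewrite (_ : (3 * l + 4) * (17 * (2 * ln l) ^+ 2) = (204 * l + 272) * ln l ^+ 2); last by ring.
  by rewrite ler_wpM2r ?sqr_ge0 //; lra.
(* here 2 B = e^(2 u) with u >= ln l; as l <= e^u, it remains to compare
   7 e^u * 17 * (2 u)^2 with e^(2 u) / 2, whence 952 = 7 * 17 * 4 * 2 *)
pose u := ln (2 * B) / 2.
have uE : ln (2 * B) = 2 * u by rewrite /u; field.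
have lu : ln l <= u.
  rewrite /u ler_pdivlMr // mulrC (_ : 2 * ln l = ln (l ^+ 2)); last by rewrite lnXn // mulr_natl.
  by rewrite ler_ln ?posrE ?exprn_gt0 // ltW.
have Eu := hu _ lu.
have BE : 2 * B = expR u * expR u.
  by rewrite -expRD -[LHS]lnK ?posrE // uE; congr expR; ring.
have le_u : l <= expR u by rewrite -[leLHS]lnK ?posrE // ler_expR.
have u1 : 1 <= expR u by apply: le_trans le_u; apply: le_trans l8; rewrite ler1n.
have h1 : (3 * l + 4) * (17 * (2 * u) ^+ 2) <= (7 * expR u) * (17 * (2 * u) ^+ 2).
  rewrite ler_wpM2r ?(mulr_ge0 _ (sqr_ge0 _)) //; clear hB Eu BE.
  by move: u1 le_u; move: (expR u) => E; lra.
have h2 : 952 * u ^+ 2 * expR u <= expR u * expR u by apply: ler_wpM2r Eu; exact: expR_ge0.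
rewrite uE; apply: (le_trans h1); rewrite -(@ler_pM2l _ 2) // BE; apply: le_trans h2.
by rewrite le_eqVlt; apply/orP; left; apply/eqP; ring.
Qed.

Lemma tail_exponent_ge (l : R) : l = ln n%:R -> 8 <= l -> 2 <= ln l ->
  243 * l * ln l ^+ 2 <= B -> (140 * l ^+ 4) ^+ 2 <= n%:R ->
  (forall u, ln l <= u -> 952 * u ^+ 2 <= expR u) ->
  3 * l <= B / (2 * (D2 + 1)) - 4.
Proof.
move=> lE l8 ll2 hB hn hu.
have D1 : 0 < 2 * (D2 + 1) by rewrite mulr_gt0 // (le_lt_trans D2_ge0) // ltrDl.
rewrite lerBrDr ler_pdivlMr //.
have [x2|/ltW x2] := leP x 2; first exact: tail_exponent_small_saddle.
by apply: tail_exponent_large_saddle => //; apply: le_trans l8; rewrite ler1n.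
Qed.

End TailExponent.

(** * The characteristic function as a ratio of saddle integrals *)

Lemma limn_esup_lt_near (R : realType) (u : nat -> \bar R) (c : \bar R) :
  (limn_esup u < c)%E -> \forall n \near \oo, (u n < c)%E.
Proof.
rewrite /limn_esup /limf_esup => /ereal_inf_lt[_ [A FA <-]] lt_c.
apply: filterS FA => n An; apply: le_lt_trans lt_c.
by apply: ereal_sup_ubound; exists n.
Qed.

Lemma limn_einf_gt_near (R : realType) (u : nat -> \bar R) (c : \bar R) :
  (c < limn_einf u)%E -> \forall n \near \oo, (c < u n)%E.
Proof.
rewrite /limn_einf lteNr => /limn_esup_lt_near; apply: filterS => n /=.
by rewrite lteN2.
Qed.

(** Half the period when [kap = 1 / sqrt l2]: the variable is scaled by the standard
deviation of the total size. *)
Definition period_half (R : realType) (a : nat) (x : R) : R := pi * Num.sqrt (second_moment a x).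

(** The real part of [e ^ (i b) * exp (\sum_i q_i * (e ^ (i phase_i) - 1 - i phase_i))] at
[psi = t / sqrt l2]. *)
Definition saddle_integrand (R : realType) (a n : nat) (x th b t : R) : R :=
  expR (- cos_defect a n x th (t / Num.sqrt (second_moment a x))) *
  cos (sin_defect a n x th (t / Num.sqrt (second_moment a x)) + b).

Lemma continuous_saddle_integrand (R : realType) (a n : nat) (x th b : R) :
  continuous (saddle_integrand a n x th b).
Proof.
set c := Num.sqrt (second_moment a x).
have dp (i : 'I_a) (t : R) : is_derive t 1 (fun t => phase n x th (t / c) i) (i.+1%:R / c).
  apply: (is_derive_ext (is_derive_affine (i.+1%:R / c)
    (th * (1 - i.+1%:R * (n%:R / second_moment a x))) t)) => // u.
  by rewrite /phase; ring.
have cc : continuous (fun t : R => cos_defect a n x th (t / c)).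
  move=> t; apply: cvg_big => [|i _]; first exact: add_continuous.
  apply: cvgM; first exact: cvg_cst.
  apply: cvgB; first exact: cvg_cst.
  exact: is_derive_continuous (is_derive_cosE (dp i t)).
have cs : continuous (fun t : R => sin_defect a n x th (t / c)).
  move=> t; apply: cvg_big => [|i _]; first exact: add_continuous.
  apply: cvgM; first exact: cvg_cst.
  apply: cvgB; last exact: is_derive_continuous (dp i t).
  exact: is_derive_continuous (is_derive_sinE (dp i t)).
move=> t; apply: cvgM.
  apply: continuous_cvg; first exact: continuous_expR.
  by apply: cvgN; exact: cc.
apply: continuous_cvg; first exact: continuous_cos.
by apply: cvgD; [exact: cs|exact: cvg_cst].
Qed.

Section IntegralFormula.
Context {R : realType}.
Notation mu := (@lebesgue_measure R).
Variables (a n : nat) (x : R).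
Hypotheses (a_gt0 : (0 < a)%N) (x_gt0 : 0 < x).
Hypothesis saddle_eq : \sum_(i < a) x ^+ i.+1 = n%:R.
Notation l2 := (second_moment a x).
Notation m := (mean_count a x).

Definition saddle_integral (th b : R) : R :=
  \int[mu]_(t in `[(- period_half a x), period_half a x]) saddle_integrand a n x th b t.

Let sqrt_second_moment_gt0 : 0 < Num.sqrt l2. Proof. by rewrite sqrtr_gt0 second_moment_gt0. Qed.
Let kap := (Num.sqrt l2)^-1.

Let shift (th : R) (i : 'I_a) : R := th - i.+1%:R * (th * (n%:R / l2)).

(** The linear parts of the phases add up to [m * th] minus the terms in [n], which
the factor of index [n] cancels: this is where the saddle equation enters. *)
Lemma fourier_integrand_saddle th b t :
  fourier_integrand (@length_weight R a x) (shift th) kap 1 n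
    ((m * th - b) - n%:R * (th * (n%:R / l2))) t = expR m * saddle_integrand a n x th b t.
Proof.
rewrite /fourier_integrand /saddle_integrand [RHS]mulrA.
have angleE i : angle (shift th) kap i t =
    phase n x th (t / Num.sqrt l2) i.
  by rewrite /angle /phase /kap /shift; ring.
have -> : re_sum (@length_weight R a x) (shift th) kap 1 t =
    m - cos_defect a n x th (t / Num.sqrt l2).
  rewrite /cos_defect /re_sum /mean_count -sumrB.
  by apply: eq_bigr => i _; rewrite angleE expr1n mulr1; ring.
have -> : im_sum (@length_weight R a x) (shift th) kap 1 t =
    sin_defect a n x th (t / Num.sqrt l2) +
    \sum_(i < a) length_weight x i * phase n x th (t / Num.sqrt l2) i.
  rewrite /sin_defect /im_sum -big_split /=.
  by apply: eq_bigr => i _; rewrite angleE expr1n mulr1 -mulrDr subrK.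
rewrite (sum_phase saddle_eq) -pmulrn expRD.
congr (_ * cos _); rewrite /kap; ring.
Qed.

Lemma integrable_saddle_integrand th b (l u : R) :
  mu.-integrable `[l, u] (EFin \o saddle_integrand a n x th b).
Proof. exact/integrable_itv_continuous/continuous_saddle_integrand. Qed.

Lemma cycle_total_saddle th b :
  x ^+ n / n`!%:R * cycle_total a n (fun k => cos ((k%:R - m) * th + b)) * (2 * period_half a x) =
  expR m * saddle_integral th b.
Proof.
have kap0 : 0 < kap by rewrite invr_gt0.
have : fourier_coeff (@length_weight R a x) (shift th) kap 1 n ((m * th - b) - n%:R * (th * (n%:R / l2))) = _ :=
  cycle_total_fourier a n x th (th * (n%:R / l2)) (m * th - b) kap0.
rewrite /fourier_coeff /kap invrK -/(period_half a x).
under eq_Rintegral do rewrite fourier_integrand_saddle.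
rewrite RintegralZl //; last exact: integrable_saddle_integrand.
rewrite -/(saddle_integral th b) => ->.
have -> : (fun k : nat => cos ((k%:R - m) * th + b)) = (fun k => cos (k%:R * th - (m * th - b))).
  by apply/funext => k; congr cos; ring.
by rewrite /period_half; ring.
Qed.

(** The number of permutations is the case [th = b = 0] of [cycle_total_saddle], so all
normalizing factors disappear from the quotient. *)
Lemma char_fun_saddle th b :
  (\sum_(s in bounded_cycle_perms n a) cos (((num_cycles s)%:R - m) * th + b)) /
    #|bounded_cycle_perms n a|%:R = saddle_integral th b / saddle_integral 0 0.
Proof.
pose K := x ^+ n / n`!%:R * (2 * period_half a x) / expR m.
have p0 : 0 < period_half a x by rewrite mulr_gt0 // pi_gt0.
have f0 : 0 < n`!%:R :> R by rewrite ltr0n fact_gt0.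
have K0 : K != 0.
  rewrite gt_eqF //; apply: divr_gt0; last exact: expR_gt0.
  by apply: mulr_gt0; [rewrite divr_gt0 ?exprn_gt0|rewrite mulr_gt0].
have E th' b' : saddle_integral th' b' = K * cycle_total a n (fun k => cos ((k%:R - m) * th' + b')).
  apply: (@mulfI _ (expR m)); first by rewrite gt_eqF // expR_gt0.
  rewrite -cycle_total_saddle /K; field.
  by rewrite !gt_eqF // expR_gt0.
rewrite !E invfM mulrACA mulfV // mul1r.
rewrite -!cycle_totalE; congr (_ / _).
rewrite -sum1_card natr_sum; apply: eq_bigr => s _.
by rewrite mulr0 addr0 cos0.
Qed.

End IntegralFormula.

(** * An integrable bound for the saddle integrand *)

Section Domination.
Context {R : realType}.
Notation mu := (@lebesgue_measure R).

(** One term for the central range, one for the tail. *)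
Definition dominating (t : R) : R := gauss 8^-1 t + (oneDsqr t)^-1.

Lemma integrable_oneDsqrV : mu.-integrable [set: R] (EFin \o (fun t => (oneDsqr t)^-1)).
Proof.
have c := @continuous_oneDsqrV R.
apply/integrableP; split.
  by apply/measurable_EFinP; exact: continuous_measurable_fun.
have p0 t : 0 <= (oneDsqr t)^-1 :> R by rewrite invr_ge0 (le_trans _ (oneDsqr_ge1 t)).
under eq_integral do rewrite /= ger0_norm //.
rewrite (@ge0_symfun_integralT R (fun t => (oneDsqr t)^-1)) //; last first.
  by move=> t; rewrite /= /oneDsqr sqrrN.
rewrite (_ : [set x | _] = `[0, +oo[%classic); last first.
  by apply/seteqP; split => t /=; rewrite in_itv /= andbT.
by rewrite integral0y_oneDsqr -EFinM ltry.
Qed.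

Lemma integrable_dominating : mu.-integrable [set: R] (EFin \o dominating).
Proof.
by apply: integrableDR => //; [exact: integrable_gauss|exact: integrable_oneDsqrV].
Qed.

(** In the tail the integrand is at most [n ^ -3], while
[1 + t ^ 2 <= 1 + 12 * n ^ 2 <= n ^ 3] as soon as [n >= 13]. *)
Lemma saddle_integrand_dominated (a n : nat) (x th b t : R) :
  (0 < a)%N -> (a < n)%N -> (13 <= n)%N -> 0 < x -> \sum_(i < a) x ^+ i.+1 = n%:R ->
  `|th| <= 1 / 64 -> 2 <= n%:R / a%:R :> R ->
  3 * ln n%:R <= (n%:R / a%:R) / (2 * (a%:R ^+ 2 * (x - 1) ^+ 2 / x + 1)) - 4 ->
  `|t| <= period_half a x ->
  `|saddle_integrand a n x th b t| <= dominating t.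
Proof.
move=> a0 an n13 x0 sE th1 B2 hE ht.
have l20 := second_moment_gt0 a0 x0.
have nR : 0 < n%:R :> R by rewrite ltr0n; apply: leq_trans n13.
have sl : 0 < Num.sqrt (second_moment a x) by rewrite sqrtr_gt0.
set psi := t / Num.sqrt (second_moment a x).
have psiE : psi ^+ 2 * second_moment a x = t ^+ 2.
  by rewrite /psi expr_div_n sqr_sqrtr ?ltW // divfK // gt_eqF.
have psi_pi : `|psi| <= 17 / 5.
  apply: le_trans (@pi_le_17_5 R); rewrite /psi normrM normfV (gtr0_norm sl).
  by rewrite ler_pdivrMr.
rewrite /saddle_integrand -/psi normrM ger0_norm ?expR_ge0 //.
apply: (@le_trans _ _ (expR (- cos_defect a n x th psi))).
  by rewrite ler_piMr ?expR_ge0 // cos_max.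
have q0 : 0 < oneDsqr t by rewrite (lt_le_trans _ (oneDsqr_ge1 t)).
have [cen|tail] := leP (a%:R * `|psi|) 3.
  apply: (@le_trans _ _ (gauss 8^-1 t)); last by rewrite lerDl invr_ge0 ltW.
  rewrite ler_expR lerN2 -psiE mulrC.
  exact: (cos_defect_central a0 an x0 sE).
apply: (@le_trans _ _ (oneDsqr t)^-1); last by rewrite lerDr expR_ge0.
have := cos_defect_tail a0 an x0 sE th1 tail psi_pi B2 => h.
rewrite expRN lef_pV2 ?posrE ?expR_gt0 //.
apply: (@le_trans _ _ (expR (3 * ln n%:R))); last by rewrite ler_expR (le_trans hE).
rewrite expRM_natl lnK ?posrE // /oneDsqr -psiE.
have psi2 : psi ^+ 2 <= 12.
  rewrite -(real_normK (num_real _)); move: psi_pi (normr_ge0 psi).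
  by move: (`|psi|) => y; nra.
have l2n : second_moment a x <= n%:R ^+ 2.
  apply: (le_trans (second_moment_le x0 sE)); rewrite expr2 ler_wpM2r ?ler0n //.
  by rewrite ler_nat ltnW.
have n13R : 13 <= n%:R :> R by rewrite ler_nat.
have h1 : psi ^+ 2 * second_moment a x <= 12 * n%:R ^+ 2.
  by apply: ler_pM => //; [exact: sqr_ge0|exact: ltW].
have h2 : 1 <= n%:R ^+ 2 :> R by rewrite expr_ge1 //; lra.
rewrite (exprS _ 2); move: h1 h2; move: (n%:R ^+ 2) (psi ^+ 2 * _) => y z.
by move: n13R; move: (n%:R) => k; nra.
Qed.

End Domination.

(** * Convergence of the saddle integrals *)

Section Growth.
Context {R : realType}.

Lemma ln_near (P : R -> Prop) :
  (\forall u \near +oo, P u) -> \forall u \near +oo, P (ln u).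
Proof.
move=> [M [_ HM]]; near=> u; apply: HM.
have : expR M < u by near: u; apply: nbhs_pinfty_gt; exact: num_real.
move=> h; have u0 : 0 < u := lt_trans (expR_gt0 M) h.
by rewrite -[ltLHS]expRK ltr_ln ?posrE ?expR_gt0.
Unshelve. all: by end_near. Qed.

Lemma nat_near (P : R -> Prop) :
  (\forall u \near +oo, P u) -> \forall n \near \oo, P n%:R.
Proof. by move=> HP; exact: (cvgr_idn HP). Qed.

Lemma ln_near_ge (K : R) : \forall n \near \oo, K <= ln n%:R.
Proof. by apply: (@nat_near (fun u => K <= ln u)); apply: (@ln_near (fun u => K <= u)); exact/nbhs_pinfty_ge/num_real. Qed.

Lemma ln_ln_near_ge (K : R) : \forall n \near \oo, K <= ln (ln n%:R).
Proof.
apply: (@nat_near (fun u => K <= ln (ln u))); apply: (@ln_near (fun u => K <= ln u)).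
by apply: (@ln_near (fun u => K <= u)); exact/nbhs_pinfty_ge/num_real.
Qed.

End Growth.

Section Limit.
Context {R : realType}.
Notation mu := (@lebesgue_measure R).
Variable alpha : nat -> nat.
Hypothesis alpha_ge4 : \forall n \near \oo, (4 <= alpha n)%N.
Notation B n := (n%:R / (alpha n)%:R : R).
Hypothesis ratio_large : \forall n \near \oo,
  243 * ln (n%:R : R) * ln (ln (n%:R : R)) ^+ 2 <= B n.

Notation saddle_at n := (saddle n (alpha n) (1 : R)).
Definition count_variance_at (n : nat) : R := count_variance (alpha n) n (saddle_at n).
Definition second_moment_at (n : nat) : R := second_moment (alpha n) (saddle_at n).

Lemma ratio_near_ge (K : R) : \forall n \near \oo, K <= B n.
Proof.
near=> n; apply: (@le_trans _ _ (243 * ln (n%:R : R) * ln (ln (n%:R : R)) ^+ 2)); last by near: n.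
have l1 : 1 <= ln (ln (n%:R : R)).
  by near: n; exact: ln_ln_near_ge.
have lK : `|K| <= ln (n%:R : R).
  by near: n; exact: ln_near_ge.
have h : 1 <= ln (ln (n%:R : R)) ^+ 2 by rewrite expr_ge1 //; lra.
have l0 : 0 <= ln (n%:R : R) by apply: le_trans lK.
have := ler_wpM2l l0 h; have := ler_norm K; have := normr_ge0 K.
by rewrite mulr1 -[X in _ -> _ -> _ -> _ <= X]mulrA; lra.
Unshelve. all: by end_near. Qed.

Lemma alpha_lt : \forall n \near \oo, (alpha n < n)%N.
Proof.
near=> n; have B2 : 2 <= B n by near: n; exact: ratio_near_ge.
have a4 : (4 <= alpha n)%N by near: n.
have aR : 0 < (alpha n)%:R :> R by rewrite ltr0n; apply: leq_trans a4.
rewrite -(ltr_nat R); move: B2; rewrite ler_pdivlMr //; lra.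
Unshelve. all: by end_near. Qed.

(** [count_variance_ge] bounds a power of the variance below by [n / alpha n]. *)
Lemma count_variance_near_ge (K : R) : \forall n \near \oo, K <= count_variance_at n.
Proof.
near=> n.
have a4 : (4 <= alpha n)%N by near: n.
have a0 : (0 < alpha n)%N by apply: leq_trans a4.
have an : (alpha n < n)%N by near: n; exact: alpha_lt.
have BK : (8 * `|K|) ^+ 11 < B n.
  apply: (@lt_le_trans _ _ ((8 * `|K|) ^+ 11 + 1)); first by rewrite ltrDl.
  by near: n; exact: ratio_near_ge.
have x0 := @saddle1_gt0 R _ _ a0 an; have sE := @saddle1_eq R _ _ a0 an.
have := count_variance_ge a0 an x0 sE a4; rewrite -/(count_variance_at n) => hB.
rewrite leNgt; apply/negP => vK.
have v0 : 0 <= count_variance_at n.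
  by apply: sumr_ge0 => i _; rewrite mulr_ge0 ?sqr_ge0 // ltW // length_weight_gt0.
have : (8 * count_variance_at n) ^+ 11 <= (8 * `|K|) ^+ 11.
  rewrite lerXn2r ?nnegrE ?mulr_ge0 // ler_pM2l //.
  by apply: le_trans (ler_norm K); exact: ltW.
by rewrite leNgt (lt_le_trans BK hB).
Unshelve. all: by end_near. Qed.

Lemma tail_exponent_near : \forall n \near \oo,
  3 * ln (n%:R : R) <= B n / (2 * ((alpha n)%:R ^+ 2 * (saddle_at n - 1) ^+ 2 / saddle_at n + 1)) - 4.
Proof.
have [M [_ HM]] := @expR_dominates R 2 952.
near=> n.
have a4 : (4 <= alpha n)%N by near: n.
have a0 : (0 < alpha n)%N by apply: leq_trans a4.
have an : (alpha n < n)%N by near: n; exact: alpha_lt.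
have n0 : 0 < n%:R :> R by rewrite ltr0n; apply: leq_trans an.
have x0 := @saddle1_gt0 R _ _ a0 an; have sE := @saddle1_eq R _ _ a0 an.
apply: (tail_exponent_ge (leq_trans _ a4) an x0 sE (erefl _)) => //.
- by near: n; exact: ln_near_ge.
- by near: n; exact: ln_ln_near_ge.
- by near: n.
- rewrite -[leRHS]lnK ?posrE // exprMn -exprM.
  near: n; apply: (@nat_near _ (fun u => 140 ^+ 2 * ln u ^+ 8 <= expR (ln u))).
  apply: (@ln_near _ (fun u => 140 ^+ 2 * u ^+ 8 <= expR u)).
  exact: expR_dominates.
- move=> u hu; apply: HM; apply: lt_le_trans hu.
  apply: (@lt_le_trans _ _ (M + 1)); first by rewrite ltrDl.
  by near: n; exact: ln_ln_near_ge.
Unshelve. all: by end_near. Qed.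

(** The quantity is the bound of [phase_le] on all phases. The first term vanishes as
the variance grows; for the second, [second_moment_ge] makes [alpha n ^ 2 / l2] of
order [alpha n / n]. *)
Lemma phase_bound_cvg0 (tau t : R) :
  `|tau / Num.sqrt (count_variance_at n)| + (alpha n)%:R * `|t / Num.sqrt (second_moment_at n)| @[n --> \oo] --> 0.
Proof.
apply/cvgrPdist_le => e e0; near=> n.
have a4 : (4 <= alpha n)%N by near: n.
have a0 : (0 < alpha n)%N by apply: leq_trans a4.
have an : (alpha n < n)%N by near: n; exact: alpha_lt.
have x0 := @saddle1_gt0 R _ _ a0 an; have sE := @saddle1_eq R _ _ a0 an.
have aR : 0 < (alpha n)%:R :> R by rewrite ltr0n.
have nR : 0 < n%:R :> R by rewrite ltr0n; apply: leq_trans an.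
have l20 : 0 < second_moment_at n := second_moment_gt0 a0 x0.
have small (y s : R) : 0 < s -> (2 * y / e) ^+ 2 <= s -> `|y| / Num.sqrt s <= e / 2.
  move=> s0 ys; have ss : 0 < Num.sqrt s by rewrite sqrtr_gt0.
  rewrite ler_pdivrMr //.
  have : `|2 * y / e| <= Num.sqrt s by rewrite -sqrtr_sqr ler_wsqrtr.
  rewrite normrM normfV (gtr0_norm e0) ler_pdivrMr // normrM gtr0_norm //; lra.
have h1 : `|tau / Num.sqrt (count_variance_at n)| <= e / 2.
  have v1 : 1 <= count_variance_at n by near: n; exact: count_variance_near_ge.
  rewrite normrM normfV (ger0_norm (sqrtr_ge0 _)); apply: small; first lra.
  by near: n; exact: count_variance_near_ge.
have h2 : (alpha n)%:R * `|t / Num.sqrt (second_moment_at n)| <= e / 2.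
  rewrite normrM normfV (ger0_norm (sqrtr_ge0 _)) mulrA -[(alpha n)%:R]gtr0_norm // -normrM.
  apply: small => //.
  have hB : 2 * (2 * t / e) ^+ 2 <= B n by near: n; exact: ratio_near_ge.
  have := second_moment_ge a0 an x0 sE; rewrite -/(second_moment_at n) -natr1 => h.
  move: hB; rewrite ler_pdivlMr // => hB.
  have -> : (2 * ((alpha n)%:R * t) / e) ^+ 2 = (alpha n)%:R ^+ 2 * (2 * t / e) ^+ 2.
    by rewrite -exprMn; congr (_ ^+ 2); ring.
  move: hB; move: ((2 * t / e) ^+ 2) => y hB.
  by apply: le_trans h; nra.
rewrite sub0r normrN ger0_norm ?addr_ge0 ?mulr_ge0 //; lra.
Unshelve. all: by end_near. Qed.

Definition saddle_integral_at (tau b : R) (n : nat) : R :=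
  saddle_integral (alpha n) n (saddle_at n) (tau / Num.sqrt (count_variance_at n)) b.

(** Outside one period the integrand is extended by [0]; each fixed [t] lies in the
period eventually because the second moment grows. *)
Lemma saddle_integral_cvg (tau b : R) :
  saddle_integral_at tau b n @[n --> \oo] --> gauss 2^-1 tau * cos b * \int[mu]_t gauss 2^-1 t.
Proof.
rewrite -RintegralZl //; last exact: integrable_gauss.
rewrite /saddle_integral_at /saddle_integral.
under eq_cvg do rewrite Rintegral_mkcond.
apply: (@dominated_cvg_lebesgue _ _ _ _ dominating) => //.
- move=> n.
  have mI : measurable (`[(- period_half (alpha n) (saddle_at n)), period_half (alpha n) (saddle_at n)]%classic : set R).
    exact: measurable_itv.
  apply: (measurable_restrictT _ mI).1; apply: measurable_funTS.
  apply: continuous_measurable_fun; exact: continuous_saddle_integrand.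
- move=> t _.
  pose d n : R := `|tau / Num.sqrt (count_variance_at n)| + (alpha n)%:R * `|t / Num.sqrt (second_moment_at n)|.
  have d0 : d n @[n --> \oo] --> 0 := phase_bound_cvg0 tau t.
  pose C n := cos_defect (alpha n) n (saddle_at n) (tau / Num.sqrt (count_variance_at n)) (t / Num.sqrt (second_moment_at n)).
  pose S n := sin_defect (alpha n) n (saddle_at n) (tau / Num.sqrt (count_variance_at n)) (t / Num.sqrt (second_moment_at n)).
  pose W : R := tau ^+ 2 + t ^+ 2.
  have WE : \forall n \near \oo, [/\ (0 < alpha n)%N, (alpha n < n)%N &
      (tau / Num.sqrt (count_variance_at n)) ^+ 2 * count_variance_at n + (t / Num.sqrt (second_moment_at n)) ^+ 2 * second_moment_at n = W].
    near=> n.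
    have a4 : (4 <= alpha n)%N by near: n.
    have a0 : (0 < alpha n)%N by apply: leq_trans a4.
    have an : (alpha n < n)%N by near: n; exact: alpha_lt.
    have x0 := @saddle1_gt0 R _ _ a0 an.
    have l20 : 0 < second_moment_at n := second_moment_gt0 a0 x0.
    have v1 : 1 <= count_variance_at n by near: n; exact: count_variance_near_ge.
    have v0 : 0 < count_variance_at n by lra.
    by split => //; rewrite !expr_div_n !sqr_sqrtr ?ltW // !divfK // gt_eqF.
  have cC : C n @[n --> \oo] --> W / 2.
    apply/subr_cvg0; apply: norm_cvg0.
    apply: (@squeeze_cvgr _ _ _ _ (fun=> 0) (fun n => d n * d n * W)).
    - near=> n.
      have [a0 an <-] : [/\ (0 < alpha n)%N, (alpha n < n)%N &
        (tau / Num.sqrt (count_variance_at n)) ^+ 2 * count_variance_at n + (t / Num.sqrt (second_moment_at n)) ^+ 2 * second_moment_at n = W] by near: n.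
      have x0 := @saddle1_gt0 R _ _ a0 an; have sE := @saddle1_eq R _ _ a0 an.
      by rewrite normr_ge0 /= -expr2; exact: (cos_defect_near a0 an x0 sE).
    - exact: cvg_cst.
    - rewrite -[X in _ --> X](mul0r W); apply: cvgM; last exact: cvg_cst.
      by rewrite -[X in _ --> X](mul0r 0); apply: cvgM.
  have cS : S n @[n --> \oo] --> 0.
    apply: norm_cvg0.
    apply: (@squeeze_cvgr _ _ _ _ (fun=> 0) (fun n => d n * W)).
    - near=> n.
      have [a0 an <-] : [/\ (0 < alpha n)%N, (alpha n < n)%N &
        (tau / Num.sqrt (count_variance_at n)) ^+ 2 * count_variance_at n + (t / Num.sqrt (second_moment_at n)) ^+ 2 * second_moment_at n = W] by near: n.
      have x0 := @saddle1_gt0 R _ _ a0 an; have sE := @saddle1_eq R _ _ a0 an.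
      by rewrite normr_ge0 /=; exact: (sin_defect_near a0 an x0 sE).
    - exact: cvg_cst.
    - by rewrite -[X in _ --> X](mul0r W); apply: cvgM; [exact: d0|exact: cvg_cst].
  have -> : gauss 2^-1 tau * cos b * gauss 2^-1 t = expR (- (W / 2)) * cos (0 + b).
    rewrite add0r mulrAC /gauss -expRD; congr (expR _ * _).
    by rewrite /W; field.
  have H : expR (- C n) * cos (S n + b) @[n --> \oo] --> expR (- (W / 2)) * cos (0 + b).
    apply: cvgM.
      apply: continuous_cvg; first exact: continuous_expR.
      exact: cvgN.
    apply: continuous_cvg; first exact: continuous_cos.
    by apply: cvgD => //; exact: cvg_cst.
  apply: cvg_trans H; apply: near_eq_cvg; near=> n; rewrite patchE mem_set //= in_itv /= -ler_norml.
    have a4 : (4 <= alpha n)%N by near: n.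
    have a0 : (0 < alpha n)%N by apply: leq_trans a4.
    have an : (alpha n < n)%N by near: n; exact: alpha_lt.
    have x0 := @saddle1_gt0 R _ _ a0 an.
    have l20 : 0 < second_moment_at n := second_moment_gt0 a0 x0.
    have sl : 0 < Num.sqrt (second_moment_at n) by rewrite sqrtr_gt0.
    have dn : d n <= 1.
      apply: (le_trans (ler_norm _)); rewrite -normrN -sub0r.
      near: n; have e0 : 0 < 1 :> R by [].
      by have /cvgrPdist_le/(_ _ e0) := d0.
    have a1 : 1 <= (alpha n)%:R :> R by rewrite ler1n.
    have h : `|t / Num.sqrt (second_moment_at n)| <= 1.
      apply: le_trans dn; apply: (@le_trans _ _ ((alpha n)%:R * `|t / Num.sqrt (second_moment_at n)|)).
        by rewrite ler_peMl.
      by rewrite /d lerDr.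
    move: h; rewrite normrM normfV (gtr0_norm sl) ler_pdivrMr // mul1r => h.
    apply: (le_trans h); rewrite /period_half -/(second_moment_at n) ler_peMl ?ltW //.
    by have := @pi_ge2 R; lra.
- exact: integrable_dominating.
- near=> n => t _.
  have a4 : (4 <= alpha n)%N by near: n.
  have a0 : (0 < alpha n)%N by apply: leq_trans a4.
  have an : (alpha n < n)%N by near: n; exact: alpha_lt.
  have x0 := @saddle1_gt0 R _ _ a0 an; have sE := @saddle1_eq R _ _ a0 an.
  rewrite patchE; case: ifP => [|_]; last first.
    by rewrite normr0 addr_ge0 ?expR_ge0 // invr_ge0 (le_trans _ (oneDsqr_ge1 t)).
  move=> /set_mem /=; rewrite in_itv /= -ler_norml => ht.
  apply: saddle_integrand_dominated => //.
  - by near: n; exact: nbhs_infty_ge.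
  - have h : `|tau / Num.sqrt (count_variance_at n)| + (alpha n)%:R * `|(0 : R) / Num.sqrt (second_moment_at n)| <= 1 / 64.
      apply: (le_trans (ler_norm _)); rewrite -normrN -sub0r.
      near: n; have e0 : 0 < 1 / 64 :> R by [].
      by have /cvgrPdist_le/(_ _ e0) := phase_bound_cvg0 tau 0.
    by move: h; rewrite mul0r normr0 mulr0 addr0.
  - by near: n; exact: ratio_near_ge.
  - by near: n; exact: tail_exponent_near.
Unshelve. all: by end_near. Qed.

End Limit.

(** * Convergence in distribution of the number of cycles *)

Lemma bounded_cycle_perms_card_gt0 (n a : nat) : ((0 < n)%N -> (0 < a)%N) ->
  (0 < #|bounded_cycle_perms n a|)%N.
Proof.
move=> a0; apply/card_gt0P; exists 1%g; rewrite inE; apply/forall_inP => A /imsetP[i _ ->].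
rewrite (_ : porbit 1%g i = [set i]%SET) ?cards1 ?a0 //; first exact: leq_ltn_trans (ltn_ord i).
apply/finset.setP => j; rewrite inE; apply/porbitP/eqP => [[k ->]|->].
  by rewrite expg1n perm1.
by exists 0%N; rewrite expg0 perm1.
Qed.

Section CycleCount.
Context {R : realType}.
Variable alpha : nat -> nat.
Hypothesis alpha_pos : forall n, (0 < n)%N -> (0 < alpha n)%N.
Hypothesis alpha_ge4 : \forall n \near \oo, (4 <= alpha n)%N.
Hypothesis ratio_large : \forall n \near \oo,
  243 * ln (n%:R : R) * ln (ln (n%:R : R)) ^+ 2 <= n%:R / (alpha n)%:R.

Notation Sa n := (bounded_cycle_perms n (alpha n)).

(** The uniform distribution as weights on all of ['S_n], the form in which the
continuity theorem takes a distribution. *)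
Definition unif_weight (n : nat) (s : 'S_n) : R := (s \in Sa n)%:R / #|Sa n|%:R.

Definition scaled_count (n : nat) (s : 'S_n) : R :=
  ((num_cycles s)%:R - mean_count (alpha n) (saddle n (alpha n) (1 : R))) / Num.sqrt (count_variance_at alpha n).

Let card_perms_gt0 n : 0 < #|Sa n|%:R :> R.
Proof. by rewrite ltr0n; apply: bounded_cycle_perms_card_gt0; exact: alpha_pos. Qed.

Lemma sum_unif_weight n (f : 'S_n -> R) :
  \sum_s unif_weight s * f s = (\sum_(s in Sa n) f s) / #|Sa n|%:R.
Proof.
rewrite mulr_suml [RHS]big_mkcond /=; apply: eq_bigr => s _.
by rewrite /unif_weight; case: (s \in _); rewrite ?mul0r // mul1r mulrC.
Qed.

(** Both the numerator and the denominator in [char_fun_saddle] converge, the latter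
to the Gaussian integral. *)
Lemma char_fun_cvg (tau b : R) :
  \sum_(s : 'S_n) unif_weight s * cos (tau * scaled_count s - b) @[n --> \oo] --> gauss 2^-1 tau * cos b.
Proof.
have I0 : \int[@lebesgue_measure R]_t gauss 2^-1 t != 0.
  by rewrite Rintegral_gauss // gt_eqF // sqrtr_gt0 divr_gt0 // pi_gt0.
have -> : gauss 2^-1 tau * cos b =
    (gauss 2^-1 tau * cos (- b) * \int[@lebesgue_measure R]_t gauss 2^-1 t) /
    (gauss 2^-1 0 * cos 0 * \int[@lebesgue_measure R]_t gauss 2^-1 t).
  rewrite cosN cos0 /gauss expr0n /= mulr0 oppr0 expR0 !mul1r mulfK //.
have H1 := @saddle_integral_cvg R alpha alpha_ge4 ratio_large tau (- b).
have H0 := @saddle_integral_cvg R alpha alpha_ge4 ratio_large 0 0.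
have L0 : gauss 2^-1 0 * cos 0 * \int[@lebesgue_measure R]_t gauss 2^-1 t != 0.
  by rewrite cos0 /gauss expr0n /= mulr0 oppr0 expR0 !mul1r.
apply: cvg_trans (cvgM H1 (cvgV L0 H0)).
apply: near_eq_cvg; near=> n.
have a4 : (4 <= alpha n)%N by near: n.
have a0 : (0 < alpha n)%N by apply: leq_trans a4.
have an : (alpha n < n)%N by near: n; exact: (alpha_lt alpha_ge4 ratio_large).
have x0 := @saddle1_gt0 R _ _ a0 an; have sE := @saddle1_eq R _ _ a0 an.
rewrite sum_unif_weight /= /saddle_integral_at mul0r.
rewrite -(char_fun_saddle a0 x0 sE); congr (_ / _); apply: eq_bigr => s _.
by congr cos; rewrite /scaled_count; ring.
Unshelve. all: by end_near. Qed.

Lemma scaled_count_cvg (z : R) :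
  \sum_(s : 'S_n | scaled_count s <= z) unif_weight s @[n --> \oo] --> std_normal_cdf z.
Proof.
apply: (@continuity_theorem_normal R (fun n => 'S_n) (fun n => @unif_weight n)
  (fun n => @scaled_count n)).
- by move=> n s; rewrite divr_ge0.
- move=> n; rewrite -(@mulfV _ #|Sa n|%:R); last by rewrite gt_eqF.
  under eq_bigr do rewrite -[unif_weight _]mulr1.
  by rewrite sum_unif_weight sumr_const.
- exact: char_fun_cvg.
Qed.

Lemma unif_prob_cvg (z : R) :
  unif_prob R (alpha n) (fun s : 'S_n => (num_cycles s)%:R - mean_cycles R n (alpha n)
      <= z * Num.sqrt (var_cycles R n (alpha n))) @[n --> \oo] --> std_normal_cdf z.
Proof.
apply: cvg_trans (@scaled_count_cvg z); apply: near_eq_cvg; near=> n.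
have a4 : (4 <= alpha n)%N by near: n.
have a0 : (0 < alpha n)%N by apply: leq_trans a4.
have an : (alpha n < n)%N by near: n; exact: (alpha_lt alpha_ge4 ratio_large).
have v1 : 1 <= count_variance_at alpha n :> R by near: n; exact: (count_variance_near_ge alpha_ge4 ratio_large).
have v0 : 0 < Num.sqrt (count_variance_at alpha n : R) by rewrite sqrtr_gt0; lra.
rewrite big_mkcond /= (eq_bigr (fun s : 'S_n => unif_weight s * (scaled_count s <= z)%R%:R)); last first.
  by move=> s _; case: ifP; rewrite ?mulr1 ?mulr0.
rewrite sum_unif_weight /unif_prob; congr (_ / _).
rewrite -sum1_card natr_sum big_mkcond [RHS]big_mkcond /=; apply: eq_bigr => s _.
rewrite [in RHS]inE; case: (s \in _) => //=.
rewrite /scaled_count ler_pdivrMr // mean_cyclesE (var_cyclesE a0 an).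
by case: ifP.
Unshelve. all: by end_near. Qed.

End CycleCount.

(** [12 * pi ^ 2 * e >= 12 * 9 * 9 / 4 = 243]. *)
Lemma size_condition (R : realType) (alpha : nat -> nat) :
  (\forall n \near \oo, (4 <= alpha n)%N) ->
  (limn_esup (fun n : nat =>
         ((alpha n)%:R / n%:R * ln (n%:R : R) * (ln (ln (n%:R : R))) ^+ 2)%:E)
       < (1 / (12%:R * pi ^+ 2 * expR 1))%:E)%E ->
  \forall n \near \oo, 243 * ln (n%:R : R) * ln (ln (n%:R : R)) ^+ 2 <= n%:R / (alpha n)%:R.
Proof.
move=> a4' /limn_esup_lt_near h; near=> n.
have : (((alpha n)%:R / n%:R * ln (n%:R : R) * (ln (ln (n%:R : R))) ^+ 2)%:E
  < (1 / (12%:R * pi ^+ 2 * expR 1))%:E)%E by near: n.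
have a4 : (4 <= alpha n)%N by near: n.
have aR : 0 < (alpha n)%:R :> R by rewrite ltr0n; apply: leq_trans a4.
have nR : 0 < n%:R :> R by rewrite ltr0n; near: n; exact: nbhs_infty_gt.
have c243 : 243 <= 12%:R * pi ^+ 2 * expR 1 :> R.
  have p9 : 9 <= pi ^+ 2 :> R.
    by rewrite (_ : 9 = 3 ^+ 2); [rewrite lerXn2r ?nnegrE ?pi_ge0 // pi_ge3|ring].
  have := @expR1_ge R; move: p9; move: (pi ^+ 2) (expR 1) => p e; nra.
rewrite lte_fin ltr_pdivlMr; last by apply: lt_le_trans c243.
pose y : R := ln n%:R * ln (ln n%:R) ^+ 2.
have y0 : 0 <= y by rewrite mulr_ge0 ?sqr_ge0 //; near: n; exact: ln_near_ge.
have -> : (alpha n)%:R / n%:R * ln (n%:R : R) * ln (ln (n%:R : R)) ^+ 2 = (alpha n)%:R / n%:R * y.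
  by rewrite /y; ring.
move=> hlt; have -> : 243 * ln (n%:R : R) * ln (ln (n%:R : R)) ^+ 2 = 243 * y by rewrite /y; ring.
rewrite ler_pdivlMr // -[n%:R]mul1r -ler_pdivrMr //.
have -> : 243 * y * (alpha n)%:R / n%:R = (alpha n)%:R / n%:R * y * 243 by ring.
apply: ltW; apply: le_lt_trans hlt; rewrite ler_wpM2l //.
by apply: mulr_ge0 => //; apply: divr_ge0; exact: ltW.
Unshelve. all: by end_near. Qed.

Theorem theorem1 (R : realType) (alpha : nat -> nat)
    (alpha_pos : forall n : nat, (0 < n)%N -> (0 < alpha n)%N)
    (alpha_liminf :
      (4%:R%:E <= limn_einf (fun n : nat => ((alpha n)%:R : R)%:E))%E)
    (alpha_limsup :
      (limn_esup (fun n : nat =>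
         ((alpha n)%:R / n%:R * ln (n%:R : R) * (ln (ln (n%:R : R))) ^+ 2)%:E)
       < (1 / (12%:R * pi ^+ 2 * expR 1))%:E)%E)
    (z : R) :
  (fun n : nat =>
     unif_prob R (alpha n)
       (fun s : 'S_n =>
          (num_cycles s)%:R - mean_cycles R n (alpha n)
          <= z * Num.sqrt (var_cycles R n (alpha n)))) @ \oo
  --> std_normal_cdf z.
Proof.
have a4 : \forall n \near \oo, (4 <= alpha n)%N.
  have lt34 : (3%:R%:E < limn_einf (fun n : nat => ((alpha n)%:R : R)%:E))%E.
    by apply: lt_le_trans alpha_liminf; rewrite lte_fin ltr_nat.
  move/limn_einf_gt_near : lt34; apply: filterS => n.
  by rewrite lte_fin ltr_nat.
exact: (unif_prob_cvg alpha_pos a4 (size_condition a4 alpha_limsup)).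
Qed.
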